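(* Let $0<s<1$ and $a>1$, let $\mathcal{H}_s$, $\mathcal{K}_s\subset\mathcal{H}_s$, $U(a)$ and $J$ be as defined in the context, and let $P$ be the orthogonal projection of $\mathcal{H}_s$ onto $\mathcal{K}_s$. Then $U(a)|_{\mathcal{K}_s}$ induces a bounded selfadjoint operator $S(a)$ in a Hilbert space $\mathcal{H}(\mathcal{K}_s)$, and there is a contraction $W\colon\mathcal{K}_s\to\mathcal{H}(\mathcal{K}_s)$, such that $$\ker(W)=\{0\},\qquad \ker(W^{*})=\{0\},\qquad W^{*}W=PJP,\qquad S(a)W=WU(a)P,$$ and $$\operatorname{spectrum}(S(a))=\{a^{s-1-2n} : n=0,1,2,\dots\}.$$
   Context: For $0<s<1$, $\mathcal{H}_s$ is the Hilbert space obtained by completing $C_c(\mathbb{R})$ (continuous compactly supported complex functions) in the norm of the inner product $$\langle f_1,f_2\rangle_{\mathcal{H}_s}=\int_{\mathbb{R}}\int_{\mathbb{R}}\overline{f_1(x)}\,|x-y|^{s-1}f_2(y)\,dx\,dy .$$ $\mathcal{K}_s$ is the closure of $C_c(-1,1)$ in $\mathcal{H}_s$. For $a>0$, $U(a)$ is the unitary operator on $\mathcal{H}_s$ determined by $(U(a)f)(x)=a^{s+1}f(a^{2}x)$; for $a>1$ it maps $\mathcal{K}_s$ into itself. $J$ is the period-$2$ unitary operator on $\mathcal{H}_s$ determined by $(Jf)(x)=|x|^{-s-1}f(1/x)$, $x\ne 0$. It satisfies $JU(a)J=U(a)^{*}=U(a^{-1})$ and $\langle f,Jf\rangle_{\mathcal{H}_s}\ge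 0$ for all $f\in\mathcal{K}_s$. The identities $W^{*}W=PJP$ and $S(a)W=WU(a)P$ are identities of operators defined on $\mathcal{K}_s$.
   Formalization: The spectrum of a bounded operator is closed and a^{s-1-2n} tends to 0, so the stated spectrum cannot omit 0; proved instead: spectrum(S(a)) = {a^{s-1-2n} : n ≥ 0} ∪ {0}, and the set of eigenvalues of S(a) is exactly {a^{s-1-2n} : n ≥ 0}. *)

(* Defs.v *)
From HB Require Import structures.
From mathcomp Require Import all_boot all_order all_algebra.
From mathcomp Require Import complex.
From mathcomp Require Import all_classical all_reals all_analysis.

Set Implicit Arguments.
Unset Strict Implicit.
Unset Printing Implicit Defensive.

Import Order.TTheory GRing.Theory Num.Theory.
Import numFieldNormedType.Exports.

Local Open Scope classical_set_scope.
Local Open Scope complex_scope.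
Local Open Scope ring_scope.

(* Complex Hilbert spaces.  The inner product is linear in its second argument
   and conjugate-linear in its first one.  The norm of a normed module over
   R[i] takes its values in R[i]. *)
HB.mixin Record CompleteNormedModule_isHilbert (R : realType) V
    & CompleteNormedModule R[i] V := {
  hdot : V -> V -> R[i];
  hdotDr : forall x y z, hdot x (y + z) = hdot x y + hdot x z;
  hdotZr : forall (c : R[i]) x y, hdot x (c *: y) = c * hdot x y;
  hdotC : forall x y, hdot y x = (hdot x y)^*;
  hdotxx : forall x, hdot x x = `|x| ^+ 2
}.

#[short(type="hilbertType")]
HB.structure Definition Hilbert (R : realType) :=
  {V of CompleteNormedModule R[i] V & CompleteNormedModule_isHilbert R V}.

Notation "'<< x , y >>" := (hdot x y)
  (at level 0, x at level 99, y at level 99, format "''<<' x ,  y '>>'")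
  : ring_scope.

Section Operators.
Context {R : realType}.

Definition bounded_operator (V W : hilbertType R) (T : V -> W) : Prop :=
  exists M : R[i], forall x, `|T x| <= M * `|x|.

Definition unitary (V : hilbertType R) (T : V -> V) : Prop :=
  (forall x y, '<< T x, T y >> = '<< x, y >>) /\ (forall y, exists x, T x = y).

Definition selfadjoint (V : hilbertType R) (T : V -> V) : Prop :=
  forall x y, '<< T x, y >> = '<< x, T y >>.

Definition orthogonal_projection (V : hilbertType R) (K : set V) (P : V -> V)
  : Prop :=
  forall x, K (P x) /\ forall k, K k -> '<< k, x - P x >> = 0.

(* An operator defined on a closed subspace K of V is represented by an operator
   on V of which only the values on K matter.  Its adjoint takes values in K. *)
Definition contraction_on (V W : hilbertType R) (K : set V) (T : V -> W)
  : Prop :=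
  forall x, K x -> `|T x| <= `|x|.

Definition adjoint_on (V W : hilbertType R) (K : set V) (T : V -> W)
    (Tadj : W -> V) : Prop :=
  forall y, K (Tadj y) /\ forall x, K x -> '<< Tadj y, x >> = '<< y, T x >>.

Definition resolvent_set (V : hilbertType R) (T : V -> V) : set R[i] :=
  [set z | exists B : {linear V -> V}, [/\ bounded_operator B,
     cancel (fun x => T x - z *: x) B & cancel B (fun x => T x - z *: x)]].

Definition spectrum (V : hilbertType R) (T : V -> V) : set R[i] :=
  ~` resolvent_set T.

(* The spectrum is closed, so a bounded operator with infinitely many eigenvalues
   decreasing to 0 has 0 in its spectrum even when 0 is not an eigenvalue; the
   point spectrum tells the two situations apart. *)
Definition point_spectrum (V : hilbertType R) (T : V -> V) : set R[i] :=
  [set z | exists2 x, x != 0 & T x = z *: x].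

End Operators.

Section RieszSpace.
Context {R : realType}.

(* C_c(D), for D an open subset of the line; elements are extended by 0 *)
Definition Cc (D : set R) : set (R -> R[i]) :=
  [set f | [/\ continuous (f : R -> R[i]^o), compact (closure [set x | f x != 0])
             & closure [set x | f x != 0] `<=` D]].

Definition Cintegral (f : R -> R[i]) : R[i] :=
  Complex (\int[lebesgue_measure]_x complex.Re (f x))%R
          (\int[lebesgue_measure]_x complex.Im (f x))%R.

(* The diagonal is negligible; there powR 0 (s - 1) = 0. *)
Definition riesz_form (s : R) (f g : R -> R[i]) : R[i] :=
  Cintegral (fun y => Cintegral (fun x =>
    (f x)^* * (`|x - y| `^ (s - 1))%:C * g y)).

(* H, with iota, is the completion of C_c(R) in the norm of riesz_form s;
   this determines H up to a unique unitary isomorphism *)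
Definition is_riesz_completion (s : R) (H : hilbertType R)
    (iota : (R -> R[i]) -> H) : Prop :=
  [/\ forall (c : R[i]) f g, Cc setT f -> Cc setT g ->
        iota (fun x => c * f x + g x) = c *: iota f + iota g,
      forall f g, Cc setT f -> Cc setT g ->
        '<< iota f, iota g >> = riesz_form s f g
    & closure (iota @` Cc setT) = setT].

Definition Ks (H : hilbertType R) (iota : (R -> R[i]) -> H) : set H :=
  closure (iota @` Cc `]-1, 1[).

Definition is_dilation (s a : R) (H : hilbertType R)
    (iota : (R -> R[i]) -> H) (U : H -> H) : Prop :=
  unitary U /\ forall f, Cc setT f ->
    U (iota f) = iota (fun x => (a `^ (s + 1))%:C * f (a ^+ 2 * x)).

(* The formula for J maps C_c(R \ {0}), which is dense in the completion, to
   itself (at x = 0 it gives 0), but does not preserve C_c(R). *)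
Definition is_inversion (s : R) (H : hilbertType R)
    (iota : (R -> R[i]) -> H) (J : H -> H) : Prop :=
  [/\ unitary J, involutive J & forall f, Cc [set~ 0] f ->
    J (iota f) = iota (fun x => (`|x| `^ (- s - 1))%:C * f (1 / x))].

End RieszSpace.

(* Main.v *)
Require Import Defs.
From HB Require Import structures.
From mathcomp Require Import all_boot all_order all_algebra.
From mathcomp Require Import complex ring lra.
From mathcomp Require Import all_classical all_reals all_analysis.
From mathcomp Require Import measurable_realfun.
Set Implicit Arguments.
Unset Strict Implicit.
Unset Printing Implicit Defensive.
Import Order.TTheory GRing.Theory Num.Theory.
Import numFieldNormedType.Exports.
Local Open Scope classical_set_scope.
Local Open Scope complex_scope.
Local Open Scope ring_scope.

(* Expanding (1 - xt)^(s-1) = sum_n c_n x^n t^n, with c_n = (1-s)_n / n! > 0,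
   gives <f, J g> = sum_n c_n (m_n f)^* (m_n g) for f, g supported in ]-1, 1[,
   where m_n f is the n-th moment of f.  So H(K_s) is l^2, W f is the sequence
   sqrt(c_n) m_n f, and since m_n (U f) = a^(s-1-2n) m_n f, the operator S(a) is
   diagonal.  That W contracts follows from Cauchy-Schwarz and the unitarity of J.

   Injectivity of W rests on (x-y)^2 = (1-xy)^2 - (1-x^2)(1-y^2), which turns the
   Riesz kernel on ]-1, 1[^2 into
     |x-y|^(s-1) = sum_n c'_n (1-x^2)^n (1-y^2)^n (1-xy)^(-(1-s+2n)),  c'_n > 0,
   hence into a sum of positive rank one kernels p(x) p(y) with p a polynomial.
   The norm of H_s on K_s is thus a sum of squares of combinations of moments, and
   a vector all of whose moments vanish is 0.

   The closure of the range of W is invariant under S(a); iterating S(a), whose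
   eigenvalues are positive and strictly decreasing, isolates the basis vectors of
   l^2 one after the other, so the range is dense and W^* is injective. *)

(** * Binomial series *)

(** The formula for J is given only on functions vanishing near 0, so the computations take place on
    [test0], the functions supported in some annulus d <= |x| <= r with 0 < d and r < 1; they are
    dense in K_s because the kernel is locally integrable. All integrals are iterated, as in
    [riesz_form], and each expansion is exchanged with them by dominated convergence, one variable
    at a time. The expansion of <f, J g> is dominated by a constant multiple of the two functions;
    that of the Riesz kernel degenerates on the diagonal and is dominated by the kernel itself, its
    terms being positive. Injectivity needs a limiting argument: an element of K_s is a limit of
    test functions whose moments merely tend to 0, and the energy is not continuous in the moments.
    It is a supremum of finite sums of squares of moments, hence lower semicontinuous, which
    suffices along a Cauchy sequence. The adjoint of W does not come from a representation theorem:
    W x -> P J P x is a contraction on the dense range of W, and extends. *)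

Section BinomialSeries.
Context {R : realType}.
Implicit Types (b t r : R) (n : nat).

(** The coefficients [(b)_n / n!] of [(1 - t)^(-b)]; the product form makes positivity and the
    recursion immediate. *)
Definition bin_coef b n : R := \prod_(i < n) ((b + i%:R) / i.+1%:R).

Lemma bin_coef0 b : bin_coef b 0 = 1.
Proof. by rewrite /bin_coef big_ord0. Qed.

Lemma bin_coefS b n : bin_coef b n.+1 = bin_coef b n * ((b + n%:R) / n.+1%:R).
Proof. by rewrite /bin_coef big_ord_recr. Qed.

Lemma bin_coef_gt0 b n : 0 < b -> 0 < bin_coef b n.
Proof.
move=> b0; apply: prodr_gt0 => i _; rewrite divr_gt0// ?ltr0n//.
by rewrite ltr_wpDr.
Qed.

(** Both sides are [(b)_(n+1) / n!]. This is the coefficientwise form of the derivative of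
    [(1 - t)^(-b)]. *)
Lemma bin_coef_shift b n : b * bin_coef (b + 1) n = (b + n%:R) * bin_coef b n.
Proof.
elim: n => [|n IHn]; first by rewrite !bin_coef0 addr0.
rewrite !bin_coefS mulrA IHn -!natr1.
have n0 : n%:R + 1 != 0 :> R by rewrite natr1 pnatr_eq0.
by field.
Qed.

(** Coefficientwise form of [(1 - t) (1 - t)^(-(b+1)) = (1 - t)^(-b)]. *)
Lemma bin_coef_diff b n : 0 < b ->
  bin_coef (b + 1) n.+1 - bin_coef (b + 1) n = bin_coef b n.+1.
Proof.
move=> b0; apply: (@mulfI _ b); first by rewrite gt_eqF.
rewrite mulrBr !bin_coef_shift !bin_coefS -!natr1.
have n0 : n%:R + 1 != 0 :> R by rewrite natr1 pnatr_eq0.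
by field.
Qed.

(** The ratio of consecutive terms tends to [r], so it is eventually at most the midpoint [q] of [r]
    and 1; [C] absorbs the terms before that. *)
Lemma bin_coef_geometric b r : 0 < b -> 0 < r < 1 ->
  exists C q, [/\ 0 <= C, 0 < q < 1 & forall n, bin_coef b n * r ^+ n <= C * q ^+ n].
Proof.
move=> b0 /andP[r0 r1].
pose q := (1 + r) / 2; have q0 : 0 < q by rewrite /q; lra.
have q1 : q < 1 by rewrite /q; lra.
(* From this index on [b r <= n (q - r)], which bounds the ratio [(b + n) r / (n + 1)] by [q]. *)
have [n0 Hn0] : exists n0 : nat, b * r / (q - r) <= n0%:R.
  exists (Num.truncn (b * r / (q - r))).+1.
  by apply/ltW; rewrite truncnS_gt.
have Hr n : (n0 <= n)%N -> (b + n%:R) / n.+1%:R * r <= q.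
  move=> nn; rewrite mulrAC ler_pdivrMr ?ltr0n//.
  have qr : 0 < q - r by rewrite /q; lra.
  have : b * r / (q - r) <= n%:R by rewrite (le_trans Hn0)// ler_nat.
  rewrite ler_pdivrMr// -natr1 => H.
  nra.
pose u n := bin_coef b n * r ^+ n.
have u0 n : 0 <= u n by rewrite mulr_ge0 ?exprn_ge0 ?ltW ?bin_coef_gt0.
pose C := \sum_(i < n0.+1) u i / q ^+ i.
have uq0 i : 0 <= u i / q ^+ i by rewrite divr_ge0 ?u0// exprn_ge0// ltW.
exists C, q; split; rewrite ?q0 ?q1//.
  by apply: sumr_ge0 => i _.
move=> n; have [nn|/ltnW nn] := leqP n n0.
  rewrite -ler_pdivrMr ?exprn_gt0//.
  rewrite /C (bigD1 (Ordinal (nn : (n < n0.+1)%N)))//= lerDl.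
  by apply: sumr_ge0 => i _.
elim: n nn => [|n IHn].
  rewrite leqn0 => /eqP n00; rewrite /C n00 big_ord1 /u !expr0 divr1 !mulr1//.
rewrite leq_eqVlt => /predU1P[<-|nn].
  rewrite -ler_pdivrMr ?exprn_gt0//.
  rewrite /C (bigD1 ord_max)//= lerDl.
  by apply: sumr_ge0 => i _.
rewrite bin_coefS !exprS.
have -> : bin_coef b n * ((b + n%:R) / n.+1%:R) * (r * r ^+ n) =
  (bin_coef b n * r ^+ n) * ((b + n%:R) / n.+1%:R * r) by ring.
have -> : C * (q * q ^+ n) = C * q ^+ n * q by ring.
apply: ler_pM => //; first exact: u0.
- by rewrite mulr_ge0 ?(ltW r0)// divr_ge0// addr_ge0// ltW.
- exact: IHn.
- exact: Hr.
Qed.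

Lemma is_cvg_bin_series b t : 0 < b -> `|t| < 1 -> cvgn (pseries (bin_coef b) t).
Proof.
move=> b0 t1.
pose r := (1 + `|t|) / 2; have tr : `|t| < r by rewrite /r; lra.
have r0 : 0 < r by rewrite (le_lt_trans _ tr).
have r1 : r < 1 by rewrite /r; lra.
apply: (@is_cvg_pseries_inside _ _ r); last by rewrite [ltRHS]gtr0_norm.
have r01 : 0 < r < 1 by rewrite r0.
have [C [q [C0 /andP[q0 q1] H]]] := bin_coef_geometric b0 r01.
apply: (@series_le_cvg _ _ (geometric C q)) => //.
- by move=> n; rewrite mulr_ge0 ?exprn_ge0 ?(ltW r0)// ltW// bin_coef_gt0.
- by move=> n /=; rewrite mulr_ge0// exprn_ge0// ltW.
- by apply: is_cvg_geometric_series; rewrite gtr0_norm.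
Qed.

Lemma pseries_diffs_bin b :
  pseries_diffs (bin_coef b) = (fun n => b * bin_coef (b + 1) n).
Proof.
apply/funext => n; rewrite /pseries_diffs bin_coef_shift bin_coefS.
by rewrite mulrCA mulrC mulrAC mulrCA mulrAC mulfV ?mul1r// pnatr_eq0.
Qed.

Lemma pseriesZ b (c : nat -> R) t :
  pseries (fun n => b * c n) t = (fun n => b * pseries c t n).
Proof.
apply/funext => n; rewrite /pseries /series /= mulr_sumr.
by apply: eq_bigr => i _; rewrite mulrA.
Qed.

Let p b t := limn (pseries (bin_coef b) t).

(** Multiplying a partial sum by [1 - t] telescopes by [bin_coef_diff], up to a boundary term that
    tends to 0 because the series converges. *)
Lemma bin_series_shift b t : 0 < b -> `|t| < 1 -> (1 - t) * p (b + 1) t = p b t.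
Proof.
move=> b0 t1; have b1 : 0 < b + 1 by rewrite addr_gt0.
have c0 := is_cvg_bin_series b0 t1; have c1 := is_cvg_bin_series b1 t1.
have E n : (1 - t) * pseries (bin_coef (b + 1)) t n.+1 =
    pseries (bin_coef b) t n.+1 - t * (bin_coef (b + 1) n * t ^+ n).
  rewrite /pseries /series /=; elim: n => [|n IHn].
    by rewrite !big_nat1 !bin_coef0 !expr0; ring.
  rewrite big_nat_recr//= mulrDr IHn [in RHS]big_nat_recr//=.
  by rewrite -(bin_coef_diff _ b0) exprS; ring.
have : (1 - t) * pseries (bin_coef (b + 1)) t n.+1 @[n --> \oo] --> (1 - t) * p (b + 1) t.
  apply: cvgM; first exact: cvg_cst.
  by rewrite (cvg_shiftS (pseries (bin_coef (b + 1)) t)).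
rewrite (_ : (fun n => _) = (fun n => pseries (bin_coef b) t n.+1 - t * (bin_coef (b + 1) n * t ^+ n))); last exact/funext.
move=> H1.
have : pseries (bin_coef b) t n.+1 - t * (bin_coef (b + 1) n * t ^+ n) @[n --> \oo] --> p b t - t * 0.
  apply: cvgB; first by rewrite (cvg_shiftS (pseries (bin_coef b) t)).
  apply: cvgM; first exact: cvg_cst.
  exact: cvg_series_cvg_0 c1.
rewrite mulr0 subr0 => H2.
by move/cvg_lim : H1 => <- //; move/cvg_lim : H2 => <-.
Qed.

(** Termwise differentiation at [t] asks for convergence of the series and of its first two formal
    derivatives at a radius [r] beyond [|t|]; up to constant factors these are the binomial series
    of parameters [b], [b + 1] and [b + 2]. *)
Lemma is_derive_bin_series b t : 0 < b -> `|t| < 1 ->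
  is_derive t 1 (p b) (b * p (b + 1) t).
Proof.
move=> b0 t1; have b1 : 0 < b + 1 by rewrite addr_gt0.
have b2 : 0 < b + 1 + 1 by rewrite addr_gt0.
pose r := (1 + `|t|) / 2; have tr : `|t| < r by rewrite /r; lra.
have r0 : 0 < r by rewrite (le_lt_trans _ tr).
have r1 : `|r| < 1 by rewrite gtr0_norm// /r; lra.
have -> : b * p (b + 1) t = limn (pseries (pseries_diffs (bin_coef b)) t).
  rewrite pseries_diffs_bin pseriesZ; apply/esym/cvg_lim => //.
  apply: cvgM; first exact: cvg_cst.
  exact: is_cvg_bin_series.
apply: (@pseries_snd_diffs _ _ r).
- exact: is_cvg_bin_series.
- rewrite pseries_diffs_bin pseriesZ; apply: is_cvgM; first exact: is_cvg_cst.
  exact: is_cvg_bin_series.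
- rewrite pseries_diffs_bin.
  have -> : pseries_diffs (fun n => b * bin_coef (b + 1) n) =
     fun n => b * ((b + 1) * bin_coef (b + 1 + 1) n).
    apply/funext => n; rewrite /pseries_diffs mulrCA; congr (_ * _).
    by have := congr1 (@^~ n) (pseries_diffs_bin (b + 1)); rewrite /pseries_diffs.
  rewrite pseriesZ pseriesZ; apply: is_cvgM; first exact: is_cvg_cst.
  apply: is_cvgM; first exact: is_cvg_cst.
  exact: is_cvg_bin_series.
- by rewrite [ltRHS]gtr0_norm.
Qed.

(** By the two preceding lemmas [p b x (1 - x)^b] has derivative 0 on []-1, 1[]; its value at 0 is
    1, and the mean value theorem concludes. *)
Lemma bin_seriesE b t : 0 < b -> `|t| < 1 -> p b t = (1 - t) `^ (- b).
Proof.
move=> b0 t1.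
pose g x := p b x * (1 - x) `^ b.
have dg (x : R) : `|x| < 1 -> is_derive x (1 : R) g 0.
  move=> x1; have dp := is_derive_bin_series b0 x1.
  have x10 : 0 < 1 - x by rewrite subr_gt0 (le_lt_trans _ x1)// ler_norm.
  have d1 : is_derive x (1 : R) (fun y : R => 1 - y) (-1).
    by rewrite -sub0r; apply: is_deriveB.
  have d2 : is_derive x (1 : R) (fun y => (1 - y) `^ b) (- (b * (1 - x) `^ (b - 1))).
    have d3 := is_derive1_powR b x10.
    have := @is_derive1_comp _ (fun z : R => z `^ b) (fun y : R => 1 - y) x _ _ d3 d1.
    by rewrite mulrN1.
  have := is_deriveM dp d2.
  rewrite -(bin_series_shift b0 x1).
  move=> D; apply: (is_derive_eq D).
  rewrite /GRing.scale /= -(mulr_powRB1 (ltW x10) b0).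
  by ring.
have g0 : g 0 = 1.
  rewrite /g subr0 powR1 mulr1 /p; apply/cvg_lim => //.
  rewrite -cvg_shiftS; apply: cvg_near_cst; apply: nearW => n.
  rewrite /pseries /series /= big_nat_recl//= bin_coef0 expr0 mulr1 big1 ?addr0//.
  by move=> i _; rewrite expr0n mulr0.
have gt : g t = g 0.
  have H x y : x <= y -> `|x| < 1 -> `|y| < 1 -> g x = g y.
    move=> xy x1 y1.
    have xyz z : z \in `[x, y] -> `|z| < 1.
      rewrite in_itv/= => /andP[xz zy].
      move: x1 y1; rewrite !ltr_norml => /andP[] ? ? /andP[] ? ?; lra.
    have [z zxy||c _ E] := @MVT_segment _ g (fun=> 0) x y xy.
    - apply: dg; apply: xyz; apply: subset_itv_oo_cc zxy.
    - apply: derivable_within_continuous => z zxy.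
      by have [] := dg _ (xyz _ zxy).
    - by apply/esym/eqP; rewrite -subr_eq0 E mul0r.
  have [t0|/ltW t0] := leP t 0; first by apply: H; rewrite ?normr0.
  by apply/esym; apply: H; rewrite ?normr0.
have t10 : 0 < 1 - t by rewrite subr_gt0 (le_lt_trans _ t1)// ler_norm.
have pt : (1 - t) `^ b != 0 by rewrite gt_eqF// powR_gt0.
rewrite powRN; apply: (mulIf pt); rewrite mulVf//.
by rewrite -[LHS]/(g t) gt.
Qed.

Lemma bin_series_cvg b t : 0 < b -> `|t| < 1 ->
  pseries (bin_coef b) t @ \oo --> (1 - t) `^ (- b).
Proof. by move=> b0 t1; rewrite -bin_seriesE//; exact: is_cvg_bin_series. Qed.

Lemma bin_series_le b t n : 0 < b -> 0 <= t < 1 ->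
  pseries (bin_coef b) t n <= (1 - t) `^ (- b).
Proof.
move=> b0 /andP[t0 t1]; have t1' : `|t| < 1 by rewrite ger0_norm.
rewrite -bin_seriesE//; apply: nondecreasing_cvgn_le; last exact: is_cvg_bin_series.
apply/nondecreasing_seqP => m; rewrite /pseries /series /= big_nat_recr//= lerDl.
by rewrite mulr_ge0 ?exprn_ge0// ltW// bin_coef_gt0.
Qed.

(** A bound uniform in [n], which serves as domination when sums and integrals are exchanged. *)
Lemma bin_series_norm_le b t r n : 0 < b -> `|t| <= r -> r < 1 ->
  `|pseries (bin_coef b) t n| <= (1 - r) `^ (- b).
Proof.
move=> b0 tr r1; have r0 : 0 <= r by rewrite (le_trans _ tr).
apply: le_trans (bin_series_le n b0 (_ : 0 <= r < 1)); last by rewrite r0.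
rewrite /pseries /series /= (le_trans (ler_norm_sum _ _ _))//.
apply: ler_sum => i _; rewrite normrM (ger0_norm (ltW (bin_coef_gt0 i b0))).
by rewrite ler_wpM2l ?(ltW (bin_coef_gt0 i b0))// normrX lerXn2r// nnegrE.
Qed.

End BinomialSeries.

(** * Iterated integrals *)

Section RealIntegrals.
Context {R : realType}.
Local Notation mu := (@lebesgue_measure R).
Implicit Types (u v f g : R -> R) (F : R -> R -> R).

Definition rint f : R := (\int[mu]_x f x)%R.

Definition integ f : Prop := mu.-integrable setT (EFin \o f).

Lemma eq_rint f g : f =1 g -> rint f = rint g.
Proof. by move=> fg; congr rint; apply/funext. Qed.

Lemma integ_meas f : integ f -> measurable_fun setT f.
Proof. by move=> /measurable_int /measurable_EFinP. Qed.

Lemma integD f g : integ f -> integ g -> integ (fun x => f x + g x).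
Proof. by move=> If Ig; have := integrableD measurableT If Ig. Qed.

Lemma integZ (k : R) f : integ f -> integ (fun x => k * f x).
Proof. by move=> If; have := integrableZl measurableT k If. Qed.

Lemma integ0 : integ (fun=> 0).
Proof. exact: integrable0. Qed.

Lemma integ_sum n (f : nat -> R -> R) : (forall i, integ (f i)) ->
  integ (fun x => \sum_(0 <= i < n) f i x).
Proof.
move=> If; elim: n => [|n IHn].
  by rewrite (_ : (fun _ => _) = fun=> 0);
    [exact: integ0|apply/funext => x; rewrite big_nil].
rewrite (_ : (fun _ => _) = fun x => \sum_(0 <= i < n) f i x + f n x);
  first exact: integD.
by apply/funext => x; rewrite big_nat_recr.
Qed.

Lemma integ_norm f : integ f -> integ (fun x => `|f x|).
Proof. by move=> If; have := integrable_norm If. Qed.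

Lemma rintD f g : integ f -> integ g ->
  rint (fun x => f x + g x) = rint f + rint g.
Proof. by move=> If Ig; exact: RintegralD. Qed.

Lemma rintZ (k : R) f : integ f -> rint (fun x => k * f x) = k * rint f.
Proof. by move=> If; exact: RintegralZl. Qed.

Lemma rint0 : rint (fun=> 0) = 0.
Proof. by rewrite /rint Rintegral_cst// mul0r. Qed.

Lemma rint_norm_le f : integ f -> `|rint f| <= rint (fun x => `|f x|).
Proof. by move=> If; exact: le_normr_Rintegral. Qed.

Lemma rint_le f g : integ f -> integ g -> (forall x, f x <= g x) -> rint f <= rint g.
Proof. by move=> If Ig fg; exact: le_Rintegral. Qed.

Lemma negligible_point (y : R) : mu.-negligible [set y].
Proof. exists [set y]; split => //; exact: lebesgue_measure_set1. Qed.

(** Dominated convergence off a single point [y], which is negligible; for the expansion of the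
    Riesz kernel this point is the diagonal [x = y]. *)
Lemma rint_cvg (f_ : nat -> R -> R) f g (y : R) :
  (forall n, measurable_fun setT (f_ n)) -> measurable_fun setT f ->
  integ g -> (forall x, x != y -> f_ ^~ x @ \oo --> f x) ->
  (forall n x, x != y -> `|f_ n x| <= g x) ->
  integ f /\ rint (f_ n) @[n --> \oo] --> rint f.
Proof.
move=> mf_ mf Ig cf bf.
have H1 : {ae mu, forall x, setT x -> (EFin \o f_ n) x @[n --> \oo] --> (EFin \o f) x}.
  apply: negligibleS (@negligible_point y) => x /= H; apply: contrapT => xy; apply: H => _.
  by apply: cvg_EFin; [exact: nearW|apply: cf; apply/eqP].
have H2 : {ae mu, forall x n, setT x -> (`|(EFin \o f_ n) x| <= (EFin \o g) x)%E}.
  apply: negligibleS (@negligible_point y) => x /= H; apply: contrapT => xy; apply: H => n _.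
  by rewrite lee_fin; apply: bf; apply/eqP.
have mf_E n : measurable_fun setT (EFin \o f_ n) by exact/measurable_EFinP.
have mfE : measurable_fun setT (EFin \o f) by exact/measurable_EFinP.
have [If _ Hc] := @dominated_convergence _ _ _ mu setT measurableT
  (fun n => EFin \o f_ n) (EFin \o f) (EFin \o g) mf_E mfE H1 Ig H2.
split => //.
apply: (@fine_cvg _ _ _ _ (fun n => \int[mu]_x (f_ n x)%:E)%E).
rewrite /rint /Rintegral fineK//.
exact: integrable_fin_num If.
Qed.

(** Integrability in the order of iteration of [riesz_form]: in x for every y, then in y. This is
    enough for linearity and dominated convergence of [dint], without joint measurability or
    Fubini. *)
Definition dgood F := (forall y, integ (F ^~ y)) /\ integ (fun y => rint (F ^~ y)).
Definition dint F : R := rint (fun y => rint (F ^~ y)).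

Lemma eq_dgood F G : (forall x y, F x y = G x y) -> dgood F -> dgood G.
Proof. by move=> FG; have -> : F = G by apply/funext => x; apply/funext. Qed.

Lemma eq_dint F G : (forall x y, F x y = G x y) -> dint F = dint G.
Proof. by move=> FG; have -> : F = G by apply/funext => x; apply/funext. Qed.

Lemma dgoodD F G : dgood F -> dgood G -> dgood (fun x y => F x y + G x y).
Proof.
move=> [F1 F2] [G1 G2]; split=> [y|]; first exact: integD.
rewrite (_ : (fun _ => _) = fun y => rint (F ^~ y) + rint (G ^~ y)); first exact: integD.
by apply/funext => y; rewrite rintD.
Qed.

Lemma dintD F G : dgood F -> dgood G ->
  dint (fun x y => F x y + G x y) = dint F + dint G.
Proof.
move=> [F1 F2] [G1 G2]; rewrite /dint -rintD//; apply: eq_rint => y.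
by rewrite rintD.
Qed.

Lemma dgoodZ (k : R) F : dgood F -> dgood (fun x y => k * F x y).
Proof.
move=> [F1 F2]; split=> [y|]; first exact: integZ.
rewrite (_ : (fun _ => _) = fun y => k * rint (F ^~ y)); first exact: integZ.
by apply/funext => y; rewrite rintZ.
Qed.

Lemma dintZ (k : R) F : dgood F -> dint (fun x y => k * F x y) = k * dint F.
Proof.
by move=> [F1 F2]; rewrite /dint -rintZ//; apply: eq_rint => y; rewrite rintZ.
Qed.

Lemma dintB F G : dgood F -> dgood G ->
  dint (fun x y => F x y - G x y) = dint F - dint G.
Proof.
move=> GF GG; rewrite -mulN1r -(dintZ (-1) GG) -(dintD GF (dgoodZ (-1) GG)).
by apply: eq_dint => x y; rewrite mulN1r.
Qed.

Lemma dgood_prod u v : integ u -> integ v -> dgood (fun x y => u x * v y).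
Proof.
move=> Iu Iv; split=> [y|].
  by under eq_fun do rewrite mulrC; exact: integZ.
rewrite (_ : (fun _ => _) = fun y => rint u * v y); first exact: integZ.
apply/funext => y; rewrite mulrC -rintZ//; apply: eq_rint => x; exact: mulrC.
Qed.

Lemma dint_prod u v : integ u -> integ v -> dint (fun x y => u x * v y) = rint u * rint v.
Proof.
move=> Iu Iv; rewrite /dint -rintZ//; apply: eq_rint => y.
rewrite mulrC -rintZ//; apply: eq_rint => x; exact: mulrC.
Qed.

Lemma dgood_sum n (F : nat -> R -> R -> R) : (forall i, dgood (F i)) ->
  dgood (fun x y => \sum_(0 <= i < n) F i x y).
Proof.
move=> GF; elim: n => [|n IHn].
  apply: (@eq_dgood (fun x y => 0 * 0)); last exact: dgood_prod integ0 integ0.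
  by move=> x y; rewrite big_nil mul0r.
apply: (eq_dgood _ (dgoodD IHn (GF n))) => x y.
by rewrite big_nat_recr.
Qed.

Lemma dint_sum n (F : nat -> R -> R -> R) : (forall i, dgood (F i)) ->
  dint (fun x y => \sum_(0 <= i < n) F i x y) = \sum_(0 <= i < n) dint (F i).
Proof.
move=> GF; elim: n => [|n IHn].
  have E : 0 = rint (fun=> 0) * rint (fun=> 0) by rewrite rint0 mul0r.
  rewrite big_nil [RHS]E -(dint_prod integ0 integ0).
  by apply: eq_dint => x y; rewrite big_nil mul0r.
rewrite big_nat_recr//= -IHn -(dintD (dgood_sum n GF) (GF n)).
by apply: eq_dint => x y; rewrite big_nat_recr.
Qed.

(* The diagonal is excluded since the Riesz kernel is singular there. *)
Lemma dint_cvg (F_ : nat -> R -> R -> R) F G C :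
  (forall n, dgood (F_ n)) -> (forall y, measurable_fun setT (F ^~ y)) ->
  (forall x y, x != y -> F_ n x y @[n --> \oo] --> F x y) ->
  (forall x y, 0 <= G x y) -> (forall n x y, x != y -> `|F_ n x y| <= G x y) ->
  (forall y, integ (G ^~ y) /\ rint (G ^~ y) <= C y) -> integ C ->
  dgood F /\ dint (F_ n) @[n --> \oo] --> dint F.
Proof.
move=> GF mF cF G0 bF HG IC.
have H y : integ (F ^~ y) /\ rint (F_ n ^~ y) @[n --> \oo] --> rint (F ^~ y).
  apply: (@rint_cvg (fun n => F_ n ^~ y) (F ^~ y) (G ^~ y) y) => //.
  - by move=> n; have [/(_ y)/integ_meas] := GF n.
  - by have [] := HG y.
  - by move=> x xy; exact: cF.
  - by move=> n x xy; exact: bF.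
have mFn n : measurable_fun setT (fun y => rint (F_ n ^~ y)).
  by have [_ /integ_meas] := GF n.
have mFi : measurable_fun setT (fun y => rint (F ^~ y)).
  by apply: (measurable_fun_cvg mFn) => y _; have [] := H y.
have bFi n y : `|rint (F_ n ^~ y)| <= C y.
  have [Gy GC] := HG y; have [/(_ y) Fy _] := GF n.
  apply: le_trans GC; apply: le_trans (rint_norm_le Fy) _.
  rewrite /rint /Rintegral; apply: fine_le.
  - by apply: integrable_fin_num => //; exact: integ_norm.
  - exact: integrable_fin_num.
  apply: ae_ge0_le_integral => //.
  - by apply/measurable_EFinP; apply: integ_meas; exact: integ_norm.
  - by move=> x _; rewrite lee_fin.
  - by apply/measurable_EFinP; apply: integ_meas.
  - apply: negligibleS (@negligible_point y) => x /= Hx; apply: contrapT => xy; apply: Hx => _.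
    by rewrite lee_fin; apply: bF; apply/eqP.
(* The outer limit holds at every [y]; the excluded point 0 is an arbitrary choice. *)
have [I1 C1] := @rint_cvg (fun n y => rint (F_ n ^~ y)) _ C 0 mFn mFi IC
  (fun y _ => proj2 (H y)) (fun n y _ => bFi n y).
by split => //; split => // y; have [] := H y.
Qed.

End RealIntegrals.

(** * Compactly supported functions and changes of variables *)

Section CompactSupport.
Context {R : realType}.
Local Notation mu := (@lebesgue_measure R).
Implicit Types (u v f g h G : R -> R) (r : R).

Definition csupp r u := continuous u /\ forall x, u x != 0 -> `|x| <= r.

Lemma csupp_out r u x : csupp r u -> r < `|x| -> u x = 0.
Proof.
by move=> [_ H] rx; apply/eqP; apply: contraTT rx => /H; rewrite -leNgt.
Qed.

Lemma csupp_bounded r u : csupp r u -> exists2 M, 0 <= M & forall x, `|u x| <= M.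
Proof.
move=> [cu su].
have /compact_bounded [M [Mreal HM]] : compact (u @` `[- r, r]).
  apply: continuous_compact; last exact: segment_compact.
  exact: continuous_subspaceT.
exists (`|M| + 1); first by rewrite addr_ge0.
move=> x; have [->|ux] := eqVneq (u x) 0; first by rewrite normr0 addr_ge0.
apply: (HM (`|M| + 1)); first by rewrite (le_lt_trans (ler_norm _))// ltrDl.
by exists x => //=; rewrite in_itv/= -ler_norml su.
Qed.

Lemma csupp_integ r u : csupp r u -> integ u.
Proof.
move=> [cu su]; rewrite /integ.
have -> : EFin \o u = (EFin \o u) \_ `[- r, r].
  apply/funext => x; rewrite /patch; case: ifPn => //= xr.
  apply/eqP; rewrite eqe; apply: contraNT xr => /su.
  by rewrite inE /= in_itv/= -ler_norml.
apply: (proj1 (integrable_mkcond _ _)) => //.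
apply: continuous_compact_integrable; first exact: segment_compact.
exact: continuous_subspaceT.
Qed.

Lemma csuppM r u f : continuous f -> csupp r u -> csupp r (fun x => f x * u x).
Proof.
move=> cf [cu su]; split; first by move=> x; apply: cvgM; [exact: cf|exact: cu].
by move=> x; rewrite mulf_eq0 negb_or => /andP[_ /su].
Qed.

Lemma rint_itv h (A : set R) : measurable A -> (forall x, h x != 0 -> A x) ->
  rint h = (\int[mu]_(x in A) h x)%R.
Proof.
move=> mA hA; rewrite [RHS]Rintegral_mkcond; apply: eq_rint => x.
rewrite /patch; case: ifPn => // /negP xA; apply/eqP/negPn/negP => /hA.
by move=> Ax; apply: xA; rewrite inE.
Qed.

Section Substitution.
Variables (O : set R) (F dF : R -> R) (G : R -> R) (a b : R).
Hypotheses (oO : open O) (abO : `[a, b] `<=` O) (ab : a <= b).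
Hypothesis dFE : forall x, O x -> is_derive x 1 F (dF x).
Hypothesis cdF : forall x, O x -> {for x, continuous dF}.
Hypothesis cG : continuous G.

Let F'E x : O x -> derive1 F x = dF x.
Proof. by move=> Ox; rewrite derive1E; have H := dFE Ox; rewrite derive_val. Qed.

Let cF' x : O x -> derive1 F y @[y --> x] --> derive1 F x.
Proof.
move=> Ox; rewrite F'E//.
apply: cvg_trans (cdF Ox); apply: near_eq_cvg.
by apply: filterS (open_nbhs_nbhs (conj oO Ox)) => y Oy; rewrite F'E.
Qed.

Let aO : O a. Proof. by apply: abO; rewrite /= in_itv/= lexx. Qed.
Let bO : O b. Proof. by apply: abO; rewrite /= in_itv/= lexx andbT. Qed.

Let cF x : O x -> F y @[y --> x] --> F x.
Proof.
move=> Ox; have dx := dFE Ox; apply: differentiable_continuous.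
exact/derivable1_diffP.
Qed.

Let dFoo : derivable_oo_LRcontinuous F a b.
Proof.
split.
- move=> x xab; have : O x by apply: abO; exact: subset_itv_oo_cc xab.
  by move=> /dFE [].
- exact: cvg_at_right_filter (cF aO).
- exact: cvg_at_left_filter (cF bO).
Qed.

(** [F] is C^1 only on an open set [O] around [[a, b]], which admits [y^-1] away from 0. As [F]
    decreases, the endpoints are exchanged and the Jacobian is [- dF]. *)
Lemma rint_subst_dec : {in `[a, b] &, {homo F : x y /~ x < y}} ->
  (\int[mu]_(x in `[F b, F a]) G x = \int[mu]_(x in `[a, b]) (G (F x) * - dF x))%R.
Proof.
move=> hF; congr fine.
rewrite (@integration_by_substitution_decreasing _ F G a b)//.
- apply: eq_integral => x; rewrite inE => xab /=; rewrite !fctE F'E//.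
  exact: abO.
- move=> x xab; apply: cF'; apply: abO; exact: subset_itv_oo_cc xab.
- by apply/cvg_ex; exists (derive1 F a); exact: cvg_at_right_filter (cF' aO).
- by apply/cvg_ex; exists (derive1 F b); exact: cvg_at_left_filter (cF' bO).
- exact: continuous_subspaceT.
Qed.

Lemma rint_subst_inc : {in `[a, b] &, {homo F : x y / x < y}} ->
  (\int[mu]_(x in `[F a, F b]) G x = \int[mu]_(x in `[a, b]) (G (F x) * dF x))%R.
Proof.
move=> hF; congr fine.
rewrite (@integration_by_substitution_increasing _ F G a b)//.
- apply: eq_integral => x; rewrite inE => xab /=; rewrite !fctE F'E//.
  exact: abO.
- move=> x xab; apply: cF'; apply: abO; exact: subset_itv_oo_cc xab.
- by apply/cvg_ex; exists (derive1 F a); exact: cvg_at_right_filter (cF' aO).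
- by apply/cvg_ex; exists (derive1 F b); exact: cvg_at_left_filter (cF' bO).
- exact: continuous_subspaceT.
Qed.

End Substitution.

Lemma rint_scale r G (c : R) : 0 < c -> 0 <= r -> csupp r G ->
  rint (fun x => G (c * x)) = c^-1 * rint G.
Proof.
move=> c0 r0 [cG sG].
have ab : - (r / c) <= r / c.
  by rewrite ge0_cp// divr_ge0// ltW.
have D (x : R) : setT x -> is_derive x (1 : R) (fun y : R => c * y) ((fun=> c) x).
  by move=> _; apply: is_derive_eq; rewrite scaler1.
have := @rint_subst_inc setT (fun y => c * y) (fun=> c) G _ _ openT (@subsetT _ _) ab D
  (fun x _ => cvg_cst _) cG.
rewrite mulrN mulrCA divff ?gt_eqF// mulr1 => H.
rewrite (@rint_itv G `[- r, r])//; last first.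
  by move=> x /sG; rewrite ler_norml /= in_itv.
rewrite H; last by move=> x y _ _; rewrite ltr_pM2l.
rewrite -(@rint_itv (fun x => G (c * x) * c))//; last first.
  move=> x; rewrite mulf_eq0 negb_or => /andP[/sG + _].
  rewrite normrM (gtr0_norm c0) mulrC -ler_pdivlMr// ler_norml /= in_itv//.
have S : csupp (r / c) (fun x => G (c * x)).
  split; first by move=> x; apply: continuous_comp; [exact: mulrl_continuous|exact: cG].
  by move=> x /sG; rewrite normrM (gtr0_norm c0) mulrC -ler_pdivlMr.
have -> : rint (fun x => G (c * x) * c) = c * rint (fun x => G (c * x)).
  by rewrite -(rintZ c (csupp_integ S)); apply: eq_rint => x; rewrite mulrC.
by rewrite mulrA mulVf ?mul1r// gt_eqF.
Qed.

(** Supports that also stay away from 0: the class preserved by inversion, with the radii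
    inverted. *)
Definition annulus (d r : R) u := continuous u /\ forall x, u x != 0 -> d <= `|x| <= r.

Lemma annulus_csupp d r u : annulus d r u -> csupp r u.
Proof. by move=> [cu su]; split => // x /su /andP[]. Qed.

Lemma annulus_inv d r G : 0 < d -> d <= r -> annulus d r G ->
  annulus r^-1 d^-1 (fun y => y^-1 ^+ 2 * G y^-1).
Proof.
move=> d0 dr [cG sG]; have r0 : 0 < r by exact: lt_le_trans dr.
have S y : y^-1 ^+ 2 * G y^-1 != 0 -> r^-1 <= `|y| <= d^-1.
  rewrite mulf_eq0 negb_or expf_eq0 /= invr_eq0 => /andP[y0 /sG].
  have y0' : 0 < `|y| by rewrite normr_gt0.
  by rewrite normfV => /andP[H1 H2]; rewrite -[`|y|]invrK !lef_pV2 ?posrE ?invr_gt0// H2.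
(* Since [0^-1 = 0] the value at 0 is 0, and by [S] the function vanishes on [|z| < r^-1], which
   gives continuity there. *)
split => // y; have [->|y0] := eqVneq y 0.
  rewrite /continuous_at /= invr0 expr0n mul0r; apply: cvg_near_cst.
  have : \forall z \near (0 : R), `|z| < r^-1.
    have := @nbhsx_ballx _ R (0 : R) r^-1 ; rewrite invr_gt0 => /(_ r0).
    by apply: filterS => z; rewrite -ball_normE /= sub0r normrN.
  apply: filterS => z zr; apply/eqP/negPn/negP => /S /andP[+ _].
  by rewrite leNgt zr.
have cV : z^-1 @[z --> y] --> y^-1 by exact: inv_continuous.
apply: cvgM; first by rewrite expr2; under eq_fun do rewrite expr2; exact: cvgM.
by apply: continuous_cvg => //; exact: cG.
Qed.

(** The factor [y^-2] is the absolute Jacobian of [y -> y^-1]. The integral is split at 0 because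
    inversion is decreasing on each half-line but not on their union. *)
Lemma rint_inv d r G : 0 < d -> d <= r -> annulus d r G ->
  rint (fun y => y^-1 ^+ 2 * G y^-1) = rint G.
Proof.
move=> d0 dr aG; have r0 : 0 < r by exact: lt_le_trans dr.
have aH := annulus_inv d0 dr aG.
have [cG sG] := aG.
have split2 (p q : R) (h : R -> R) : 0 < p -> p <= q -> annulus p q h ->
    rint h = (\int[mu]_(x in `[- q, - p]) h x)%R + (\int[mu]_(x in `[p, q]) h x)%R.
  move=> p0 pq [ch sh].
  rewrite -Rintegral_setU//.
  - apply: rint_itv; first exact: measurableU.
    move=> x /sh; rewrite /= !in_itv /=.
    have [x0|x0] := leP 0 x.
      by rewrite (ger0_norm x0) => ?; right.
    by rewrite (ltr0_norm x0) => /andP[? ?]; left; apply/andP; split; lra.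
  - apply: (@integrableS _ _ _ mu setT) => //; first exact: measurableU.
    by apply: (@csupp_integ q); split => // x /sh /andP[].
  - rewrite disj_set2E; apply/eqP/seteqP; split=> // x [] /=.
    rewrite !in_itv /= => /andP[_ H1] /andP[H2 _]; lra.
rewrite (split2 _ _ _ d0 dr aG) (split2 r^-1 d^-1 _ _ _ aH) ?invr_gt0//; last by rewrite lef_pV2.
have oO : open [set x : R | x != 0].
  by rewrite openE => x /= x0; apply: open_nbhs_nbhs; split => //; exact: open_neq.
have dV (x : R) : x != 0 -> is_derive x (1 : R) (fun y : R => y^-1) ((fun y : R => - (y^-1 ^+ 2)) x).
  move=> x0; have := @is_deriveV _ id x 1 1 x0 (is_derive_id x 1).
  by move=> H; apply: is_derive_eq; rewrite /GRing.scale /= mulr1 exprVn.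
have cdV (x : R) : x != 0 -> {for x, continuous (fun y : R => - (y^-1 ^+ 2))}.
  move=> x0; apply: cvgN; rewrite expr2; under eq_fun do rewrite expr2.
  by apply: cvgM; exact: inv_continuous.
have E A : (\int[mu]_(x in A) (x^-1 ^+ 2 * G x^-1) = \int[mu]_(x in A) (G x^-1 * - - (x^-1 ^+ 2)))%R.
  by apply: eq_Rintegral => x _; rewrite opprK mulrC.
rewrite !E.
have ri : r^-1 <= d^-1 by rewrite lef_pV2.
have r'0 : 0 < r^-1 by rewrite invr_gt0.
rewrite -(@rint_subst_dec [set x | x != 0] (fun y => y^-1) (fun y => - (y^-1 ^+ 2)) G)//; last 3 first.
- by move=> x /=; rewrite in_itv /= => /andP[_ H]; apply/eqP; lra.
- lra.
- move=> x y; rewrite !in_itv /= => /andP[_ H1] /andP[_ H2] xy.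
  by rewrite ltf_nV2// ?negrE; lra.
rewrite -(@rint_subst_dec [set x | x != 0] (fun y => y^-1) (fun y => - (y^-1 ^+ 2)) G)//; last 2 first.
- by move=> x /=; rewrite in_itv /= => /andP[H _]; apply/eqP; lra.
- move=> x y; rewrite !in_itv /= => /andP[H1 _] /andP[H2 _] xy.
  by rewrite ltf_pV2// ?posrE; lra.
by rewrite !invrN !invrK.
Qed.

End CompactSupport.

(** * The Riesz kernel *)

Section RieszKernel.
Context {R : realType}.
Local Notation mu := (@lebesgue_measure R).
Variable s : R.
Hypothesis s0 : 0 < s.

Definition rkernel (x y : R) : R := `|x - y| `^ (s - 1).

Lemma measurable_rkernel y : measurable_fun setT (rkernel ^~ y).
Proof.
apply: (measurableT_comp (f := fun z => z `^ (s - 1))); first exact: measurable_powR.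
by apply: continuous_measurable_fun => x; apply: cvg_norm; apply: cvgB; [exact: cvg_id|exact: cvg_cst].
Qed.

(** [e] is the sign of [x - y] on [[p, q]], so that the antiderivative [e (e (x - y))^s / s] serves
    both sides of the singularity. *)
Let piece (e y p q : R) : e * e = 1 -> p < q ->
  (forall x, p <= x <= q -> 0 < e * (x - y)) ->
  (\int[mu]_(x in `[p, q]) (rkernel x y)%:E =
    (e * (e * (q - y)) `^ s / s)%:E - (e * (e * (p - y)) `^ s / s)%:E)%E.
Proof.
move=> ee pq pos.
have ne : `|e| = 1.
  by apply/eqP; rewrite -(@eqrXn2 _ 2) ?normr_ge0// real_normK ?num_real// expr1n expr2 ee.
have dl x : is_derive x (1 : R) (fun z : R => e * (z - y)) e.
  have D1 : is_derive x (1 : R) (fun z : R => z - y) (1 - 0) by apply: is_deriveB.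
  have := is_deriveZ (f := fun z : R => z - y) e D1.
  by rewrite subr0 /GRing.scale /= mulr1.
have dp t x : p <= x <= q -> is_derive x (1 : R) (fun z : R => (e * (z - y)) `^ t)
     (t * (e * (x - y)) `^ (t - 1) * e).
  move=> xpq; have D2 := is_derive1_powR t (pos _ xpq).
  exact: (@is_derive1_comp _ (fun z : R => z `^ t) (fun z : R => e * (z - y)) x _ _ D2 (dl x)).
have dF x : p <= x <= q -> is_derive x (1 : R) (fun z : R => e * (e * (z - y)) `^ s / s)
     ((e * (x - y)) `^ (s - 1)).
  move=> xpq; have D := is_deriveZ (f := fun z : R => (e * (z - y)) `^ s) (e / s) (dp s x xpq).
  have -> : (fun z : R => e * (e * (z - y)) `^ s / s) = (e / s) \*: (fun z : R => (e * (z - y)) `^ s).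
    by apply/funext => z /=; rewrite /GRing.scale /=; ring.
  apply: (is_derive_eq D); rewrite /GRing.scale /=.
  transitivity (e * e * (s / s) * (e * (x - y)) `^ (s - 1)); first by ring.
  by rewrite ee divff ?gt_eqF// !mul1r.
have cts t x : p <= x <= q -> (e * (z - y)) `^ t @[z --> x] --> (e * (x - y)) `^ t.
  by move=> xpq; have D := dp t x xpq; apply: (@differentiable_continuous _ _ _ x (fun z : R => (e * (z - y)) `^ t)); exact/derivable1_diffP.
have pp : p <= p <= q by rewrite lexx ltW.
have qq : p <= q <= q by rewrite lexx ltW.
transitivity (\int[mu]_(x in `[p, q]) ((e * (x - y)) `^ (s - 1))%:E)%E; last first.
  apply: (@continuous_FTC2 _ (fun x => (e * (x - y)) `^ (s - 1))
    (fun z => e * (e * (z - y)) `^ s / s) p q pq).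
  - apply: derivable_within_continuous => x; rewrite in_itv /= => xpq.
    by have [] := dp (s - 1) x xpq.
  - split.
    + move=> x xpq; have : x \in `[p, q] by exact: subset_itv_oo_cc xpq.
      by rewrite in_itv /= => /dF [].
    + apply: cvg_at_right_filter.
      by apply: cvgM; [apply: cvgM; [exact: cvg_cst|exact: cts]|exact: cvg_cst].
    + apply: cvg_at_left_filter.
      by apply: cvgM; [apply: cvgM; [exact: cvg_cst|exact: cts]|exact: cvg_cst].
  - move=> x xpq; have : x \in `[p, q] by exact: subset_itv_oo_cc xpq.
    rewrite in_itv /= => /dF D; rewrite derive1E; exact: derive_val.
apply: eq_integral => x; rewrite inE /= in_itv /= => xpq; congr EFin.
by rewrite /rkernel -[`|x - y|]mul1r -ne -normrM gtr0_norm// pos.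
Qed.

Let small_le (b : R) n : 0 < b -> 0 < b / n.+2%:R < b.
Proof.
move=> b0; rewrite divr_gt0 ?ltr0n//= ltr_pdivrMr ?ltr0n// ltr_pMr//.
by rewrite ltr1n.
Qed.

Let small_homo (b : R) m n : 0 < b -> (m <= n)%N -> b / n.+2%:R <= b / m.+2%:R.
Proof.
by move=> b0 mn; rewrite ler_pM2l// lef_pV2 ?posrE ?ltr0n// ler_nat ltnS.
Qed.

Let small_ex (b d : R) : 0 < b -> 0 < d -> exists n, b / n.+2%:R <= d.
Proof.
move=> b0 d0; exists (Num.truncn (b / d)).
rewrite ler_pdivrMr ?ltr0n// mulrC -ler_pdivrMr//.
apply/ltW; apply: lt_trans (truncnS_gt _) _; by rewrite ltr_nat.
Qed.

(** The integrand is singular at [y], so [piece] is applied on [[y + b/(n+2), y + b]] and monotone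
    convergence lets [n] grow. The shift by 2 keeps the left end strictly below the right one
    already for [n = 0]. *)
Lemma rkernel_right y b : 0 < b ->
  (\int[mu]_(x in `]y, (y + b)%R]) (rkernel x y)%:E <= (b `^ s / s)%:E)%E.
Proof.
move=> b0; pose F n := `[(y + b / n.+2%:R)%R, (y + b)%R]%classic.
have EF : `]y, (y + b)%R]%classic = \bigcup_n F n.
  apply/seteqP; split=> [x|x [n _]]; rewrite /F /= !in_itv /=.
    move=> /andP[yx xb]; have [|n Hn] := @small_ex b (x - y) b0; first by rewrite subr_gt0.
    by exists n => //; rewrite /F /= in_itv /=; move: (b / _) Hn => d Hn; apply/andP; split; lra.
  by have := small_le n b0; move: (b / _) => d /andP[? ?] /andP[? ?]; apply/andP; split; lra.
have nF : nondecreasing_seq F.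
  move=> m n mn; apply/subsetPset => x; rewrite /F /= !in_itv /=.
  by have := small_homo b0 mn; move: (b / n.+2%:R) (b / m.+2%:R) => d d' ? /andP[? ?]; apply/andP; split; lra.
have c : (\int[mu]_(x in F n) (rkernel x y)%:E @[n --> \oo] -->
    \int[mu]_(x in \bigcup_n F n) (rkernel x y)%:E)%E.
  apply: ge0_nondecreasing_set_cvg_integral => //.
  - by move=> n; exact: measurable_itv.
  - by move=> n; apply: measurable_funTS; apply/measurable_EFinP; exact: measurable_rkernel.
  - by move=> n x _; rewrite lee_fin powR_ge0.
rewrite EF; apply: (cvge_to_le c); apply: nearW => n.
have := small_le n b0; rewrite /F; move: (b / _) => d /andP[n0 nb].
rewrite (@piece 1); [|by rewrite mul1r|lra|by move=> x /andP[? ?]; lra].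
rewrite -EFinB lee_fin !mul1r -mulrBl ler_pM2r ?invr_gt0//.
have -> : y + b - y = b by ring.
by rewrite gerBl powR_ge0.
Qed.

Lemma rkernel_left y b : 0 < b ->
  (\int[mu]_(x in `[(y - b)%R, y[) (rkernel x y)%:E <= (b `^ s / s)%:E)%E.
Proof.
move=> b0; pose F n := `[(y - b)%R, (y - b / n.+2%:R)%R]%classic.
have EF : `[(y - b)%R, y[%classic = \bigcup_n F n.
  apply/seteqP; split=> [x|x [n _]]; rewrite /F /= !in_itv /=.
    move=> /andP[yx xb]; have [|n Hn] := @small_ex b (y - x) b0; first by rewrite subr_gt0.
    by exists n => //; rewrite /F /= in_itv /=; move: (b / _) Hn => d Hn; apply/andP; split; lra.
  by have := small_le n b0; move: (b / _) => d /andP[? ?] /andP[? ?]; apply/andP; split; lra.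
have nF : nondecreasing_seq F.
  move=> m n mn; apply/subsetPset => x; rewrite /F /= !in_itv /=.
  by have := small_homo b0 mn; move: (b / n.+2%:R) (b / m.+2%:R) => d d' ? /andP[? ?]; apply/andP; split; lra.
have c : (\int[mu]_(x in F n) (rkernel x y)%:E @[n --> \oo] -->
    \int[mu]_(x in \bigcup_n F n) (rkernel x y)%:E)%E.
  apply: ge0_nondecreasing_set_cvg_integral => //.
  - by move=> n; exact: measurable_itv.
  - by move=> n; apply: measurable_funTS; apply/measurable_EFinP; exact: measurable_rkernel.
  - by move=> n x _; rewrite lee_fin powR_ge0.
rewrite EF; apply: (cvge_to_le c); apply: nearW => n.
have := small_le n b0; rewrite /F; move: (b / _) => d /andP[n0 nb].
rewrite (@piece (-1)); [|by rewrite mulrNN mulr1|lra|by move=> x /andP[? ?]; lra].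
rewrite -EFinB lee_fin !mulN1r !mulNr opprK addrC -mulrBl ler_pM2r ?invr_gt0//.
have -> : - (y - b - y) = b by ring.
by rewrite gerBl powR_ge0.
Qed.

(** For [|y| <= 1] the interval [[-1, 1]] lies in [[y - 2, y + 2]], and each side of [y] contributes
    at most [2^s / s] to the integral of the kernel. *)
Definition rkbound : R := 2 `^ s / s + 2 `^ s / s.

Definition rkernel1 (x y : R) : R := if `|x| <= 1 then rkernel x y else 0.

Lemma rkernel1_integ y : `|y| <= 1 ->
  integ (rkernel1 ^~ y) /\ rint (rkernel1 ^~ y) <= rkbound.
Proof.
move=> y1.
have sub : (`[-1, 1] : set R) `<=` `[y - 2, y[ `|` `[y, y + 2].
  move=> x /=; rewrite !in_itv /= => /andP[x1 x2].
  move: y1; rewrite ler_norml => /andP[? ?].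
  by have [yx|xy] := leP y x; [right|left]; apply/andP; split; lra.
have dis : [disjoint (`[y - 2, y[ : set R) & (`[y, y + 2] : set R)].
  rewrite disj_set2E; apply/eqP/seteqP; split=> // x [] /=.
  by rewrite !in_itv /= => /andP[_ H1] /andP[H2 _]; lra.
have E : EFin \o (rkernel1 ^~ y) = (fun x => (rkernel x y)%:E) \_ `[-1, 1].
  apply/funext => x; rewrite /patch /rkernel1 /= mem_setE in_itv /= -ler_norml.
  by case: ifP.
have mI : measurable (`[-1, 1] : set R) by exact: measurable_itv.
have mk (A : set R) : measurable_fun A (fun x => (rkernel x y)%:E).
  by apply: measurable_funTS; apply/measurable_EFinP; exact: measurable_rkernel.
have k0 x : (0 <= (rkernel x y)%:E)%E by rewrite lee_fin powR_ge0.
have bnd : (\int[mu]_(x in `[(-1)%R, 1%R]) (rkernel x y)%:E <= rkbound%:E)%E.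
  apply: (@le_trans _ _ (\int[mu]_(x in `[(y - 2)%R, y[ `|` `[y, (y + 2)%R]) (rkernel x y)%:E)%E).
    apply: ge0_subset_integral => //; first exact: measurableU.
    - exact: mk.
  rewrite ge0_integral_setU//=; last exact: mk.
  rewrite /rkbound EFinD; apply: leeD; first exact: rkernel_left.
  by rewrite -integral_itv_obnd_cbnd//; exact: rkernel_right.
have I : integ (rkernel1 ^~ y).
  rewrite /integ E; apply: (proj1 (integrable_mkcond _ _)) => //.
  apply/integrableP; split; first exact: mk.
  under eq_integral do rewrite gee0_abs//.
  by apply: le_lt_trans bnd _; rewrite ltry.
split => //; rewrite -lee_fin /rint /Rintegral fineK; last exact: integrable_fin_num.
by rewrite -[X in (X <= _)%E]/(\int[mu]_x (EFin \o (rkernel1 ^~ y)) x)%E E -integral_mkcond.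
Qed.

Lemma rkbound_ge0 : 0 <= rkbound.
Proof. by rewrite /rkbound addr_ge0// divr_ge0 ?powR_ge0// ltW. Qed.

End RieszKernel.

(** * Series expansions of the kernels under the iterated integral *)

Section KernelExpansions.
Context {R : realType}.
Implicit Types (u v g : R -> R).

(** Each partial sum consists of separated products, whose iterated integrals factor; the bound
    [C |u(x)| |v(y)|], uniform in [N], carries the sum through both integrals. *)
Lemma dint_series (w : nat -> R) (A B : nat -> R -> R) u v (C : R) (F : R -> R -> R) :
  (forall i, integ (A i)) -> (forall i, integ (B i)) -> integ u -> integ v -> 0 <= C ->
  (forall N x y, `|\sum_(0 <= i < N) w i * (A i x * B i y)| <= C * (`|u x| * `|v y|)) ->
  (forall x y, \sum_(0 <= i < N) w i * (A i x * B i y) @[N --> \oo] --> F x y) ->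
  dgood F /\ \sum_(0 <= i < N) w i * (rint (A i) * rint (B i)) @[N --> \oo] --> dint F.
Proof.
move=> IA IB Iu Iv C0 bF cF.
pose F_ N x y := \sum_(0 <= i < N) w i * (A i x * B i y).
have GF N : dgood (F_ N).
  by apply: dgood_sum => i; apply: dgoodZ; exact: dgood_prod.
have mF y : measurable_fun setT (F ^~ y).
  apply: (@measurable_fun_cvg _ _ _ _ (fun N => F_ N ^~ y)) => [N|x _]; last exact: cF.
  by have [/(_ y)/integ_meas] := GF N.
have Iu' := integ_norm Iu; have Iv' := integ_norm Iv.
have [||GG cI] := @dint_cvg _ F_ F (fun x y => C * (`|u x| * `|v y|))
  (fun y => C * (rint (fun x => `|u x|) * `|v y|)) GF mF (fun x y _ => cF x y)
  (fun x y => mulr_ge0 C0 (mulr_ge0 (normr_ge0 _) (normr_ge0 _))) (fun n x y _ => bF n x y).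
- move=> y; have E : (fun x => C * (`|u x| * `|v y|)) = (fun x => C * `|v y| * `|u x|).
    by apply/funext => x; ring.
  rewrite E; split; first exact: integZ.
  by rewrite rintZ// mulrAC mulrA.
- by under eq_fun do rewrite mulrA; exact: integZ.
split=> //; rewrite (_ : (fun N => _) = (fun N => dint (F_ N))); first exact: cI.
apply/funext => N; rewrite dint_sum; last by move=> i; apply: dgoodZ; exact: dgood_prod.
by apply: eq_bigr => i _; rewrite dintZ ?dint_prod//; exact: dgood_prod.
Qed.

Lemma continuous_expr n : continuous (fun x : R => x ^+ n).
Proof. by move=> x; exact: exprn_continuous. Qed.

(** The weight [c] carries the support condition: where it vanishes, [t] is unrestricted and both
    sides are 0. *)
Lemma powRN_series (b t : R) (c : R) : 0 < b -> (c != 0 -> `|t| < 1) ->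
  (\sum_(0 <= i < N) bin_coef b i * t ^+ i) * c @[N --> \oo] --> (1 - t) `^ (- b) * c.
Proof.
move=> b0 ct; have [->|/ct t1] := eqVneq c 0.
  by rewrite mulr0; under eq_fun do rewrite mulr0; exact: cvg_cst.
apply: cvgM; last exact: cvg_cst.
exact: (bin_series_cvg b0 t1).
Qed.

Definition moment n u : R := rint (fun x => x ^+ n * u x).

Lemma moment_integ r n u : csupp r u -> integ (fun x => x ^+ n * u x).
Proof. by move=> su; apply: (@csupp_integ _ r); apply: csuppM => //; exact: continuous_expr. Qed.

(** The binomial series in [t = x y] separates the variables, and [|x y| <= r] on the supports gives
    a bound uniform in [N]. *)
Lemma dint_hardy (b r : R) u v : 0 < b -> r < 1 -> 0 <= r -> csupp r u -> csupp r v ->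
  dgood (fun x y => u x * (1 - x * y) `^ (- b) * v y) /\
  \sum_(0 <= i < N) bin_coef b i * (moment i u * moment i v) @[N --> \oo] -->
    dint (fun x y => u x * (1 - x * y) `^ (- b) * v y).
Proof.
move=> b0 r1 r0 su sv.
have E N x y : \sum_(0 <= i < N) bin_coef b i * ((x ^+ i * u x) * (y ^+ i * v y)) =
    (\sum_(0 <= i < N) bin_coef b i * (x * y) ^+ i) * (u x * v y).
  by rewrite mulr_suml; apply: eq_bigr => i _; rewrite exprMn; ring.
have small x y : u x * v y != 0 -> `|x * y| <= r.
  rewrite mulf_eq0 negb_or normrM => /andP[/(proj2 su) xr /(proj2 sv) yr].
  rewrite -[leRHS]mulr1; apply: ler_pM => //; exact: le_trans yr (ltW r1).
apply: (@dint_series (bin_coef b) (fun i x => x ^+ i * u x) (fun i y => y ^+ i * v y)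
  u v ((1 - r) `^ (- b))).
- by move=> i; exact: moment_integ su.
- by move=> i; exact: moment_integ sv.
- exact: csupp_integ su.
- exact: csupp_integ sv.
- exact: powR_ge0.
- move=> N x y; rewrite E -[X in _ <= _ * X]normrM [leLHS]normrM.
  have [->|uv] := eqVneq (u x * v y) 0; first by rewrite normr0 !mulr0.
  by rewrite ler_wpM2r//; exact: (bin_series_norm_le N b0 (small _ _ uv) r1).
- move=> x y; under eq_fun do rewrite E.
  have -> : u x * (1 - x * y) `^ (- b) * v y = (1 - x * y) `^ (- b) * (u x * v y) by ring.
  by apply: powRN_series => // /small /le_lt_trans; apply.
Qed.

(** Where the integrand lives, [|y| >= 1/r > 1 > |x|], and [|x - y|^(s-1) |y|^(-s-1) = y^-2 (1 -
    x/y)^(s-1)] since the exponents of [|y|] add up to -2. The series in [x/y] separates the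
    variables, and [y^-2] is the Jacobian that turns the integrals in [y] into moments of [g]. *)
Lemma dint_inversion (s r d : R) u g : s < 1 -> 0 < d -> d <= r -> r < 1 ->
  csupp r u -> annulus d r g ->
  dgood (fun x y => u x * rkernel s x y * (`|y| `^ (- s - 1) * g y^-1)) /\
  \sum_(0 <= i < N) bin_coef (1 - s) i * (moment i u * moment i g) @[N --> \oo] -->
    dint (fun x y => u x * rkernel s x y * (`|y| `^ (- s - 1) * g y^-1)).
Proof.
move=> s1 d0 dr r1 su ag.
have b0 : 0 < 1 - s by rewrite subr_gt0.
have r0 : 0 < r by exact: lt_le_trans dr.
have agi i : annulus d r (fun t => t ^+ i * g t).
  split; first by move=> x; apply: cvgM; [exact: continuous_expr|exact: (proj1 ag)].
  by move=> x; rewrite mulf_eq0 negb_or => /andP[_ /(proj2 ag)].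
have Ii i : integ (fun y => y^-1 ^+ 2 * (y^-1 ^+ i * g y^-1)).
  exact: csupp_integ (annulus_csupp (annulus_inv d0 dr (agi i))).
have E N x y : \sum_(0 <= i < N) bin_coef (1 - s) i * ((x ^+ i * u x) * (y^-1 ^+ 2 * (y^-1 ^+ i * g y^-1))) =
    (\sum_(0 <= i < N) bin_coef (1 - s) i * (x * y^-1) ^+ i) * (u x * (y^-1 ^+ 2 * g y^-1)).
  by rewrite mulr_suml; apply: eq_bigr => i _; rewrite exprMn; ring.
have small x y : u x * (y^-1 ^+ 2 * g y^-1) != 0 -> y != 0 /\ `|x * y^-1| <= r.
  rewrite mulf_eq0 negb_or => /andP[/(proj2 su) xr].
  rewrite mulf_eq0 negb_or expf_eq0 /= invr_eq0 normrM.
  move=> /andP[y0 /(proj2 ag)/andP[_ yr]]; split => //.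
  by rewrite -[leRHS]mulr1; apply: ler_pM => //; exact: le_trans yr (ltW r1).
have : dgood (fun x y => u x * rkernel s x y * (`|y| `^ (- s - 1) * g y^-1)) /\
  \sum_(0 <= i < N) bin_coef (1 - s) i * (rint (fun x => x ^+ i * u x) *
     rint (fun y => y^-1 ^+ 2 * (y^-1 ^+ i * g y^-1))) @[N --> \oo] -->
    dint (fun x y => u x * rkernel s x y * (`|y| `^ (- s - 1) * g y^-1)).
  apply: (@dint_series (bin_coef (1 - s)) (fun i x => x ^+ i * u x) (fun i y => y^-1 ^+ 2 * (y^-1 ^+ i * g y^-1))
    u (fun y => y^-1 ^+ 2 * g y^-1) ((1 - r) `^ (- (1 - s)))).
  - by move=> i; exact: moment_integ su.
  - exact: Ii.
  - exact: csupp_integ su.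
  - exact: csupp_integ (annulus_csupp (annulus_inv d0 dr ag)).
  - exact: powR_ge0.
  - move=> N x y; rewrite E -[X in _ <= _ * X]normrM [leLHS]normrM.
    have [->|uv] := eqVneq (u x * (y^-1 ^+ 2 * g y^-1)) 0; first by rewrite normr0 !mulr0.
    by rewrite ler_wpM2r//; exact: (bin_series_norm_le N b0 (proj2 (small _ _ uv)) r1).
  - move=> x y; under eq_fun do rewrite E.
    have -> : u x * rkernel s x y * (`|y| `^ (- s - 1) * g y^-1) =
        (1 - x / y) `^ (- (1 - s)) * (u x * (y^-1 ^+ 2 * g y^-1)).
      have [uv0|uv] := eqVneq (u x * (y^-1 ^+ 2 * g y^-1)) 0.
        rewrite uv0 mulr0; move/eqP: uv0; rewrite mulf_eq0 => /orP[/eqP->|].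
          by rewrite !mul0r.
        rewrite mulf_eq0 expf_eq0 /= invr_eq0.
        move=> /orP[/eqP ->|/eqP ->]; last by rewrite !mulr0.
        (* The case [y = 0]: there [y^-1] is 0 by convention, and [g] vanishes near 0. *)
        rewrite invr0 (_ : g 0 = 0) ?mulr0//; apply/eqP/negPn/negP => /(proj2 ag).
        by rewrite normr0 leNgt d0.
      have [y0 xy] := small _ _ uv.
      have xy1 : 0 < 1 - x / y.
        by rewrite subr_gt0; apply: le_lt_trans (ler_norm _) _; apply: le_lt_trans r1.
      have ay : 0 < `|y| by rewrite normr_gt0.
      have -> : rkernel s x y = (1 - x / y) `^ (- (1 - s)) * `|y| `^ (s - 1).
        rewrite /rkernel (_ : x - y = - (y * (1 - x / y))); last by field.
        by rewrite normrN normrM (gtr0_norm xy1) powRM ?(ltW xy1)// opprB mulrC.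
      have -> : y^-1 ^+ 2 = `|y| `^ (s - 1) * `|y| `^ (- s - 1).
        rewrite -powRD; last by rewrite (gt_eqF ay) implybT.
        rewrite (_ : s - 1 + (- s - 1) = - 2%:R); last by ring.
        by rewrite powR_invn// -exprVn -normfV real_normK ?num_real.
      by ring.
    by apply: powRN_series => // /small[_ /le_lt_trans]; apply.
move=> [GG cI]; split => //.
rewrite (_ : (fun N => _) = (fun N => \sum_(0 <= i < N) bin_coef (1 - s) i * (rint (fun x => x ^+ i * u x) *
     rint (fun y => y^-1 ^+ 2 * (y^-1 ^+ i * g y^-1))))); first exact: cI.
apply/funext => N; apply: eq_bigr => i _; congr (_ * (_ * _)).
exact/esym/(rint_inv d0 dr (agi i)).
Qed.

Section Riesz.
Variable s : R.
Hypothesis s01 : 0 < s < 1.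

Let s0 : 0 < s. Proof. by case/andP: s01. Qed.
Let s1 : s < 1. Proof. by case/andP: s01. Qed.

(** The exponent of [1 / (1 - x y)] in the n-th term: [1 - s] from the prefactor, and [2 n] from the
    n-th power of [q = (1 - x^2) (1 - y^2) / (1 - x y)^2]. *)
Definition rexp n : R := 1 - s + n.*2%:R.
Definition damp n u x : R := (1 - x ^+ 2) ^+ n * u x.

Lemma rexp_gt0 n : 0 < rexp n.
Proof. by rewrite /rexp ltr_wpDr// subr_gt0. Qed.

Lemma csupp_damp r n u : csupp r u -> csupp r (damp n u).
Proof.
apply: csuppM => x; apply: (@continuous_comp _ _ _ (fun x : R => 1 - x ^+ 2) (fun z => z ^+ n)); last exact: exprn_continuous.
by apply: cvgB; [exact: cvg_cst|exact: exprn_continuous].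
Qed.

(* Up to the factor c'_n, the n-th term of the expansion of the Riesz kernel. *)
Definition hardy n u v (x y : R) : R :=
  damp n u x * (1 - x * y) `^ (- rexp n) * damp n v y.

Lemma riesz_expansion_term r n u v x y : r < 1 -> csupp r u -> csupp r v ->
  let q := (1 - x ^+ 2) * (1 - y ^+ 2) / (1 - x * y) ^+ 2 in
  hardy n u v x y = q ^+ n * ((1 - x * y) `^ (- (1 - s)) * (u x * v y)).
Proof.
move=> r1 su sv q; have [uv0|] := eqVneq (u x * v y) 0.
  rewrite uv0 !mulr0 /hardy /damp; move/eqP: uv0; rewrite mulf_eq0.
  by move=> /orP[/eqP->|/eqP->]; rewrite ?mulr0 ?mul0r.
rewrite mulf_eq0 negb_or => /andP[/(proj2 su) xr /(proj2 sv) yr].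
have xy1 : 0 < 1 - x * y.
  rewrite subr_gt0; apply: le_lt_trans (ler_norm _) _; rewrite normrM.
  by rewrite -(mulr1 1); apply: ltr_pM => //; [exact: le_lt_trans r1|exact: le_lt_trans r1].
rewrite /hardy /damp /q /rexp opprD powRD; last by rewrite (gt_eqF xy1) implybT.
rewrite powR_invn ?ltW// -mul2n exprM [in RHS]exprMn [in RHS]exprMn exprVn.
by ring.
Qed.

(** Here [1 - q = ((x - y) / (1 - x y))^2], the squared pseudohyperbolic distance; raising it to the
    power [- (1 - s) / 2] gives the formula. It is positive off the diagonal, so the binomial series
    in [q] converges there. *)
Lemma riesz_kernel_split (x y : R) : `|x| < 1 -> `|y| < 1 -> x != y ->
  let q := (1 - x ^+ 2) * (1 - y ^+ 2) / (1 - x * y) ^+ 2 in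
  0 <= q < 1 /\ rkernel s x y = (1 - q) `^ (- ((1 - s) / 2)) * (1 - x * y) `^ (- (1 - s)).
Proof.
move=> x1 y1 xy q.
have xy1 : 0 < 1 - x * y.
  rewrite subr_gt0; apply: le_lt_trans (ler_norm _) _; rewrite normrM.
  by rewrite -(mulr1 1); apply: ltr_pM.
have qE : (1 - x * y) ^+ 2 * (1 - q) = (x - y) ^+ 2.
  by rewrite /q; field; rewrite gt_eqF.
have q1 : 0 < 1 - q.
  by rewrite -(pmulr_rgt0 _ (exprn_gt0 2 xy1)) qE exprn_even_gt0//= subr_eq0.
split.
  rewrite -subr_gt0 q1 andbT /q divr_ge0 ?exprn_ge0 ?(ltW xy1)// mulr_ge0// subr_ge0.
    by rewrite -(ger0_norm (sqr_ge0 x)) normrX exprn_ile1 ?normr_ge0 ?(ltW x1) ?(ltW y1).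
  by rewrite -(ger0_norm (sqr_ge0 y)) normrX exprn_ile1 ?normr_ge0 ?(ltW x1) ?(ltW y1).
rewrite /rkernel.
have -> : s - 1 = 2%:R * (- ((1 - s) / 2)) by field.
rewrite powRrM powR_mulrn ?normr_ge0// real_normK ?num_real// -qE.
rewrite powRM ?exprn_ge0 ?ltW// mulrC; congr (_ * _).
by rewrite -powR_mulrn ?ltW// -powRrM; congr powR; field.
Qed.

(** Near the diagonal [q] tends to 1 and no constant bounds the partial sums. Their terms are
    nonnegative, so they stay below their sum, and the domination is the kernel itself times a bound
    for [u] and [|v|]; [rkernel1_integ] bounds its inner integral uniformly in [y]. *)
Lemma dint_riesz r u v : r < 1 -> 0 <= r -> csupp r u -> csupp r v ->
  dgood (fun x y => u x * rkernel s x y * v y) /\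
  \sum_(0 <= n < N) bin_coef ((1 - s) / 2) n * dint (hardy n u v) @[N --> \oo] -->
    dint (fun x y => u x * rkernel s x y * v y).
Proof.
move=> r1 r0 su sv.
have al0 : 0 < (1 - s) / 2 by rewrite divr_gt0// subr_gt0.
have Gh n : dgood (hardy n u v).
  by have [] := dint_hardy (rexp_gt0 n) r1 r0 (csupp_damp n su) (csupp_damp n sv).
have [Mu Mu0 HMu] := csupp_bounded su.
pose F_ N x y := \sum_(0 <= n < N) bin_coef ((1 - s) / 2) n * hardy n u v x y.
have GF N : dgood (F_ N) by apply: dgood_sum => n; exact: dgoodZ.
have FE N x y : F_ N x y = pseries (bin_coef ((1 - s) / 2))
    ((1 - x ^+ 2) * (1 - y ^+ 2) / (1 - x * y) ^+ 2) N * ((1 - x * y) `^ (- (1 - s)) * (u x * v y)).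
  rewrite /F_ /pseries /series /= mulr_suml; apply: eq_bigr => n _.
  by rewrite (riesz_expansion_term n x y r1 su sv); exact: mulrA.
have lt1 x y : u x * v y != 0 -> `|x| < 1 /\ `|y| < 1.
  rewrite mulf_eq0 negb_or => /andP[/(proj2 su) xr /(proj2 sv) yr].
  by split; apply: le_lt_trans r1.
pose G x y := Mu * `|v y| * rkernel1 s x y.
have G0 x y : 0 <= G x y.
  by rewrite /G mulr_ge0 ?mulr_ge0// /rkernel1; case: ifP => // _; exact: powR_ge0.
have [||||||] := @dint_cvg _ F_ (fun x y => u x * rkernel s x y * v y) G
  (fun y => Mu * rkbound s * `|v y|) GF.
- move=> y; rewrite (_ : (fun x => _) = (fun x => u x * rkernel s x y) \* (fun=> v y))//.
  apply: measurable_funM => //; apply: measurable_funM.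
    exact: integ_meas (csupp_integ su).
  exact: measurable_rkernel.
- move=> x y xy; have [uv0|uv] := eqVneq (u x * v y) 0.
    have -> : u x * rkernel s x y * v y = 0 by rewrite mulrAC uv0 mul0r.
    by under eq_fun do rewrite FE uv0 !mulr0; exact: cvg_cst.
  have [x1 y1] := lt1 _ _ uv.
  have [/andP[q0 q1] ->] := riesz_kernel_split x1 y1 xy.
  under eq_fun do rewrite FE.
  rewrite (_ : u x * _ * v y = (1 - (1 - x ^+ 2) * (1 - y ^+ 2) / (1 - x * y) ^+ 2) `^ (- ((1 - s) / 2)) *
    ((1 - x * y) `^ (- (1 - s)) * (u x * v y))); last by ring.
  apply: cvgM; last exact: cvg_cst.
  by apply: bin_series_cvg => //; rewrite ger0_norm.
- exact: G0.
- move=> n x y xy; rewrite FE; have [uv0|uv] := eqVneq (u x * v y) 0.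
    by rewrite uv0 !mulr0 normr0; exact: G0.
  have [x1 y1] := lt1 _ _ uv.
  have [q01 kE] := riesz_kernel_split x1 y1 xy.
  rewrite /G /rkernel1 (ltW x1) kE.
  set P := (1 - _) `^ (- ((1 - s) / 2)); set p := (1 - x * y) `^ (- (1 - s)).
  have -> : Mu * `|v y| * (P * p) = P * (p * (Mu * `|v y|)) by ring.
  have S0 : 0 <= pseries (bin_coef ((1 - s) / 2))
      ((1 - x ^+ 2) * (1 - y ^+ 2) / (1 - x * y) ^+ 2) n.
    rewrite /pseries /series /=; apply: sumr_ge0 => i _.
    by rewrite mulr_ge0 ?exprn_ge0 ?(ltW (bin_coef_gt0 i al0))//; case/andP: q01.
  rewrite normrM (ger0_norm S0) normrM (ger0_norm (powR_ge0 _ _)) normrM.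
  apply: ler_pM => //.
  - by rewrite !mulr_ge0 ?powR_ge0.
  - exact: bin_series_le.
  - by rewrite ler_wpM2l ?powR_ge0// ler_wpM2r.
- move=> y; have [v0|vn0] := eqVneq (v y) 0.
    have E : G ^~ y = fun=> 0 by apply/funext => x; rewrite /G v0 normr0 mulr0 mul0r.
    by rewrite E rint0 v0 normr0 mulr0; split => //; exact: integ0.
  have y1 : `|y| <= 1 by apply: le_trans (ltW r1); exact: (proj2 sv).
  have [I1 B1] := rkernel1_integ s0 y1.
  split; first exact: integZ.
  by rewrite /G rintZ// mulrAC ler_wpM2r// ler_wpM2l.
- by apply: integZ; apply: integ_norm; exact: csupp_integ sv.
move=> GG cI; split => //; rewrite (_ : (fun N => _) = (fun N => dint (F_ N))); first exact: cI.
apply/funext => N; rewrite dint_sum; last by move=> n; exact: dgoodZ.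
by apply: eq_bigr => n _; rewrite dintZ.
Qed.

(** A supremum bound on one function and an integral bound on the other: a bounded function of small
    support has small energy, which yields the density of [test0]. *)
Lemma dint_riesz_le r u v M : r < 1 -> 0 <= r -> csupp r u -> csupp r v -> 0 <= M ->
  (forall x, `|u x| <= M) ->
  `|dint (fun x y => u x * rkernel s x y * v y)| <= M * rkbound s * rint (fun y => `|v y|).
Proof.
move=> r1 r0 su sv M0 HM.
have [[G1 G2] _] := dint_riesz r1 r0 su sv.
have Iv := integ_norm (csupp_integ sv).
apply: le_trans (rint_norm_le G2) _; rewrite -rintZ//.
apply: rint_le; [exact: integ_norm|exact: integZ|move=> y].
apply: le_trans (rint_norm_le (G1 y)) _.
have [v0|vn0] := eqVneq (v y) 0.
  rewrite v0 normr0 mulr0 (_ : (fun x => _) = fun=> 0) ?rint0//.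
  by apply/funext => x; rewrite mulr0 normr0.
have y1 : `|y| <= 1 by apply: le_trans (ltW r1); exact: (proj2 sv).
have [I1 B1] := rkernel1_integ s0 y1.
apply: (@le_trans _ _ (rint (fun x => M * `|v y| * rkernel1 s x y))); last first.
  by rewrite rintZ// mulrAC ler_wpM2r// ler_wpM2l.
apply: rint_le; [exact: integ_norm|exact: integZ|move=> x].
rewrite !normrM mulrAC /rkernel1 (ger0_norm (powR_ge0 _ _)).
case: ifP => [_|/negP x1].
  by rewrite ler_wpM2r ?powR_ge0// ler_wpM2r.
rewrite (csupp_out su) ?normr0 ?mul0r ?mulr0//.
by rewrite ltNge; apply/negP => xr; apply: x1; exact: le_trans xr (ltW r1).
Qed.

End Riesz.
End KernelExpansions.

(** * The Riesz energy as a supremum of quadratic expressions in moments *)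

Section RealEnergy.
Context {R : realType}.
Local Notation mu := (@lebesgue_measure R).
Implicit Types (u v : R -> R).

Lemma rint_indic (p q c : R) : p <= q ->
  integ (fun x => if p <= x <= q then c else 0) /\
  rint (fun x => if p <= x <= q then c else 0) = c * (q - p).
Proof.
move=> pq.
have E : EFin \o (fun x => if p <= x <= q then c else 0) = (cst c%:E) \_ `[p, q].
  by apply/funext => x; rewrite /patch /= mem_setE in_itv /=; case: ifP.
have m : mu `[p, q] = (q - p)%:E.
  rewrite lebesgue_measure_itv /= lte_fin; case: ltP => // qp.
  by rewrite (_ : p = q) ?subrr//; apply/le_anti; rewrite pq.
split.
  rewrite /integ E; apply: (proj1 (integrable_mkcond _ _)) => //.
  by apply: continuous_compact_integrable; [exact: segment_compact|apply: continuous_subspaceT => x; exact: cvg_cst].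
pose h (x : R) := if p <= x <= q then c else 0.
rewrite -/h in E *; rewrite /rint /Rintegral -[X in fine X]/(\int[mu]_x (EFin \o h) x)%E.
by rewrite E -integral_mkcond integral_cst// [X in (_ * X)%E]m.
Qed.

Lemma csupp_rint_norm_le r M u : 0 <= r -> csupp r u -> (forall x, `|u x| <= M) ->
  rint (fun x => `|u x|) <= M * (r + r).
Proof.
move=> r0 su HM; have [I E] := @rint_indic (- r) r M (ge0_cp r0).2.
rewrite -{2}[r]opprK -[r - - r]/(r - (- r)) -E; apply: rint_le => //.
  exact: integ_norm (csupp_integ su).
move=> x; rewrite -ler_norml; case: ifP => [_|/negP xr]; first exact: HM.
by rewrite (csupp_out su) ?normr0// ltNge; apply/negP.
Qed.

(** A bump on [[1/4, 3/4]], hence away from 0 and 1, used to produce a vector with nonzero n-th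
    coordinate. With the factor [x ^+ n] the integrand of the n-th moment is an even power of [x]
    times a nonnegative bump. *)
Definition tent n (x : R) : R := x ^+ n * Num.max 0 ((x - 4^-1) * (3 / 4 - x)).

Lemma tent_annulus n : annulus 4^-1 (3 / 4) (tent n).
Proof.
split=> x.
  apply: cvgM; first exact: exprn_continuous.
  apply: (@continuous_max _ _ (fun=> 0) (fun x : R => (x - 4^-1) * (3 / 4 - x))).
    exact: cvg_cst.
  by apply: cvgM; apply: cvgB; (exact: cvg_id || exact: cvg_cst).
rewrite /tent mulf_eq0 negb_or => /andP[_].
case: (leP ((x - 4^-1) * (3 / 4 - x)) 0) => [_|]; first by rewrite eqxx.
by move=> H _; rewrite ger0_norm; [apply/andP; split; nra|nra].
Qed.

Lemma tent_moment n : 0 < moment n (tent n).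
Proof.
(* On [[3/8, 5/8]] each [x ^+ n] is at least [(3/8)^n], and both factors of the bump are at least
   1/8. *)
pose c : R := (3 / 8) ^+ n * (3 / 8) ^+ n * 64^-1.
have c0 : 0 < c by rewrite /c !mulr_gt0// exprn_gt0// divr_gt0.
have [I E] : integ (fun x => if 3 / 8 <= x <= 5 / 8 then c else 0) /\
    rint (fun x => if 3 / 8 <= x <= 5 / 8 then c else 0) = c * (5 / 8 - 3 / 8).
  by apply: rint_indic; lra.
apply: (@lt_le_trans _ _ (c * (5 / 8 - 3 / 8))); first by rewrite mulr_gt0//; lra.
rewrite -E; apply: rint_le => //; first exact: moment_integ (annulus_csupp (tent_annulus n)).
move=> x; rewrite /tent; case: ifP => [/andP[x1 x2]|_].
  rewrite mulrA /c; apply: ler_pM => //.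
  - by apply: ler_pM; rewrite ?exprn_ge0 ?divr_ge0//; apply: lerXn2r; rewrite ?nnegrE//; lra.
  - by rewrite le_max; apply/orP; right; nra.
by rewrite mulrA -expr2 mulr_ge0 ?sqr_ge0// le_max lexx.
Qed.

Section Energy.
Variable s : R.
Hypothesis s01 : 0 < s < 1.

Let s0 : 0 < s. Proof. by case/andP: s01. Qed.
Let s1 : s < 1. Proof. by case/andP: s01. Qed.
Let al0 : 0 < (1 - s) / 2. Proof. by rewrite divr_gt0// subr_gt0. Qed.

Definition rform u v : R := dint (fun x y => u x * rkernel s x y * v y).

Definition cball u := exists r, [/\ 0 <= r, r < 1 & csupp r u].

(** Both expansions of the energy are cut off, which leaves finitely many squares of moments. *)
Definition trunc_energy N M u : R :=
  \sum_(0 <= n < N) bin_coef ((1 - s) / 2) n *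
    \sum_(0 <= m < M) bin_coef (rexp s n) m * (moment m (damp n u)) ^+ 2.

Lemma moment_damp_cvg (u_ : nat -> R -> R) : (forall k, cball (u_ k)) ->
  (forall i, moment i (u_ k) @[k --> \oo] --> (0 : R)) ->
  forall n i, moment i (damp n (u_ k)) @[k --> \oo] --> (0 : R).
Proof.
move=> Hu H; elim=> [|n IHn] i.
  rewrite (_ : (fun k => _) = fun k => moment i (u_ k)); first exact: H.
  by apply/funext => k; apply: eq_rint => x; rewrite /damp expr0 mul1r.
rewrite (_ : (fun k => _) = fun k => moment i (damp n (u_ k)) - moment i.+2 (damp n (u_ k))).
  by rewrite -(subr0 (0 : R)); apply: cvgB; exact: IHn.
apply/funext => k; have [r [r0 r1 su]] := Hu k.
have sd := csupp_damp n su.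
rewrite /moment -mulN1r -rintZ; last exact: moment_integ sd.
rewrite -rintD; [|exact: moment_integ sd|by apply: integZ; exact: moment_integ sd].
by apply: eq_rint => x; rewrite /damp !exprS; ring.
Qed.

Lemma momentB i u v : cball u -> cball v -> moment i (fun x => u x - v x) = moment i u - moment i v.
Proof.
move=> [r [r0 r1 su]] [r' [r'0 r'1 sv]].
rewrite /moment -mulN1r -rintZ; last exact: moment_integ sv.
rewrite -rintD; [|exact: moment_integ su|by apply: integZ; exact: moment_integ sv].
by apply: eq_rint => x; ring.
Qed.

Lemma momentB_damp i n u v : cball u -> cball v ->
  moment i (damp n (fun x => u x - v x)) = moment i (damp n u) - moment i (damp n v).
Proof.
move=> [r [r0 r1 su]] [r' [r'0 r'1 sv]].
rewrite -momentB; last 2 first.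
- by exists r; split=> //; exact: csupp_damp.
- by exists r'; split=> //; exact: csupp_damp.
by apply: eq_rint => x; rewrite /damp; ring.
Qed.

Let hardy_cvg u n : cball u -> \sum_(0 <= m < M) bin_coef (rexp s n) m * (moment m (damp n u)) ^+ 2
  @[M --> \oo] --> dint (hardy s n u u).
Proof.
move=> [r [r0 r1 su]].
have [_] := dint_hardy (rexp_gt0 s01 n) r1 r0 (csupp_damp n su) (csupp_damp n su).
by under eq_fun do under eq_bigr do rewrite -expr2.
Qed.

Let hardy_le u n M : cball u -> \sum_(0 <= m < M) bin_coef (rexp s n) m * (moment m (damp n u)) ^+ 2
  <= dint (hardy s n u u).
Proof.
move=> bu; have := @hardy_cvg u n bu; set g := (fun M => _) => cg.
have <- : limn g = dint (hardy s n u u) by exact: cvg_lim.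
apply: (nondecreasing_cvgn_le _ (cvgP _ cg)).
apply/nondecreasing_seqP => m; rewrite /g big_nat_recr//= lerDl.
by rewrite mulr_ge0 ?sqr_ge0// ltW// bin_coef_gt0// rexp_gt0.
Qed.

Let riesz_cvg u : cball u ->
  \sum_(0 <= n < N) bin_coef ((1 - s) / 2) n * dint (hardy s n u u) @[N --> \oo] --> rform u u.
Proof. by move=> [r [r0 r1 su]]; have [_] := dint_riesz s01 r1 r0 su su. Qed.

Lemma trunc_energy_le N M u : cball u -> trunc_energy N M u <= rform u u.
Proof.
move=> bu; have := riesz_cvg bu; set g := (fun N => _) => cg.
apply: (@le_trans _ _ (g N)).
  by apply: ler_sum => n _; rewrite ler_wpM2l ?(ltW (bin_coef_gt0 _ al0))//; exact: hardy_le.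
have <- : limn g = rform u u by exact: cvg_lim.
apply: (nondecreasing_cvgn_le _ (cvgP _ cg)).
apply/nondecreasing_seqP => n; rewrite /g big_nat_recr//= lerDl.
rewrite mulr_ge0 ?(ltW (bin_coef_gt0 _ al0))//.
by apply: le_trans (@hardy_le u n 0 bu); rewrite big_nil.
Qed.

(** With [trunc_energy_le], this makes the energy the supremum of its truncations, from which lower
    semicontinuity under convergence of moments is drawn. *)
Lemma energy_le B u : cball u -> (forall N M, trunc_energy N M u <= B) -> rform u u <= B.
Proof.
move=> bu H; apply: (cvgr_to_le (riesz_cvg bu)); apply: nearW => N.
have c : trunc_energy N M u @[M --> \oo] -->
    \sum_(0 <= n < N) bin_coef ((1 - s) / 2) n * dint (hardy s n u u).
  rewrite /trunc_energy; elim: (N) => [|n IHn].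
    by rewrite big_nil; under eq_fun do rewrite big_nil; exact: cvg_cst.
  rewrite big_nat_recr//=; under eq_fun do rewrite big_nat_recr//=.
  by apply: cvgD => //; apply: cvgM; [exact: cvg_cst|exact: hardy_cvg].
by apply: (cvgr_to_le c); apply: nearW => M; exact: H.
Qed.

Lemma rform_ge0 u : cball u -> 0 <= rform u u.
Proof. by move=> bu; apply: le_trans (trunc_energy_le 0 0 bu); rewrite /trunc_energy big_nil. Qed.

Lemma cballB u v : cball u -> cball v -> cball (fun x => u x - v x).
Proof.
move=> [r [r0 r1 su]] [r' [r'0 r'1 sv]]; exists (Num.max r r'); split.
- by rewrite le_max r0.
- by rewrite gt_max r1.
split; first by move=> x; apply: cvgB; [exact: (proj1 su)|exact: (proj1 sv)].
move=> x; rewrite le_max; have [->|/(proj2 su)-> //] := eqVneq (u x) 0.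
by rewrite sub0r oppr_eq0 => /(proj2 sv) ->; rewrite orbT.
Qed.

(* The truncated energies only involve moments, which is why they pass to the
   limit in [k] although the energy itself does not. *)
Lemma energy_moment0 (u_ : nat -> R -> R) j e : (forall k, cball (u_ k)) ->
  (forall i, moment i (u_ k) @[k --> \oo] --> (0 : R)) ->
  (\forall k \near \oo, rform (fun x => u_ j x - u_ k x) (fun x => u_ j x - u_ k x) <= e) ->
  rform (u_ j) (u_ j) <= e.
Proof.
move=> Hu Hm He; apply: energy_le => // N M.
have c : trunc_energy N M (fun x => u_ j x - u_ k x) @[k --> \oo] --> trunc_energy N M (u_ j).
  rewrite /trunc_energy; elim: (N) => [|n IHn].
    by rewrite big_nil; under eq_fun do rewrite big_nil; exact: cvg_cst.
  rewrite big_nat_recr//=; under eq_fun do rewrite big_nat_recr//=.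
  apply: cvgD => //; apply: cvgM; first exact: cvg_cst.
  elim: (M) => [|m IHm].
    by rewrite big_nil; under eq_fun do rewrite big_nil; exact: cvg_cst.
  rewrite big_nat_recr//=; under eq_fun do rewrite big_nat_recr//=.
  apply: cvgD => //; apply: cvgM; first exact: cvg_cst.
  have c1 : moment m (damp n (fun x => u_ j x - u_ k x)) @[k --> \oo] --> moment m (damp n (u_ j)).
    rewrite (_ : (fun k => _) = fun k => moment m (damp n (u_ j)) - moment m (damp n (u_ k))); last first.
      by apply/funext => k; rewrite momentB_damp.
    rewrite -[X in _ --> X]subr0; apply: cvgB; first exact: cvg_cst.
    exact: moment_damp_cvg.
  by rewrite expr2; under eq_fun do rewrite expr2; exact: cvgM.
apply: (cvgr_to_le c); apply: filterS He => k; apply: le_trans.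
by apply: trunc_energy_le; exact: cballB.
Qed.

End Energy.
End RealEnergy.

(** * The Hilbert space l^2 *)

Section ComplexSquare.
Context {R : realType}.
Implicit Types z w : R[i].

(** The squared modulus as an element of [R]: the norm of [R[i]] takes its values in [R[i]], while
    series and order arguments are carried out in [R]. *)
Definition sqnorm z : R := complex.Re z ^+ 2 + complex.Im z ^+ 2.

Lemma sqnormE z : (sqnorm z)%:C = `|z| ^+ 2.
Proof. by rewrite add_Re2_Im2. Qed.

Lemma sqnorm_ge0 z : 0 <= sqnorm z.
Proof. by rewrite addr_ge0 ?sqr_ge0. Qed.

Lemma sqnormM z w : sqnorm (z * w) = sqnorm z * sqnorm w.
Proof. by case: z => a b; case: w => c d; rewrite /sqnorm /=; ring. Qed.

Lemma sqnorm0 : sqnorm (0 : R[i]) = 0.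
Proof. by rewrite /sqnorm /= expr0n addr0. Qed.

Lemma sqnormN z : sqnorm (- z) = sqnorm z.
Proof. by case: z => a b; rewrite /sqnorm /= !sqrrN. Qed.

Lemma sqnorm_eq0 z : sqnorm z = 0 -> z = 0.
Proof.
case: z => a b /eqP; rewrite /sqnorm /= paddr_eq0 ?sqr_ge0// !sqrf_eq0.
by case/andP => /eqP -> /eqP ->.
Qed.

Lemma sqnormD_le z w : sqnorm (z + w) <= 2 * sqnorm z + 2 * sqnorm w.
Proof. by case: z => a b; case: w => c d; rewrite /sqnorm /=; have := sqr_ge0 (a - c); have := sqr_ge0 (b - d); nra. Qed.

Lemma norm_sqrt z : `|z| = (Num.sqrt (sqnorm z))%:C.
Proof. by rewrite normc_def. Qed.

Lemma Re_cinner_le z w : `|complex.Re (z^* * w)| <= (sqnorm z + sqnorm w) / 2.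
Proof.
case: z => a b; case: w => c d; rewrite /sqnorm /= ler_norml.
have := sqr_ge0 (a - c); have := sqr_ge0 (b - d).
have := sqr_ge0 (a + c); have := sqr_ge0 (b + d).
by move=> ? ? ? ?; apply/andP; split; nra.
Qed.

Lemma Im_cinner_le z w : `|complex.Im (z^* * w)| <= (sqnorm z + sqnorm w) / 2.
Proof.
case: z => a b; case: w => c d; rewrite /sqnorm /= ler_norml.
have := sqr_ge0 (a - d); have := sqr_ge0 (b + c).
have := sqr_ge0 (a + d); have := sqr_ge0 (b - c).
by move=> ? ? ? ?; apply/andP; split; nra.
Qed.

Lemma conjM z w : (z * w)^* = z^* * w^*. Proof. exact: rmorphM. Qed.
Lemma conjD z w : (z + w)^* = z^* + w^*. Proof. exact: rmorphD. Qed.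
Lemma conj_realE (x : R) : x%:C^* = x%:C :> R[i].
Proof. exact: conjc_real. Qed.

Lemma ReD z w : complex.Re (z + w) = complex.Re z + complex.Re w.
Proof. by case: z; case: w. Qed.
Lemma ImD z w : complex.Im (z + w) = complex.Im z + complex.Im w.
Proof. by case: z; case: w. Qed.

End ComplexSquare.

Section SquareSummable.
Context {R : realType}.

(** Bounded partial sums: the terms are nonnegative, so this amounts to convergence, and closure
    under linear combinations is an estimate on finite sums. *)
Definition l2_pred : {pred nat -> R[i]} :=
  mem [set x : nat -> R[i] | exists M : R, forall N,
    \sum_(0 <= i < N) sqnorm (x i) <= M].

Lemma l2_predP (x : nat -> R[i]) : reflect (exists M : R, forall N,
    \sum_(0 <= i < N) sqnorm (x i) <= M) (x \in l2_pred).
Proof. by apply: (iffP idP); rewrite inE. Qed.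

Lemma l2_pred_submod : submod_closed l2_pred.
Proof.
split.
  apply/l2_predP; exists 0 => N; rewrite big1// => i _; exact: sqnorm0.
move=> a x y /l2_predP[M HM] /l2_predP[M' HM']; apply/l2_predP.
exists (2 * (sqnorm a * M) + 2 * M') => N.
apply: (@le_trans _ _ (2 * (sqnorm a * \sum_(0 <= i < N) sqnorm (x i)) +
   2 * \sum_(0 <= i < N) sqnorm (y i))).
  rewrite !mulr_sumr -big_split/=; apply: ler_sum => i _.
  by rewrite -sqnormM sqnormD_le.
rewrite lerD// ler_pM2l// ler_wpM2l// sqnorm_ge0//.
Qed.

HB.instance Definition _ := GRing.isSubmodClosed.Build _ _ l2_pred l2_pred_submod.

Record l2 := L2 { l2_seq : nat -> R[i]; l2_seqP : l2_seq \in l2_pred }.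

HB.instance Definition _ := [isSub for l2_seq].
HB.instance Definition _ := [Choice of l2 by <:].
HB.instance Definition _ := [SubChoice_isSubLmodule of l2 by <:].

End SquareSummable.
Arguments l2 : clear implicits.

Section L2Norm.
Context {R : realType}.
Implicit Types x y : l2 R.

Definition l2c x : nat -> R[i] := l2_seq x.
Arguments l2c : simpl never.

Lemma l2cD x y i : l2c (x + y) i = l2c x i + l2c y i. Proof. by []. Qed.
Lemma l2cZ a x i : l2c (a *: x) i = a * l2c x i. Proof. by []. Qed.
Lemma l2cN x i : l2c (- x) i = - l2c x i. Proof. by []. Qed.
Lemma l2c0 i : l2c 0 i = 0. Proof. by []. Qed.

Lemma l2P x y : (forall i, l2c x i = l2c y i) -> x = y.
Proof. by move=> H; apply/val_inj/funext. Qed.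

Definition l2q x : R := limn (series (fun i => sqnorm (l2c x i))).

Lemma l2_cvg x : cvgn (series (fun i => sqnorm (l2c x i))).
Proof.
have /l2_predP[M HM] := l2_seqP x.
apply: nondecreasing_is_cvgn.
  apply/nondecreasing_seqP => n; rewrite /series /= big_nat_recr//= lerDl.
  exact: sqnorm_ge0.
by exists M => _ [n _ <-]; exact: HM.
Qed.

Lemma l2_partial_le x N : \sum_(0 <= i < N) sqnorm (l2c x i) <= l2q x.
Proof.
apply: (nondecreasing_cvgn_le _ (@l2_cvg x)).
apply/nondecreasing_seqP => n; rewrite /series /= big_nat_recr//= lerDl.
exact: sqnorm_ge0.
Qed.

Lemma l2q_le x M : (forall N, \sum_(0 <= i < N) sqnorm (l2c x i) <= M) -> l2q x <= M.
Proof.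
move=> H; apply: limr_le; first exact: l2_cvg.
by apply: nearW => n; exact: H.
Qed.

Lemma l2q_ge0 x : 0 <= l2q x.
Proof. by have := l2_partial_le x 0; rewrite big_nil. Qed.

Lemma l2_coord_le x i : sqnorm (l2c x i) <= l2q x.
Proof.
apply: le_trans (l2_partial_le x i.+1); rewrite big_nat_recr//= lerDr.
by apply: sumr_ge0 => j _; exact: sqnorm_ge0.
Qed.

Definition l2r x y : R := limn (series (fun i => complex.Re ((l2c x i)^* * l2c y i))).
Definition l2i x y : R := limn (series (fun i => complex.Im ((l2c x i)^* * l2c y i))).

Lemma l2_dom_cvg x y (u : nat -> R) :
  (forall i, `|u i| <= (sqnorm (l2c x i) + sqnorm (l2c y i)) / 2) -> cvgn (series u).
Proof.
move=> H; apply: normed_cvg.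
apply: (@series_le_cvg _ _ (fun i => 2^-1 * (sqnorm (l2c x i) + sqnorm (l2c y i)))) => //.
- by move=> n /=.
- by move=> n /=; rewrite mulr_ge0// addr_ge0// sqnorm_ge0.
- by move=> n /=; rewrite mulrC.
apply: is_cvg_seriesZ; have := is_cvg_seriesD (@l2_cvg x) (@l2_cvg y).
by [].
Qed.

Lemma l2r_cvg x y : cvgn (series (fun i => complex.Re ((l2c x i)^* * l2c y i))).
Proof. apply: (@l2_dom_cvg x y) => i; exact: Re_cinner_le. Qed.

Lemma l2i_cvg x y : cvgn (series (fun i => complex.Im ((l2c x i)^* * l2c y i))).
Proof. apply: (@l2_dom_cvg x y) => i; exact: Im_cinner_le. Qed.

Definition l2dot x y : R[i] := Complex (l2r x y) (l2i x y).
Arguments l2dot : simpl never.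

Lemma l2dotDr x y z : l2dot x (y + z) = l2dot x y + l2dot x z.
Proof.
rewrite /l2dot /l2r /l2i; apply/eqP; rewrite eq_complex /=; apply/andP; split; apply/eqP.
  rewrite -lim_seriesD; [|exact: l2r_cvg..].
  by congr (limn (series _)); apply/funext => i /=; rewrite l2cD mulrDr ReD.
rewrite -lim_seriesD; [|exact: l2i_cvg..].
by congr (limn (series _)); apply/funext => i /=; rewrite l2cD mulrDr ImD.
Qed.

Let lim_seriesM (a : R) (f : R ^nat) : cvgn (series f) ->
  limn (series (fun i => a * f i)) = a * limn (series f).
Proof. by move/(lim_seriesZ a). Qed.

Lemma l2dotZr (c : R[i]) x y : l2dot x (c *: y) = c * l2dot x y.
Proof.
have cR := @l2r_cvg x y; have cI := @l2i_cvg x y.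
rewrite /l2dot /l2r /l2i; case: c => a b.
have E i : (l2c x i)^* * l2c ((a +i* b) *: y) i = (a +i* b) * ((l2c x i)^* * l2c y i).
  by rewrite l2cZ mulrCA.
apply/eqP; rewrite eq_complex /=; apply/andP; split; apply/eqP.
  rewrite -(lim_seriesM a cR) -(lim_seriesM b cI) -lim_seriesB; last 2 first.
  - exact: is_cvg_seriesZ.
  - exact: is_cvg_seriesZ.
  congr (limn (series _)); apply/funext => i; rewrite E.
  by rewrite !fctE; case: ((l2c x i)^* * l2c y i).
rewrite -(lim_seriesM a cI) -(lim_seriesM b cR) -lim_seriesD; last 2 first.
- exact: is_cvg_seriesZ.
- exact: is_cvg_seriesZ.
congr (limn (series _)); apply/funext => i; rewrite E.
by rewrite !fctE; case: ((l2c x i)^* * l2c y i).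
Qed.

Lemma l2dotC x y : l2dot y x = (l2dot x y)^*.
Proof.
rewrite /l2dot /l2r /l2i; apply/eqP; rewrite eq_complex /=; apply/andP; split; apply/eqP.
  congr (limn (series _)); apply/funext => i.
  by case: (l2c x i) => ? ?; case: (l2c y i) => ? ? /=; ring.
rewrite -lim_seriesN; last exact: l2i_cvg.
congr (limn (series _)); apply/funext => i.
by rewrite !fctE; case: (l2c x i) => ? ?; case: (l2c y i) => ? ? /=; ring.
Qed.

Lemma l2dotxx_q x : l2dot x x = (l2q x)%:C.
Proof.
rewrite /l2dot /l2r /l2i; apply/eqP; rewrite eq_complex /=; apply/andP; split; apply/eqP.
  congr (limn (series _)); apply/funext => i.
  by rewrite /sqnorm; case: (l2c x i) => ? ? /=; ring.
apply/cvg_lim => //; rewrite (_ : series _ = fun=> 0); first exact: cvg_cst.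
apply/funext => n; rewrite /series /= big1// => i _.
by case: (l2c x i) => ? ? /=; ring.
Qed.

Lemma l2qZ (c : R[i]) x : l2q (c *: x) = sqnorm c * l2q x.
Proof.
rewrite /l2q -(lim_seriesM (sqnorm c) (@l2_cvg x)).
by congr (limn (series _)); apply/funext => i; rewrite l2cZ sqnormM.
Qed.

Lemma l2dotDl x y z : l2dot (x + y) z = l2dot x z + l2dot y z.
Proof. by rewrite [LHS]l2dotC l2dotDr rmorphD [l2dot x z]l2dotC [l2dot y z]l2dotC. Qed.

Lemma l2rD x y : l2q (x + y) = l2q x + 2 * l2r x y + l2q y.
Proof.
have : l2dot (x + y) (x + y) = l2dot x x + (l2dot x y + (l2dot x y)^*) + l2dot y y.
    by rewrite l2dotDr !l2dotDl (l2dotC x y); ring.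
rewrite !l2dotxx_q => /(congr1 (@complex.Re R)); rewrite !ReD /= => ->; ring.
Qed.

Lemma l2q_eq0 x : l2q x = 0 -> x = 0.
Proof.
move=> x0; apply: l2P => i; apply: sqnorm_eq0; apply/le_anti.
by rewrite sqnorm_ge0 -x0 l2_coord_le.
Qed.

Definition l2n x : R := Num.sqrt (l2q x).

Lemma l2n_sqr x : l2n x ^+ 2 = l2q x.
Proof. by rewrite sqr_sqrtr// l2q_ge0. Qed.

Lemma l2n_ge0 x : 0 <= l2n x. Proof. exact: sqrtr_ge0. Qed.

Lemma l2n_eq0 x : l2n x = 0 -> x = 0.
Proof. by move=> x0; apply: l2q_eq0; rewrite -l2n_sqr x0 expr0n. Qed.

Lemma l2r_le x y : l2r x y <= l2n x * l2n y.
Proof.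
have [/eqP/l2n_eq0 ->|xn] := boolP (l2n x == 0).
  rewrite /l2r (_ : series _ = fun=> 0); last first.
    apply/funext => n; rewrite /series /= big1// => i _.
    by case: (l2c y i) => ? ?; rewrite l2c0 /=; ring.
  by rewrite lim_cst// mulr_ge0 ?l2n_ge0.
have [/eqP/l2n_eq0 ->|yn] := boolP (l2n y == 0).
  rewrite /l2r (_ : series _ = fun=> 0); last first.
    apply/funext => n; rewrite /series /= big1// => i _.
    by case: (l2c x i) => ? ?; rewrite l2c0 /=; ring.
  by rewrite lim_cst// mulr_ge0 ?l2n_ge0.
have x0 : 0 < l2n x by rewrite lt_neqAle eq_sym xn l2n_ge0.
have y0 : 0 < l2n y by rewrite lt_neqAle eq_sym yn l2n_ge0.
(* The real part of Cauchy-Schwarz follows from expanding the squared norm of [|y| x - |x| y], then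
   dividing by [2 |x| |y|]. *)
have := l2q_ge0 ((l2n y)%:C *: x + (- (l2n x)%:C) *: y).
rewrite l2rD !l2qZ sqnormN -!l2n_sqr.
have -> : l2r ((l2n y)%:C *: x) ((- (l2n x)%:C) *: y) = - (l2n x * l2n y * l2r x y).
  have : l2dot ((l2n y)%:C *: x) ((- (l2n x)%:C) *: y) = - ((l2n x * l2n y)%:C * l2dot x y).
    rewrite l2dotZr [l2dot (_ *: _) _]l2dotC l2dotZr [in RHS](l2dotC y x).
    rewrite conjM conj_realE rmorphM; ring.
  move=> /(congr1 (@complex.Re R)) /=; rewrite mul0r subr0 => ->; ring.
rewrite /sqnorm /= expr0n !addr0 => H.
have xy0 : 0 < l2n x * l2n y by rewrite mulr_gt0.
rewrite -(ler_pM2l xy0); nra.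
Qed.

Lemma l2nD x y : l2n (x + y) <= l2n x + l2n y.
Proof.
rewrite -(@ler_pXn2r _ 2)// ?nnegrE ?addr_ge0 ?l2n_ge0//.
by rewrite l2n_sqr l2rD -!l2n_sqr; have := l2r_le x y; nra.
Qed.

Definition l2norm x : R[i] := (l2n x)%:C.

Lemma l2normD x y : l2norm (x + y) <= l2norm x + l2norm y.
Proof. by rewrite /l2norm -rmorphD/= lecR l2nD. Qed.

Lemma l2normZ (c : R[i]) x : l2norm (c *: x) = `|c| * l2norm x.
Proof.
rewrite /l2norm norm_sqrt -rmorphM/= /l2n l2qZ sqrtrM//; exact: sqnorm_ge0.
Qed.

Lemma l2norm_eq0 x : l2norm x = 0 -> x = 0.
Proof. by move=> /complexI /l2n_eq0. Qed.

HB.instance Definition _ := Lmodule_isNormed.Build R[i] (l2 R)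
  l2normD l2normZ l2norm_eq0.

Lemma l2_normE x : `|x| = (l2n x)%:C. Proof. by []. Qed.

End L2Norm.
Arguments l2c {R} x _ : simpl never.
Arguments l2dot {R} x y : simpl never.

Section L2Complete.
Context {R : realType}.

Lemma l2_coord_norm_le (x : l2 R) i :
  `|complex.Re (l2c x i)| <= l2n x /\ `|complex.Im (l2c x i)| <= l2n x.
Proof.
have := l2_coord_le x i; rewrite -l2n_sqr /sqnorm => H.
by split; rewrite -(@ler_pXn2r _ 2)// ?nnegrE ?l2n_ge0// real_normK ?num_real//;
  apply: le_trans H; rewrite ?lerDl ?lerDr sqr_ge0.
Qed.

(** The coordinates converge along [F] to some [L]. Finite sums of [|x_i - y_i|^2] pass to the limit
    in [y], so those of [|x_i - L_i|^2] are at most [e^2] for every [N]: this shows both that [L] is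
    square summable and that [F] converges to it in norm. *)
Lemma l2_complete (F : set_system (l2 R)) : ProperFilter F -> cauchy F -> cvg F.
Proof.
move=> FF /cauchyP Fc.
have {}Fc (e : R) : 0 < e -> exists x, \forall y \near F, l2n (x - y) < e.
  move=> e0; have [|x Hx] := Fc e%:C; first by rewrite ltcR.
  exists x; apply: filterS Hx => y; rewrite -ball_normE /= l2_normE ltcR//.
have cvR i : cvg ((fun y => complex.Re (l2c y i)) @ F).
  apply: cauchy_cvg; apply: cauchy_exP => e e0.
  have [x Hx] := Fc _ e0; exists (complex.Re (l2c x i)).
  apply: filterS Hx => y xy; rewrite -ball_normE /=.
  have [H _] := l2_coord_norm_le (x - y) i.
  apply: le_lt_trans xy; apply: le_trans H.
  by rewrite l2cD l2cN; case: (l2c x i) => ? ?; case: (l2c y i).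
have cvI i : cvg ((fun y => complex.Im (l2c y i)) @ F).
  apply: cauchy_cvg; apply: cauchy_exP => e e0.
  have [x Hx] := Fc _ e0; exists (complex.Im (l2c x i)).
  apply: filterS Hx => y xy; rewrite -ball_normE /=.
  have [_ H] := l2_coord_norm_le (x - y) i.
  apply: le_lt_trans xy; apply: le_trans H.
  by rewrite l2cD l2cN; case: (l2c x i) => ? ?; case: (l2c y i).
pose L i : R[i] := Complex (lim ((fun y => complex.Re (l2c y i)) @ F))
                           (lim ((fun y => complex.Im (l2c y i)) @ F)).
have cvq x N : \sum_(0 <= i < N) sqnorm (l2c (x - y) i) @[y --> F] -->
    \sum_(0 <= i < N) sqnorm (l2c x i - L i).
  elim: N => [|N IHN].
    rewrite big_nil; under eq_fun do rewrite big_nil; exact: cvg_cst.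
  rewrite big_nat_recr//=; under eq_fun do rewrite big_nat_recr//=.
  apply: cvgD => //; rewrite /sqnorm.
  have E y : complex.Re (l2c (x - y) N) = complex.Re (l2c x N) - complex.Re (l2c y N) /\
             complex.Im (l2c (x - y) N) = complex.Im (l2c x N) - complex.Im (l2c y N).
    by rewrite l2cD l2cN; case: (l2c x N) => ? ?; case: (l2c y N).
  have -> : complex.Re (l2c x N - L N) = complex.Re (l2c x N) - lim ((fun y => complex.Re (l2c y N)) @ F).
    by case: (l2c x N).
  have -> : complex.Im (l2c x N - L N) = complex.Im (l2c x N) - lim ((fun y => complex.Im (l2c y N)) @ F).
    by case: (l2c x N).
  under eq_fun do rewrite (proj1 (E _)) (proj2 (E _)).
  apply: cvgD; rewrite expr2; under eq_fun do rewrite expr2.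
    by apply: cvgM; (apply: cvgB; [exact: cvg_cst|exact: cvR]).
  by apply: cvgM; (apply: cvgB; [exact: cvg_cst|exact: cvI]).
have Hle (e : R) : 0 < e -> exists2 x, (\forall y \near F, l2n (x - y) < e) &
    forall N, \sum_(0 <= i < N) sqnorm (l2c x i - L i) <= e ^+ 2.
  move=> e0; have [x Hx] := Fc _ e0; exists x => // N.
  apply: (cvgr_to_le (@cvq x N)); apply: filterS Hx => y xy.
  apply: le_trans (l2_partial_le _ _) _; rewrite -l2n_sqr.
  by rewrite lerXn2r// ?nnegrE ?l2n_ge0 ?(ltW e0) ?(ltW xy).
have LP : L \in l2_pred.
  have [x _ Hx] := Hle 1 ltr01.
  have Px : (fun i => l2c x i - L i) \in l2_pred by apply/l2_predP; exists (1 ^+ 2).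
  have -> : L = l2c x - (fun i => l2c x i - L i).
    by apply/funext => i; rewrite -[RHS]/(l2c x i - (l2c x i - L i)) opprB addrC subrK.
  by rewrite rpredB// l2_seqP.
pose l := L2 LP.
apply/cvg_ex; exists l; apply/cvgrPdist_le => /= e e0.
have e_real : e = (complex.Re e)%:C by rewrite RRe_real// gtr0_real.
pose e' := complex.Re e / 2.
have e'0 : 0 < e'.
  by rewrite divr_gt0// -ltcR -e_real.
have [x Hx HN] := Hle e' e'0.
apply: filterS Hx => y xy; rewrite l2_normE e_real lecR.
have -> : l - y = (l - x) + (x - y) by rewrite addrA subrK.
apply: le_trans (l2nD _ _) _.
have -> : complex.Re e = e' + e' by rewrite /e'; field.
apply: lerD; last exact: ltW.
rewrite -(@ler_pXn2r _ 2)// ?nnegrE ?l2n_ge0 ?(ltW e'0)// l2n_sqr.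
apply: l2q_le => N; apply: le_trans (HN N); apply: ler_sum => i _.
by rewrite -sqnormN l2cD l2cN opprB.
Qed.

HB.instance Definition _ := Uniform_isComplete.Build (l2 R) l2_complete.

Lemma l2dotxx (x : l2 R) : l2dot x x = `|x| ^+ 2.
Proof. by rewrite l2dotxx_q l2_normE -rmorphXn/= l2n_sqr. Qed.

HB.instance Definition _ := CompleteNormedModule_isHilbert.Build R (l2 R)
  l2dotDr l2dotZr l2dotC l2dotxx.

Definition l2_hilbert : hilbertType R := l2 R.
End L2Complete.

(** * Extension of contractions by density *)

Section HilbertGeneralities.
Context {R : realType}.

(** The norm as an element of [R], so that real inequalities and automation apply. *)
Definition nrm (V : hilbertType R) (x : V) : R := complex.Re `|x|.

Section OneSpace.
Variable V : hilbertType R.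
Implicit Types x y z : V.

Lemma nrmE x : `|x| = (nrm x)%:C.
Proof. by rewrite /nrm RRe_real// ger0_real. Qed.

Lemma nrm_ge0 x : 0 <= nrm x.
Proof. by rewrite -ler0c -nrmE. Qed.

Lemma nrmD x y : nrm (x + y) <= nrm x + nrm y.
Proof. by have := ler_normD x y; rewrite !nrmE -rmorphD lecR. Qed.

Lemma nrmN x : nrm (- x) = nrm x.
Proof. by rewrite /nrm normrN. Qed.

Lemma nrmBC x y : nrm (x - y) = nrm (y - x).
Proof. by rewrite -nrmN opprB. Qed.

Lemma nrm_tri z x y : nrm (x - y) <= nrm (x - z) + nrm (z - y).
Proof. by apply: le_trans (nrmD _ _); rewrite addrA subrK. Qed.

Lemma nrmZ (c : R[i]) x : nrm (c *: x) = Num.sqrt (sqnorm c) * nrm x.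
Proof. by apply/complexI; rewrite -nrmE normrZ nrmE norm_sqrt -rmorphM. Qed.

Lemma nrm0 : nrm (0 : V) = 0.
Proof. by rewrite /nrm normr0. Qed.

Lemma nrm_eq0 x : nrm x = 0 -> x = 0.
Proof. by move=> x0; apply/eqP; rewrite -normr_eq0 nrmE x0. Qed.

Lemma nrm_small x : (forall e, 0 < e -> nrm x <= e) -> x = 0.
Proof.
move=> H; apply: nrm_eq0; apply/le_anti; rewrite nrm_ge0 andbT.
by apply/ler_addgt0Pr => e e0; rewrite add0r; exact: H.
Qed.

Lemma hdotDl x y z : '<< x + y, z >> = '<< x, z >> + '<< y, z >>.
Proof. by rewrite hdotC hdotDr conjD -!hdotC. Qed.

Lemma hdotZl (c : R[i]) x y : '<< c *: x, y >> = c^* * '<< x, y >>.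
Proof. by rewrite hdotC hdotZr conjM -hdotC. Qed.

Lemma hdotNr x y : '<< x, - y >> = - '<< x, y >>.
Proof. by rewrite -scaleN1r hdotZr mulN1r. Qed.

Lemma hdotBr x y z : '<< x, y - z >> = '<< x, y >> - '<< x, z >>.
Proof. by rewrite hdotDr hdotNr. Qed.

Lemma hdotNl x y : '<< - x, y >> = - '<< x, y >>.
Proof. by rewrite hdotC hdotNr rmorphN /= -hdotC. Qed.

Lemma hdotBl x y z : '<< x - y, z >> = '<< x, z >> - '<< y, z >>.
Proof. by rewrite hdotDl hdotNl. Qed.

Lemma hdot0r x : '<< x, 0 >> = 0.
Proof. by rewrite -(scale0r (0 : V)) hdotZr mul0r. Qed.

Lemma hdotxx_nrm x : '<< x, x >> = (nrm x ^+ 2)%:C.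
Proof. by rewrite hdotxx nrmE -rmorphXn. Qed.

Lemma hdotxx_eq0 x : '<< x, x >> = 0 -> x = 0.
Proof.
rewrite hdotxx_nrm => /complexI /eqP; rewrite sqrf_eq0 => /eqP.
exact: nrm_eq0.
Qed.

Lemma hdot_CS x y : `|'<< x, y >>| <= (nrm x * nrm y)%:C.
Proof.
have [->|x0] := eqVneq x 0.
  by rewrite hdotC hdot0r rmorph0 normr0 nrm0 mul0r.
have n0 : 0 < nrm x.
  by rewrite lt_neqAle nrm_ge0 andbT eq_sym; apply: contra_neq x0 => /nrm_eq0.
(* [|x|^2] times the component of [y] orthogonal to [x], written without division. *)
pose w := (nrm x ^+ 2)%:C *: y - '<< x, y >> *: x.
have : '<< w, w >> = (nrm x ^+ 4 * nrm y ^+ 2 - nrm x ^+ 2 * sqnorm '<< x, y >>)%:C.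
  rewrite /w !hdotBl !hdotBr !hdotZl !hdotZr !hdotxx_nrm (hdotC x y) conj_realE.
  rewrite !(rmorphB, rmorphM)/= sqnormE normCK.
  ring.
rewrite hdotxx_nrm => /complexI H.
rewrite norm_sqrt lecR -(@ler_pXn2r _ 2)// ?nnegrE ?sqrtr_ge0 ?mulr_ge0 ?nrm_ge0//.
rewrite sqr_sqrtr ?sqnorm_ge0// exprMn.
rewrite -(ler_pM2l (_ : 0 < nrm x ^+ 2)) ?exprn_gt0// -subr_ge0.
by rewrite mulrA -exprD -H sqr_ge0.
Qed.

Lemma closure_nrm (A : set V) x :
  closure A x <-> forall e : R, 0 < e -> exists2 y, A y & nrm (x - y) < e.
Proof.
split=> [Ax e e0|H B].
  have [|y [Ay xy]] := Ax (ball x (e%:C)).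
    by apply: nbhsx_ballx; rewrite ltcR.
  by exists y => //; move: xy; rewrite -ball_normE /= nrmE ltcR.
move=> /nbhs_ballP[e /= e0 eB].
have eE : e = (complex.Re e)%:C by rewrite RRe_real// gtr0_real.
have [|y Ay xy] := H (complex.Re e); first by rewrite -ltcR -eE.
exists y; split => //; apply: eB; rewrite -ball_normE /= nrmE eE ltcR//.
Qed.

Lemma closureP_sub (A B : set V) :
  (forall x, A x -> closure B x) -> closure A `<=` closure B.
Proof.
move=> AB x /closure_nrm Ax; apply/closure_nrm => e e0.
have e20 : 0 < e / 2 by rewrite divr_gt0.
have [y Ay xy] := Ax _ e20.
have /closure_nrm/(_ _ e20)[z Bz yz] := AB _ Ay.
exists z => //; apply: le_lt_trans (nrm_tri y _ _) _.
by rewrite [ltRHS](splitr e) ltrD.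
Qed.

Lemma sub_closure_nrm (A : set V) x : A x -> closure A x.
Proof. by move=> Ax; apply: subset_closure. Qed.

Lemma closure_subspace (A : set V) :
  (forall c x y, A x -> A y -> A (c *: x + y)) ->
  forall c x y, closure A x -> closure A y -> closure A (c *: x + y).
Proof.
move=> AL c x y /closure_nrm Ax /closure_nrm Ay; apply/closure_nrm => e e0.
set k := Num.sqrt (sqnorm c) + 1.
have k0 : 0 < k by rewrite ltr_wpDl// sqrtr_ge0.
have [|x' Ax' xx'] := Ax (e / 2 / k); first by rewrite !divr_gt0.
have [|y' Ay' yy'] := Ay (e / 2); first by rewrite divr_gt0.
exists (c *: x' + y'); first exact: AL.
rewrite opprD addrACA -scalerBr; apply: le_lt_trans (nrmD _ _) _.
rewrite nrmZ [ltRHS](splitr e) ler_ltD//.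
rewrite ltr_pdivlMr// in xx'; apply: le_trans (ltW xx').
by rewrite mulrC ler_wpM2l ?nrm_ge0// /k lerDl.
Qed.

(** For [x] in [A] one has [|y|^2 = <y, y - x> <= |y| |y - x|], and [x] may be taken close to
    [y]. *)
Lemma hdot_dense0 (A : set V) y :
  (forall x, closure A x) -> (forall x, A x -> '<< y, x >> = 0) -> y = 0.
Proof.
move=> cA yA; apply: nrm_small => e e0.
have /closure_nrm/(_ _ e0)[x Ax yx] := cA y.
have H : (nrm y ^+ 2)%:C = '<< y, y - x >> by rewrite hdotBr (yA x)// subr0 hdotxx_nrm.
have := hdot_CS y (y - x); rewrite -H ger0_norm ?ler0c ?exprn_ge0 ?nrm_ge0//.
rewrite lecR => H2; have n0 := nrm_ge0 y.
have [//|en] := leP (nrm y) e; have n1 : 0 < nrm y by rewrite (lt_trans e0).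
move: H2; rewrite expr2 ler_pM2l// => /le_lt_trans/(_ yx).
by rewrite ltNge (ltW en).
Qed.

End OneSpace.

(** Used to carry identities between inner products from a dense set to its closure, one argument at
    a time. *)
Lemma lipschitz_closure_eq0 (V : hilbertType R) (A : set V) (f : V -> R[i]) (M : R) :
  0 <= M ->
  (forall x y, `|f x - f y| <= (M * nrm (x - y))%:C) ->
  (forall x, A x -> f x = 0) -> forall x, closure A x -> f x = 0.
Proof.
move=> M0 Hf fA x /closure_nrm Ax; apply/eqP; rewrite -normr_eq0 norm_sqrt.
suff -> : Num.sqrt (sqnorm (f x)) = 0 by [].
apply/le_anti; rewrite sqrtr_ge0 andbT; apply/ler_addgt0Pr => e e0; rewrite add0r.
have M1 : 0 < M + 1 by rewrite ltr_wpDl.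
have [|y Ay xy] := Ax (e / (M + 1)); first by rewrite divr_gt0.
have := Hf x y; rewrite (fA _ Ay) subr0 norm_sqrt lecR => /le_trans; apply.
rewrite ltr_pdivlMr// in xy; apply: le_trans (ltW xy).
by rewrite mulrC ler_wpM2l ?nrm_ge0// lerDl.
Qed.

Section Extension.
Variables (V W : hilbertType R) (T : Type) (D : set T) (i : T -> V) (w : T -> W).
Variable P : {linear V -> V}.
Hypothesis lin : forall c t t', D t -> D t' -> exists t'',
  [/\ D t'', i t'' = c *: i t + i t' & w t'' = c *: w t + w t'].
Hypothesis contr : forall t, D t -> nrm (w t) <= nrm (i t).
Hypothesis PD : forall x, closure (i @` D) (P x).

Let dist t t' : D t -> D t' -> nrm (w t - w t') <= nrm (i t - i t').
Proof.
move=> Dt Dt'; have [t'' [Dt'' it wt]] := lin (-1) Dt' Dt.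
by have := contr Dt''; rewrite it wt !scaleN1r ![- _ + _]addrC.
Qed.

Let approx x e : 0 < e -> exists2 t, D t & nrm (P x - i t) < e.
Proof.
by move=> e0; have /closure_nrm/(_ _ e0)[_ [t Dt <-] H] := @PD x; exists t.
Qed.

Let ext_val x : exists z, forall t, D t -> nrm (z - w t) <= nrm (P x - i t).
Proof.
have /choice[u Hu] : forall k : nat, exists t, D t /\ nrm (P x - i t) < k.+1%:R^-1.
  by move=> k; have [|t Dt Ht] := @approx x k.+1%:R^-1; [rewrite invr_gt0 ltr0n|exists t].
have small (e : R) : 0 < e -> \forall k \near \oo, k.+1%:R^-1 < e.
  move=> e0; have := cvgr0Pnorm_lt (harmonic : R^nat) => /(_ \oo _)[+ _].
  move=> /(_ cvg_harmonic e e0); apply: filterS => k; rewrite ger0_norm//.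
  by rewrite invr_ge0.
have cw : cvg (w (u k) @[k --> \oo]).
  apply: cauchy_cvg; apply: cauchy_exP => e e0.
  have eE : e = (complex.Re e)%:C by rewrite RRe_real// gtr0_real.
  have e20 : 0 < complex.Re e / 2 by rewrite divr_gt0// -ltcR -eE.
  have [N _ HN] := small _ e20.
  exists (w (u N)); suff : \forall k \near \oo, ball (w (u N)) e (w (u k)) by [].
  near=> k; rewrite -ball_normE /= nrmE eE ltcR.
  apply: le_lt_trans (dist (proj1 (Hu _)) (proj1 (Hu _))) _.
  apply: le_lt_trans (nrm_tri (P x) _ _) _.
  rewrite [ltRHS]splitr; apply: ltrD.
    by rewrite nrmBC; apply: lt_trans (proj2 (Hu _)) _; exact: (HN N (leqnn N)).
  by apply: lt_trans (proj2 (Hu _)) _; apply: (HN k); near: k; exists N.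
exists (lim (w (u k) @[k --> \oo])) => t Dt.
apply/ler_addgt0Pr => e e0.
have e20 : 0 < e / 2 by rewrite divr_gt0.
move/cvgrPdist_lt : cw => /(_ (e / 2)%:C); rewrite ltcR => /(_ e20) H1.
near \oo => k.
apply: le_trans (nrm_tri (w (u k)) _ _) _.
have H2 : nrm (lim (w (u k) @[k --> \oo]) - w (u k)) <= e / 2.
  by apply/ltW; rewrite -ltcR -nrmE; near: k.
have H3 : nrm (P x - i (u k)) <= e / 2.
  apply/ltW/(lt_trans (proj2 (Hu k))); near: k; exact: small.
have H4 : nrm (i (u k) - i t) <= e / 2 + nrm (P x - i t).
  by apply: le_trans (nrm_tri (P x) _ _) _; rewrite lerD2r nrmBC.
have H5 := dist (proj1 (Hu k)) Dt.
lra.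
Unshelve. all: by end_near. Qed.

(** [lin] and [contr] make [i t -> w t] a well-defined contraction, and precomposition with [P]
    makes its extension total on [V]. The index type allows data given on functions rather than on
    vectors. The inequality says at once that [L] equals [w t] where [P x = i t] and that it is the
    continuous extension. It is used for W, indexed by test functions, and for its adjoint, indexed
    by K_s with [i] equal to W. *)
Lemma extend_contraction : exists L : {linear V -> W},
  forall x t, D t -> nrm (L x - w t) <= nrm (P x - i t).
Proof.
have [f Hf] := choice ext_val.
(* The estimate of [ext_val] determines the value, so linearity only requires approximating both
   sides by the same [w t]. *)
have uniq x z : (forall e, 0 < e -> exists t, [/\ D t, nrm (P x - i t) <= e & nrm (z - w t) <= e]) -> z = f x.
  move=> H; apply/eqP; rewrite -subr_eq0; apply/eqP/nrm_small => e e0.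
  have [|t [Dt H1 H2]] := H (e / 2); first by rewrite divr_gt0.
  apply: le_trans (nrm_tri (w t) _ _) _; rewrite [leRHS]splitr lerD//.
  by rewrite nrmBC; apply: le_trans (Hf _ _ Dt) _.
have fL : linear f.
  move=> c x y; apply/esym/uniq => e e0.
  set k := Num.sqrt (sqnorm c) + 1.
  have k0 : 0 < k by rewrite ltr_wpDl// sqrtr_ge0.
  have [|t Dt tx] := @approx x (e / 2 / k); first by rewrite !divr_gt0.
  have [|t' Dt' ty] := @approx y (e / 2); first by rewrite divr_gt0.
  have [t'' [Dt'' it wt]] := lin c Dt Dt'.
  have key (V' : hilbertType R) (p q p' q' : V') : nrm (p - p') <= e / 2 / k ->
      nrm (q - q') <= e / 2 -> nrm (c *: p + q - (c *: p' + q')) <= e.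
    move=> h1 h2; rewrite opprD addrACA -scalerBr; apply: le_trans (nrmD _ _) _.
    rewrite [leRHS]splitr lerD// nrmZ.
    rewrite ler_pdivlMr// in h1; apply: le_trans h1.
    by rewrite mulrC ler_wpM2l ?nrm_ge0// /k lerDl.
  exists t''; split=> //.
    by rewrite it linearP; apply: key; exact: ltW.
  rewrite wt; apply: key; first by apply: le_trans (Hf _ _ Dt) (ltW tx).
  exact: le_trans (Hf _ _ Dt') (ltW ty).
pose mf := GRing.isLinear.Build _ _ _ _ f fL.
pose L : {linear V -> W} := HB.pack f mf.
by exists L => x t Dt; exact: Hf.
Qed.

End Extension.

End HilbertGeneralities.

(** * Diagonal operators on l^2 *)

Section DiagonalOperators.
Context {R : realType}.
Implicit Types (x y w : l2 R).

Lemma sqnorm_real (r : R) : sqnorm r%:C = r ^+ 2.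
Proof. by rewrite /sqnorm /= expr0n addr0. Qed.

Lemma l2n_le_coord (M : R) x y : 0 <= M ->
  (forall i, sqnorm (l2c x i) <= M ^+ 2 * sqnorm (l2c y i)) -> l2n x <= M * l2n y.
Proof.
move=> M0 H; rewrite -(@ler_pXn2r _ 2)// ?nnegrE ?mulr_ge0 ?l2n_ge0//.
rewrite exprMn !l2n_sqr; apply: l2q_le => N.
apply: (@le_trans _ _ (\sum_(0 <= i < N) M ^+ 2 * sqnorm (l2c y i))).
  by apply: ler_sum => i _; exact: H.
by rewrite -mulr_sumr ler_wpM2l ?sqr_ge0// l2_partial_le.
Qed.

Lemma diag_exists (d : nat -> R[i]) (M : R) : 0 <= M ->
  (forall i, sqnorm (d i) <= M ^+ 2) ->
  exists T : {linear l2 R -> l2 R},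
    (forall x i, l2c (T x) i = d i * l2c x i) /\ forall x, l2n (T x) <= M * l2n x.
Proof.
move=> M0 dM.
have dx x : (fun i => d i * l2c x i) \in l2_pred.
  apply/l2_predP; exists (M ^+ 2 * l2q x) => N.
  apply: (@le_trans _ _ (\sum_(0 <= i < N) M ^+ 2 * sqnorm (l2c x i))).
    by apply: ler_sum => i _; rewrite sqnormM ler_wpM2r// sqnorm_ge0.
  by rewrite -mulr_sumr ler_wpM2l ?sqr_ge0// l2_partial_le.
pose f x : l2 R := L2 (dx x).
have fE x i : l2c (f x) i = d i * l2c x i by [].
have fL : linear f.
  by move=> c x y; apply: l2P => i; rewrite l2cD l2cZ !fE l2cD l2cZ; ring.
pose mf := GRing.isLinear.Build _ _ _ _ f fL.
pose T : {linear l2 R -> l2 R} := HB.pack f mf.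
exists T; split=> // x; apply: l2n_le_coord => // i.
by rewrite sqnormM ler_wpM2r// sqnorm_ge0.
Qed.

Lemma l2_delta_subproof n : (fun i => (i == n)%:R : R[i]) \in l2_pred.
Proof.
apply/l2_predP; exists 1 => N.
have [nN|Nn] := ltnP n N.
  rewrite (bigD1_seq n) ?mem_index_iota ?iota_uniq//= eqxx big1.
    by rewrite addr0 /sqnorm /= expr1n expr0n addr0.
  by move=> i /negbTE ->; rewrite sqnorm0.
rewrite big_nat big1// => i /= iN; rewrite ltn_eqF ?sqnorm0//.
exact: leq_trans Nn.
Qed.

Definition l2_delta n : l2 R := L2 (l2_delta_subproof n).

Lemma l2c_delta n i : l2c (l2_delta n) i = (i == n)%:R. Proof. by []. Qed.

Lemma l2_delta_neq0 n : l2_delta n != 0.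
Proof.
apply/eqP => /(congr1 (fun x => l2c x n)); rewrite l2c_delta eqxx l2c0.
by move/eqP; rewrite oner_eq0.
Qed.

Lemma l2c_sum (I : Type) (r : seq I) (F : I -> l2 R) i :
  l2c (\sum_(j <- r) F j) i = \sum_(j <- r) l2c (F j) i.
Proof. by apply: (big_morph (fun x => l2c x i)). Qed.

Lemma l2c_trunc x N i :
  l2c (\sum_(0 <= j < N) l2c x j *: l2_delta j) i = if (i < N)%N then l2c x i else 0.
Proof.
rewrite l2c_sum; case: ltnP => iN.
  rewrite (bigD1_seq i) ?mem_index_iota ?iota_uniq//= big1.
    by rewrite l2cZ l2c_delta eqxx mulr1 addr0.
  by move=> j ji; rewrite l2cZ l2c_delta eq_sym (negbTE ji) mulr0.
rewrite big_nat big1// => j /= jN; rewrite l2cZ l2c_delta gtn_eqF ?mulr0//.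
exact: leq_trans iN.
Qed.

Lemma l2_trunc_cvg x e : 0 < e -> exists N,
  l2n (x - \sum_(0 <= j < N) l2c x j *: l2_delta j) < e.
Proof.
move=> e0; have /cvgrPdist_lt/(_ (e ^+ 2)) := @l2_cvg _ x.
rewrite exprn_gt0// => /(_ isT) [N _ /(_ N (leqnn N))] /=.
rewrite -/(l2q x) ger0_norm ?subr_ge0 ?l2_partial_le// => HN; exists N.
rewrite -(@ltr_pXn2r _ 2)// ?nnegrE ?l2n_ge0 ?(ltW e0)// l2n_sqr.
apply: le_lt_trans HN; rewrite /series /=; apply: l2q_le => M.
rewrite lerBrDl.
have E i : sqnorm (l2c (x - \sum_(0 <= j < N) l2c x j *: l2_delta j) i) =
    if (i < N)%N then 0 else sqnorm (l2c x i).
  by rewrite l2cD l2cN l2c_trunc; case: ifP; rewrite ?subrr ?sqnorm0 ?subr0.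
apply: le_trans (l2_partial_le x (maxn N M)).
rewrite [leRHS](@big_cat_nat _ _ _ N)//= ?leq_maxl// lerD2l.
under eq_bigr do rewrite E.
have [MN|/ltnW NM] := leqP M N.
  rewrite big_nat big1; last by move=> i /= iM; rewrite (leq_trans iM).
  by apply: sumr_ge0 => i _; exact: sqnorm_ge0.
rewrite (@big_cat_nat _ _ _ N 0 M)//= big_nat big1 ?add0r; last by move=> i /= ->.
rewrite big_nat [leRHS]big_nat; apply: ler_sum => i /andP[iN _].
by rewrite ltnNge iN.
Qed.

Section Decreasing.
Variables (lam : nat -> R) (T : {linear l2 R -> l2 R}).
Hypothesis lam0 : forall n, 0 < lam n.
Hypothesis lam_dec : forall m n, (m < n)%N -> lam n < lam m.
Hypothesis TE : forall x i, l2c (T x) i = (lam i)%:C * l2c x i.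

Lemma iter_diagE k x i : l2c (iter k T x) i = (lam i ^+ k)%:C * l2c x i.
Proof.
elim: k => [|k IHk]; first by rewrite expr0 mul1r.
by rewrite iterS TE IHk exprS rmorphM mulrA.
Qed.

(* If [v] has no component on the first [n] basis vectors, then
   [T ^ k v / lam n ^ k] tends to the [n]-th component of [v]. *)
Lemma diag_invariant_full (L : set (l2 R)) :
  (forall c x y, L x -> L y -> L (c *: x + y)) ->
  (forall x, (forall e, 0 < e -> exists2 y, L y & l2n (x - y) < e) -> L x) ->
  (forall x, L x -> L (T x)) -> (forall n, exists2 w, L w & l2c w n != 0) ->
  forall x, L x.
Proof.
move=> Llin Lcl LT Lw.
have [w0 Lw0 _] := Lw 0%N.
have L0 : L 0 by have := Llin (-1) _ _ Lw0 Lw0; rewrite scaleN1r addNr.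
have LZ c x : L x -> L (c *: x) by move=> Lx; have := Llin c _ _ Lx L0; rewrite addr0.
have LD x y : L x -> L y -> L (x + y) by move=> Lx Ly; have := Llin 1 _ _ Lx Ly; rewrite scale1r.
have Lsum N (F : nat -> l2 R) : (forall j, (j < N)%N -> L (F j)) -> L (\sum_(0 <= j < N) F j).
  elim: N => [|N IHN] HF; first by rewrite big_nil.
  rewrite big_nat_recr//=; apply: LD; last exact: HF.
  by apply: IHN => j jN; apply: HF; exact: ltnW.
suff Ld n : L (l2_delta n).
  move=> x; apply: Lcl => e e0; have [N HN] := l2_trunc_cvg x e0.
  by exists (\sum_(0 <= j < N) l2c x j *: l2_delta j) => //; apply: Lsum => j _; exact: LZ.
elim/ltn_ind: n => n IHn.
have [w Lw' wn] := Lw n.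
(* By induction the first [n] basis vectors lie in [L], so the first [n] coordinates can be removed
   from [w] without leaving [L]. *)
pose v := w - \sum_(0 <= j < n) l2c w j *: l2_delta j.
have Lv : L v.
  rewrite /v -scaleN1r addrC; apply: Llin => //; apply: Lsum => j jn.
  by apply: LZ; exact: IHn.
have vE i : l2c v i = if (i < n)%N then 0 else l2c w i.
  by rewrite /v l2cD l2cN l2c_trunc; case: ifP; rewrite ?subrr ?subr0.
suff Lwn : L (l2c w n *: l2_delta n).
  by have := LZ (l2c w n)^-1 _ Lwn; rewrite scalerA mulVf// scale1r.
apply: Lcl => e e0.
(* All ratios [lam i / lam n] with [i > n] are at most [r < 1], so the coordinates beyond [n] of
   [T ^ k v / lam n ^ k] decay like [r ^ k], uniformly in [i]. *)
pose r := lam n.+1 / lam n.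
have r0 : 0 < r by rewrite divr_gt0.
have r1 : r < 1 by rewrite ltr_pdivrMr// mul1r lam_dec.
have [k Hk] : exists k, r ^+ k * l2n v < e.
  have := @cvg_geometric _ (l2n v) r; rewrite ger0_norm ?ltW// => /(_ r1).
  move=> /cvgrPdist_lt/(_ e e0) [k _ /(_ k (leqnn k))] /=.
  rewrite sub0r normrN ger0_norm; last by rewrite mulr_ge0 ?l2n_ge0// exprn_ge0// ltW.
  by rewrite mulrC; exists k.
exists ((lam n ^+ k)^-1%:C *: iter k T v).
  by apply: LZ; elim: k {Hk} => //= k IHk; exact: LT.
apply: le_lt_trans Hk; apply: l2n_le_coord; first by rewrite exprn_ge0 ?ltW.
move=> i; rewrite l2cD l2cN !l2cZ iter_diagE l2c_delta vE.
have ln0 : lam n ^+ k != 0 by rewrite expf_neq0// gt_eqF.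
case: (ltngtP i n) => [ilt|igt|->].
- by rewrite !mulr0 subr0 sqnorm0 mulr0.
- rewrite mulr0 sub0r sqnormN mulrA -rmorphM sqnormM sqnorm_real.
  rewrite ler_wpM2r ?sqnorm_ge0// lerXn2r ?nnegrE ?exprn_ge0 ?(ltW r0)//.
    by rewrite mulr_ge0 ?invr_ge0 ?exprn_ge0// ltW.
  rewrite mulrC /r expr_div_n ler_wpM2r ?invr_ge0 ?exprn_ge0 ?(ltW (lam0 n))//.
  apply: lerXn2r; rewrite ?nnegrE ?(ltW (lam0 _))//.
  by move: igt; rewrite leq_eqVlt => /predU1P[<-//|/lam_dec/ltW].
- rewrite mulr1 mulrA -rmorphM mulVf// rmorph1 mul1r subrr sqnorm0.
  by rewrite mulr_ge0 ?sqr_ge0 ?sqnorm_ge0.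
Qed.

Hypothesis lam_cvg : lam n @[n --> \oo] --> (0 : R).

Lemma diag_delta n : T (l2_delta n) = (lam n)%:C *: l2_delta n.
Proof.
apply: l2P => i; rewrite TE l2cZ l2c_delta.
by case: eqVneq => [->|] //; rewrite !mulr0.
Qed.

Lemma diag_point_spectrum :
  @point_spectrum R (l2_hilbert) T = [set (lam n)%:C | n in @setT nat].
Proof.
apply/seteqP; split=> [z [x x0 Tx]|_ [n _ <-]]; last first.
  by exists (l2_delta n); [exact: l2_delta_neq0|exact: diag_delta].
have [i xi] : exists i, l2c x i != 0.
  apply/not_existsP => H; move/negP: x0; apply; apply/eqP/l2P => i.
  by rewrite l2c0; apply/eqP/negPn/negP; exact: H.
exists i => //; apply: (mulIf xi).
by have := congr1 (fun y => l2c y i) Tx; rewrite TE l2cZ.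
Qed.

Lemma diag_spectrum :
  @spectrum R (l2_hilbert) T = [set (lam n)%:C | n in @setT nat] `|` [set 0].
Proof.
apply/seteqP; split=> [z|z].
  move=> Sz; apply: contrapT => /not_orP[/forall2NP Hn z0]; apply: Sz.
  have zn n : (lam n)%:C - z != 0.
    by rewrite subr_eq0; apply/eqP; case: (Hn n) => [/(_ I)|].
  pose u n := sqnorm ((lam n)%:C - z).
  have u0 n : 0 < u n.
    rewrite lt_neqAle sqnorm_ge0 andbT eq_sym; apply/eqP => /sqnorm_eq0 /eqP.
    exact/negP.
  have sz0 : sqnorm z != 0 by apply/eqP => /sqnorm_eq0 /z0.
  (* Since [lam n] tends to 0, [u n] tends to [|z|^2], which is nonzero; the inverses converge,
     hence are bounded, and the diagonal operator with entries [(lam n - z)^-1] is a bounded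
     resolvent. *)
  have cu : (u n)^-1 @[n --> \oo] --> (sqnorm z)^-1.
    apply: cvgV => //; rewrite -sqnormN.
    have E n : u n = (lam n - complex.Re z) ^+ 2 + (complex.Im z) ^+ 2.
      by rewrite /u; case: (z) => p q; rewrite /sqnorm /= sub0r sqrrN.
    have -> : sqnorm (- z) = (0 - complex.Re z) ^+ 2 + (complex.Im z) ^+ 2.
      by case: (z) => p q; rewrite /sqnorm /= sub0r [(- q) ^+ 2]sqrrN.
    rewrite (_ : u = fun n => (lam n - complex.Re z) ^+ 2 + (complex.Im z) ^+ 2); last exact/funext.
    apply: cvgD; last exact: cvg_cst.
    by rewrite expr2; under eq_fun do rewrite expr2; apply: cvgM; apply: cvgB => //; exact: cvg_cst.
  have /cvg_seq_bounded [K [Kreal HK]] : cvgn (fun n => (u n)^-1) by apply/cvg_ex; eexists; exact: cu.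
  have HK1 n : (u n)^-1 <= `|K| + 1.
    have := HK (`|K| + 1); rewrite (le_lt_trans (ler_norm _)) ?ltrDl// => /(_ isT n I) /=.
    by rewrite ger0_norm// invr_ge0 ltW.
  have K0 : 0 <= `|K| + 1 by rewrite addr_ge0.
  have [||B [BE Bn]] := @diag_exists (fun n => ((lam n)%:C - z)^-1) (Num.sqrt (`|K| + 1)).
  - exact: sqrtr_ge0.
  - move=> i; rewrite sqr_sqrtr//; apply: le_trans (HK1 i).
    rewrite -[leLHS](mulfK (lt0r_neq0 (u0 i))) -sqnormM mulVf//.
    by rewrite (sqnorm_real 1) expr1n mul1r.
  exists B; split.
  - exists (Num.sqrt (`|K| + 1))%:C => x.
    have := Bn x; rewrite -lecR rmorphM; exact.
  - move=> x; apply: l2P => i; rewrite BE l2cD l2cN TE l2cZ -mulrBl mulrA mulVf ?mul1r//.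
  - move=> x; apply: l2P => i; rewrite l2cD l2cN TE l2cZ BE -mulrBl mulrA mulfV ?mul1r//.
case=> [[n _ <-]|->] [B [[M HM] BK _]].
  have := BK (l2_delta n); rewrite diag_delta subrr linear0 => /esym/eqP.
  exact/negP/l2_delta_neq0.
(* A bounded inverse of [T] would send [lam n] times the n-th basis vector to that vector, so its
   bound would satisfy [1 <= M lam n] for every [n], contradicting that [lam n] tends to 0. *)
have HB n : 1 <= complex.Re M * lam n.
  have := HM ((lam n)%:C *: l2_delta n).
  have := BK (l2_delta n); rewrite scale0r subr0 diag_delta => ->.
  have n0 : 0 < l2n (l2_delta n).
    rewrite lt_neqAle l2n_ge0 andbT eq_sym; apply/eqP => /l2n_eq0 /eqP.
    exact/negP/l2_delta_neq0.
  have -> : `|(lam n)%:C *: l2_delta n| = (lam n * l2n (l2_delta n))%:C.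
    by rewrite normrZ rmorphM ger0_norm // ler0c ltW.
  rewrite lecE => /andP[_]; have -> (r : R) : complex.Re (M * r%:C) = complex.Re M * r.
    by case: (M) => p q; rewrite /= mulr0 subr0.
  by rewrite mulrA -[X in X <= _ -> _]mul1r ler_pM2r.
have : 1 <= complex.Re M * 0.
  have cM : complex.Re M * lam n @[n --> \oo] --> complex.Re M * 0.
    by apply: cvgM => //; exact: cvg_cst.
  by apply: (cvgr_to_ge cM); apply: nearW => n; exact: HB.
by rewrite mulr0 ler10.
Qed.

End Decreasing.
End DiagonalOperators.

(** * Test functions *)

Section ComplexTestFunctions.
Context {R : realType}.
Implicit Types (f g : R -> R[i]) (r d : R).
Local Notation Re := (@complex.Re R).
Local Notation Im := (@complex.Im R).

Lemma normc_le_parts (z : R[i]) : `|z| <= (`|Re z| + `|Im z|)%:C.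
Proof.
rewrite norm_sqrt lecR -(@ler_pXn2r _ 2)// ?nnegrE ?sqrtr_ge0 ?addr_ge0//.
rewrite sqr_sqrtr ?sqnorm_ge0// /sqnorm sqrrD !real_normK ?num_real//.
by rewrite lerD2r lerDl mulrn_wge0// mulr_ge0.
Qed.

Lemma parts_le_normc (z : R[i]) :
  `|Re z| <= Num.sqrt (sqnorm z) /\ `|Im z| <= Num.sqrt (sqnorm z).
Proof.
by split; rewrite -(@ler_pXn2r _ 2)// ?nnegrE ?sqrtr_ge0// sqr_sqrtr ?sqnorm_ge0//
  real_normK ?num_real// /sqnorm ?lerDl ?lerDr sqr_ge0.
Qed.

Lemma continuous_parts f : continuous (f : R -> R[i]^o) <->
  continuous (Re \o f) /\ continuous (Im \o f).
Proof.
split=> [cf|[cr ci] x].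
  split=> x; apply/cvgrPdist_lt => e e0.
    have /cvgrPdist_lt/(_ e%:C) := cf x; rewrite ltcR => /(_ e0).
    apply: filterS => y; rewrite norm_sqrt ltcR; apply: le_lt_trans.
    have [H _] := parts_le_normc (f x - f y); apply: le_trans H.
    by rewrite /=; case: (f x) => ? ?; case: (f y).
  have /cvgrPdist_lt/(_ e%:C) := cf x; rewrite ltcR => /(_ e0).
  apply: filterS => y; rewrite norm_sqrt ltcR; apply: le_lt_trans.
  have [_ H] := parts_le_normc (f x - f y); apply: le_trans H.
  by rewrite /=; case: (f x) => ? ?; case: (f y).
apply/cvgrPdist_lt => e e0.
have eE : e = (Re e)%:C by rewrite RRe_real// gtr0_real.
have e20 : 0 < Re e / 2 by rewrite divr_gt0// -ltcR -eE.
have /cvgrPdist_lt/(_ _ e20) := cr x; have /cvgrPdist_lt/(_ _ e20) := ci x.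
apply: filterS2 => y H1 H2; apply: le_lt_trans (normc_le_parts _) _.
rewrite eE ltcR [ltRHS]splitr; apply: ltrD.
  by apply: le_lt_trans H2; rewrite /=; case: (f x) => ? ?; case: (f y).
by apply: le_lt_trans H1; rewrite /=; case: (f x) => ? ?; case: (f y).
Qed.

Definition ccsupp r f := continuous (f : R -> R[i]^o) /\ forall x, f x != 0 -> `|x| <= r.

Definition cannulus d r f :=
  continuous (f : R -> R[i]^o) /\ forall x, f x != 0 -> d <= `|x| <= r.

Lemma parts_neq0 (z : R[i]) : (Re z != 0) || (Im z != 0) -> z != 0.
Proof. by apply: contraTneq => ->; rewrite /= eqxx. Qed.

Lemma ccsupp_parts r f : ccsupp r f -> csupp r (Re \o f) /\ csupp r (Im \o f).
Proof.
move=> [/continuous_parts[cr ci] sf]; split; split => // x /= H; apply: sf; apply: parts_neq0.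
  by rewrite H.
by rewrite H orbT.
Qed.

Lemma cannulus_parts d r f : cannulus d r f ->
  annulus d r (Re \o f) /\ annulus d r (Im \o f).
Proof.
move=> [/continuous_parts[cr ci] sf]; split; split => // x /= H; apply: sf; apply: parts_neq0.
  by rewrite H.
by rewrite H orbT.
Qed.

Lemma closure_supp f (A : set R) : closed A -> (forall x, f x != 0 -> A x) ->
  closure [set x | f x != 0] `<=` A.
Proof.
move=> cA fA; rewrite [X in _ `<=` X](closure_id A).1//.
by apply: closureS => x /=; exact: fA.
Qed.

Lemma closed_ball_itv r : closed [set x : R | `|x| <= r].
Proof.
rewrite (_ : [set _ | _] = `[- r, r]%classic); first exact: interval_closed.
by apply/seteqP; split=> x /=; rewrite in_itv /= ler_norml.
Qed.

Lemma ccsupp_Cc (D : set R) r f : ccsupp r f -> (forall x, `|x| <= r -> D x) -> Cc D f.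
Proof.
move=> [cf sf] rD.
have sub : closure [set x | f x != 0] `<=` [set x : R | `|x| <= r].
  by apply: closure_supp => //; exact: closed_ball_itv.
split=> //; last by move=> x /sub /rD.
apply: (subclosed_compact (@closed_closure _ _) (@segment_compact _ (- r) r)).
by move=> x /sub /=; rewrite in_itv /= ler_norml.
Qed.

Lemma ccsupp_CcT r f : ccsupp r f -> Cc setT f.
Proof. by move=> sf; exact: ccsupp_Cc sf _. Qed.

Lemma cannulus_ccsupp d r f : cannulus d r f -> ccsupp r f.
Proof. by move=> [cf sf]; split => // x /sf /andP[]. Qed.

Lemma cannulus_Cc0 d r f : 0 < d -> cannulus d r f -> Cc [set~ 0] f.
Proof.
move=> d0 af; have [_ cpt _] := ccsupp_CcT (cannulus_ccsupp af).
have [cf sf] := af; split => //.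
have cl : closed [set x : R | d <= `|x|].
  rewrite (_ : [set _ | _] = ~` [set x : R | `|x| < d]).
    apply: open_closedC; rewrite (_ : [set _ | _] = `]- d, d[%classic); first exact: interval_open.
    by apply/seteqP; split=> x /=; rewrite in_itv /= ltr_norml.
  by apply/seteqP; split=> x /=; rewrite leNgt => /negP.
move=> x /(closure_supp cl (fun x fx => proj1 (andP (sf x fx)))) /= dx x0.
by move: dx; rewrite x0 normr0 leNgt d0.
Qed.

(** The support is compact in the open interval, so [1 / (1 - |x|)] is bounded on it by some [B],
    and [r = 1 - 1/B] works. *)
Lemma Cc_ccsupp f : Cc `]-1, 1[ f -> exists r, [/\ 0 <= r, r < 1 & ccsupp r f].
Proof.
move=> [cf cpt sub]; set K := closure _ in cpt sub.
have K1 x : K x -> `|x| < 1 by move=> /sub; rewrite /= in_itv /= ltr_norml.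
have : compact ((fun x : R => (1 - `|x|)^-1) @` K).
  apply: continuous_compact => //; apply: continuous_in_subspaceT => x xK.
  have x1 : `|x| < 1 by apply: K1; move: xK; rewrite inE.
  apply: cvgV; first by rewrite gt_eqF// subr_gt0.
  by apply: cvgB; [exact: cvg_cst|exact: (@norm_continuous _ R^o)].
move=> /compact_bounded [M [Mreal HM]].
pose B := `|M| + 1; have B0 : 0 < B by rewrite ltr_wpDl.
have B1 : 1 <= B by rewrite lerDr.
exists (1 - B^-1); split.
- by rewrite subr_ge0 invf_le1.
- by rewrite ltrBlDr ltrDl invr_gt0.
split => // x fx; have Kx : K x by exact: subset_closure.
have x1 : 0 < 1 - `|x| by rewrite subr_gt0 K1.
have := HM B; rewrite (le_lt_trans (ler_norm M)) ?ltrDl// => /(_ isT (1 - `|x|)^-1).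
have H : ((fun x : R => (1 - `|x|)^-1) @` K) (1 - `|x|)^-1 by exists x.
move=> /(_ H) /(le_trans (ler_norm _)) HB.
by rewrite lerBrDr -lerBrDl -[leRHS]invrK lef_pV2 ?posrE ?invr_gt0.
Qed.

(** On this class J is given by its formula and all series converge; it is stable under the dilation
    and dense in K_s. *)
Definition test0 f := exists d r, [/\ 0 < d, d <= r, r < 1 & cannulus d r f].

Lemma test0_ccsupp f : test0 f -> exists r, [/\ 0 <= r, r < 1 & ccsupp r f].
Proof.
move=> [d [r [d0 dr r1 af]]]; exists r; split => //; last exact: cannulus_ccsupp af.
by rewrite (le_trans (ltW d0)).
Qed.

Lemma ccsupp_Cc1 r f : r < 1 -> ccsupp r f -> Cc `]-1, 1[ f.
Proof.
move=> r1 sf; apply: ccsupp_Cc sf _ => x xr.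
by rewrite /= in_itv /= -ltr_norml (le_lt_trans xr).
Qed.

Lemma test0_Cc1 f : test0 f -> Cc `]-1, 1[ f.
Proof. by move=> /test0_ccsupp[r [_ r1 sf]]; exact: ccsupp_Cc1 sf. Qed.

Lemma test0_CcT f : test0 f -> Cc setT f.
Proof. by move=> /test0_ccsupp[r [_ _ sf]]; exact: ccsupp_CcT sf. Qed.

Lemma test0_Cc0 f : test0 f -> Cc [set~ 0] f.
Proof. by move=> [d [r [d0 _ _ af]]]; exact: cannulus_Cc0 af. Qed.

Lemma test0_lin (c : R[i]) f g : test0 f -> test0 g -> test0 (fun x => c * f x + g x).
Proof.
move=> [d [r [d0 dr r1 [cf sf]]]] [d' [r' [d'0 dr' r'1 [cg sg]]]].
exists (Num.min d d'), (Num.max r r'); split.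
- by rewrite lt_min d0.
- by rewrite ge_min !le_max dr.
- by rewrite gt_max r1.
split; first by move=> x; apply: cvgD; [apply: cvgM; [exact: cvg_cst|exact: cf]|exact: cg].
move=> x; have [->|/sf /andP[H1 H2]] := eqVneq (f x) 0.
  rewrite mulr0 add0r => /sg /andP[H1 H2]; apply/andP; split.
    by rewrite ge_min H1 orbT.
  by rewrite le_max H2 orbT.
by move=> _; rewrite ge_min H1 le_max H2.
Qed.

Lemma cvgM_real (u : R -> R) f : continuous u -> continuous (f : R -> R[i]^o) ->
  continuous ((fun x => (u x)%:C * f x) : R -> R[i]^o).
Proof.
move=> cu /continuous_parts[cr ci]; apply/continuous_parts; split.
  rewrite (_ : _ \o _ = fun x => u x * (Re \o f) x); last first.
    by apply/funext => x /=; case: (f x) => p q /=; rewrite mul0r subr0.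
  by move=> x; apply: cvgM; [exact: cu|exact: cr].
rewrite (_ : _ \o _ = fun x => u x * (Im \o f) x); last first.
  by apply/funext => x /=; case: (f x) => p q /=; rewrite mul0r addr0.
by move=> x; apply: cvgM; [exact: cu|exact: ci].
Qed.

Lemma ccsupp_dil r (c b : R) f : 0 < c -> ccsupp r f ->
  ccsupp (r / c) (fun x => b%:C * f (c * x)).
Proof.
move=> c0 [cf sf]; split.
  apply: cvgM_real => x; first exact: cvg_cst.
  by apply: (@continuous_comp _ _ _ (fun x => c * x) (f : R -> R[i]^o)); [exact: mulrl_continuous|exact: cf].
move=> x; rewrite mulf_eq0 negb_or => /andP[_ /sf].
by rewrite normrM (gtr0_norm c0) mulrC -ler_pdivlMr.
Qed.

Lemma test0_dil (c b : R) f : 1 < c -> test0 f -> test0 (fun x => b%:C * f (c * x)).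
Proof.
move=> c1 [d [r [d0 dr r1 af]]]; have c0 : 0 < c by rewrite (lt_trans _ c1).
exists (d / c), (r / c); split.
- by rewrite divr_gt0.
- by rewrite ler_pM2r ?invr_gt0.
- by rewrite ltr_pdivrMr// mul1r (lt_trans r1).
split; first by have [] := ccsupp_dil b c0 (cannulus_ccsupp af).
move=> x; rewrite mulf_eq0 negb_or => /andP[_ /(proj2 af)].
by rewrite normrM (gtr0_norm c0) ler_pdivrMr// ler_pdivlMr// mulrC.
Qed.

Lemma ccsupp_inv (s d r : R) f : 0 < d -> d <= r -> cannulus d r f ->
  ccsupp d^-1 (fun x => (`|x| `^ (- s - 1))%:C * f (1 / x)).
Proof.
move=> d0 dr [cf sf]; have r0 : 0 < r by exact: lt_le_trans dr.
split; last first.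
  move=> x; rewrite mulf_eq0 negb_or div1r => /andP[_ /sf/andP[dx xr]].
  have x0 : x != 0.
    by apply: contraTneq dx => ->; rewrite invr0 normr0 -ltNge.
  by rewrite -[leLHS]invrK lef_pV2 ?posrE ?invr_gt0 ?normr_gt0// -normfV.
move=> x; have [->|x0] := eqVneq x 0.
  (* At 0 the argument [1 / 0] is 0 by convention, where [f] vanishes; for small nonzero [x] the
     argument [1 / x] leaves the support. *)
  have E0 : (`|0 : R| `^ (- s - 1))%:C * f (1 / 0) = 0 :> R[i].
    have f0 : f 0 = 0 by apply/eqP/negPn/negP => /sf; rewrite normr0 leNgt d0.
    by rewrite div1r invr0 f0 mulr0.
  rewrite /continuous_at E0; apply: cvg_near_cst.
  have : \forall z \near (0 : R), `|z| < r^-1.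
    have := @nbhsx_ballx _ R (0 : R) r^-1 ; rewrite invr_gt0 => /(_ r0).
    by apply: filterS => z; rewrite -ball_normE /= sub0r normrN.
  apply: filterS => z zr; apply/eqP/negPn/negP.
  rewrite mulf_eq0 negb_or div1r => /andP[_ /sf/andP[dz]].
  have z0 : z != 0 by apply: contraTneq dz => ->; rewrite invr0 normr0 -ltNge.
  rewrite leNgt => /negP; apply.
  by rewrite normfV -[ltLHS]invrK ltf_pV2 ?posrE ?invr_gt0 ?normr_gt0.
have c1 : (fun z : R => `|z| `^ (- s - 1)) y @[y --> x] --> `|x| `^ (- s - 1).
  apply: (@continuous_comp _ _ _ (fun z : R => `|z|) (fun z => z `^ (- s - 1))).
    exact: (@norm_continuous _ R^o).
  have ax : 0 < `|x| by rewrite normr_gt0.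
  have D := is_derive1_powR (- s - 1) ax.
  by apply: differentiable_continuous; exact/derivable1_diffP.
have c2 : (f (1 / y) : R[i]^o) @[y --> x] --> (f (1 / x) : R[i]^o).
  apply: (@continuous_comp _ _ _ (fun z : R => 1 / z) (f : R -> R[i]^o)); last exact: cf.
  by apply: cvgM; [exact: cvg_cst|exact: inv_continuous].
have c1' : ((`|y| `^ (- s - 1))%:C : R[i]^o) @[y --> x] --> ((`|x| `^ (- s - 1))%:C : R[i]^o).
  apply/cvgrPdist_lt => e e0.
  have eE : e = (Re e)%:C by rewrite RRe_real// gtr0_real.
  have e'0 : 0 < Re e by rewrite -ltcR -eE.
  have /cvgrPdist_lt/(_ _ e'0) := c1; apply: filterS => y H.
  rewrite -rmorphB; apply: le_lt_trans (normc_le_parts _) _.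
  by rewrite /= normr0 addr0 eE ltcR.
exact: cvgM c1' c2.
Qed.

End ComplexTestFunctions.

(** * Realization of the form <f, J g> in l^2 *)

Section RieszForm.
Context {R : realType}.
Implicit Types (f g : R -> R[i]).
Local Notation Re := (@complex.Re R).
Local Notation Im := (@complex.Im R).

Definition rgood (s : R) (u v : R -> R) := dgood (fun x y => u x * rkernel s x y * v y).

Lemma riesz_form_parts s f g :
  rgood s (Re \o f) (Re \o g) -> rgood s (Im \o f) (Im \o g) ->
  rgood s (Re \o f) (Im \o g) -> rgood s (Im \o f) (Re \o g) ->
  riesz_form s f g =
    Complex (rform s (Re \o f) (Re \o g) + rform s (Im \o f) (Im \o g))
            (rform s (Re \o f) (Im \o g) - rform s (Im \o f) (Re \o g)).
Proof.
move=> Grr Gii Gri Gir.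
transitivity (Complex
  (dint (fun x y => Re ((f x)^* * (`|x - y| `^ (s - 1))%:C * g y)))
  (dint (fun x y => Im ((f x)^* * (`|x - y| `^ (s - 1))%:C * g y)))).
  by [].
congr Complex.
  apply: etrans (dintD Grr Gii); apply: eq_dint => x y.
  by rewrite /rkernel /=; case: (f x) => p q; case: (g y) => p' q' /=; ring.
apply: etrans (dintB Gri Gir); apply: eq_dint => x y.
by rewrite /rkernel /=; case: (f x) => p q; case: (g y) => p' q' /=; ring.
Qed.

Lemma test0_common f g : test0 f -> test0 g ->
  exists d r, [/\ 0 < d, d <= r, r < 1, cannulus d r f & cannulus d r g].
Proof.
move=> [d [r [d0 dr r1 [cf sf]]]] [d' [r' [d'0 dr' r'1 [cg sg]]]].
exists (Num.min d d'), (Num.max r r'); split.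
- by rewrite lt_min d0.
- by rewrite ge_min !le_max dr.
- by rewrite gt_max r1.
- by split => // x /sf /andP[H1 H2]; rewrite ge_min H1 le_max H2.
- by split => // x /sg /andP[H1 H2]; rewrite ge_min H1 le_max H2 !orbT.
Qed.

Definition cmoment n f : R[i] := Complex (moment n (Re \o f)) (moment n (Im \o f)).

Lemma cmoment_lin n c f g : (exists r, ccsupp r f) -> (exists r, ccsupp r g) ->
  cmoment n (fun x => c * f x + g x) = c * cmoment n f + cmoment n g.
Proof.
move=> [r sf] [r' sg]; have [fr fi] := ccsupp_parts sf; have [gr gi] := ccsupp_parts sg.
have Ifr := moment_integ n fr; have Ifi := moment_integ n fi.
have Igr := moment_integ n gr; have Igi := moment_integ n gi.
case: c => p q; rewrite /cmoment /moment; apply/eqP; rewrite eq_complex /=; apply/andP; split; apply/eqP.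
  rewrite -(rintZ p Ifr) -mulNr -(rintZ (- q) Ifi) -rintD; [|exact: integZ..].
  rewrite -rintD//; last by apply: integD; exact: integZ.
  by apply: eq_rint => x /=; case: (f x) => ? ?; case: (g x) => ? ? /=; ring.
rewrite -(rintZ p Ifi) -(rintZ q Ifr) -rintD; [|exact: integZ..].
rewrite -rintD//; last by apply: integD; exact: integZ.
by apply: eq_rint => x /=; case: (f x) => ? ?; case: (g x) => ? ? /=; ring.
Qed.

Lemma moment_dil r n (b c : R) (u : R -> R) : 0 < c -> 0 <= r -> csupp r u ->
  moment n (fun x => b * u (c * x)) = b / c ^+ n.+1 * moment n u.
Proof.
move=> c0 r0 su; have cn0 : c ^+ n != 0 by rewrite expf_neq0// gt_eqF.
have sn : csupp r (fun x => x ^+ n * u x) by apply: csuppM => //; exact: continuous_expr.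
have sc : csupp (r / c) (fun x => (c * x) ^+ n * u (c * x)).
  split; last first.
    by move=> x /(proj2 sn); rewrite normrM (gtr0_norm c0) mulrC -ler_pdivlMr.
  by move=> x; apply: (@continuous_comp _ _ _ (fun x => c * x) (fun x => x ^+ n * u x));
    [exact: mulrl_continuous|exact: (proj1 sn)].
rewrite exprS invfM mulrCA [X in X * _]mulrC -mulrA -(rint_scale c0 r0 sn).
rewrite -rintZ; last exact: csupp_integ sc.
by apply: eq_rint => x; rewrite exprMn; field.
Qed.

Lemma cmoment_dil r n (b c : R) f : 0 < c -> 0 <= r -> ccsupp r f ->
  cmoment n (fun x => b%:C * f (c * x)) = (b / c ^+ n.+1)%:C * cmoment n f.
Proof.
move=> c0 r0 sf; have [fr fi] := ccsupp_parts sf.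
rewrite /cmoment; apply/eqP; rewrite eq_complex /= !mul0r subr0 addr0.
rewrite -(moment_dil n b c0 r0 fr) -(moment_dil n b c0 r0 fi).
apply/andP; split; apply/eqP; apply: eq_rint => x /=; congr (_ * _).
  by case: (f (c * x)) => ? ? /=; rewrite mul0r subr0.
by case: (f (c * x)) => ? ? /=; rewrite mul0r addr0.
Qed.

End RieszForm.

Section Realization.
Context {R : realType}.
Local Notation Re := (@complex.Re R).
Local Notation Im := (@complex.Im R).
Variables (s : R) (H : hilbertType R) (iota : (R -> R[i]) -> H) (J : {linear H -> H}).
Hypotheses (s01 : 0 < s < 1) (hC : is_riesz_completion s iota)
  (hJ : is_inversion s iota J).
Implicit Types (f g : R -> R[i]).

Let s0 : 0 < s. Proof. by case/andP: s01. Qed.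
Let s1 : s < 1. Proof. by case/andP: s01. Qed.

Let iota_lin (c : R[i]) f g : Cc setT f -> Cc setT g ->
  iota (fun x => c * f x + g x) = c *: iota f + iota g.
Proof. by case: hC => + _ _; apply. Qed.

Let iota_form f g : Cc setT f -> Cc setT g -> '<< iota f, iota g >> = riesz_form s f g.
Proof. by case: hC => _ + _; apply. Qed.

Lemma unitary_nrm (V : hilbertType R) (T : V -> V) x : unitary T -> nrm (T x) = nrm x.
Proof.
move=> [TT _]; apply/eqP; rewrite -(@eqrXn2 _ 2) ?nrm_ge0//; apply/eqP/complexI.
by rewrite -!hdotxx_nrm TT.
Qed.

Lemma nrm_iota r f : 0 <= r -> r < 1 -> ccsupp r f ->
  nrm (iota f) ^+ 2 = rform s (Re \o f) (Re \o f) + rform s (Im \o f) (Im \o f).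
Proof.
move=> r0 r1 sf; have [fr fi] := ccsupp_parts sf.
have G u v : csupp r u -> csupp r v -> rgood s u v.
  by move=> su sv; have [] := dint_riesz s01 r1 r0 su sv.
have := hdotxx_nrm (iota f).
rewrite iota_form; [|exact: ccsupp_CcT sf..].
rewrite riesz_form_parts; [|exact: G..].
by move=> /(congr1 Re) /= <-.
Qed.

Let coef n : R := bin_coef (1 - s) n.
Let coef0 n : 0 < coef n. Proof. by apply: bin_coef_gt0; rewrite subr_gt0. Qed.

Definition hardy_coord f n : R[i] := (Num.sqrt (coef n))%:C * cmoment n f.

Lemma iota_J_parts f g : test0 f -> test0 g ->
  \sum_(0 <= i < N) coef i * Re ((cmoment i f)^* * cmoment i g) @[N --> \oo] -->
    Re '<< iota f, J (iota g) >> /\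
  \sum_(0 <= i < N) coef i * Im ((cmoment i f)^* * cmoment i g) @[N --> \oo] -->
    Im '<< iota f, J (iota g) >>.
Proof.
move=> tf tg; have [d [r [d0 dr r1 af ag]]] := test0_common tf tg.
have [fr fi] := ccsupp_parts (cannulus_ccsupp af).
have [gr gi] := cannulus_parts ag.
have [_ _ JE] := hJ; rewrite JE; last exact: test0_Cc0.
pose h (x : R) : R[i] := (`|x| `^ (- s - 1))%:C * g (1 / x).
have -> : '<< iota f, iota (fun x => (`|x| `^ (- s - 1))%:C * g (1 / x)) >> = riesz_form s f h.
  apply: iota_form; first exact: test0_CcT.
  exact: ccsupp_CcT (ccsupp_inv s d0 dr ag).
have Ehr : Re \o h = fun y => `|y| `^ (- s - 1) * (Re \o g) y^-1.
  by apply/funext => y; rewrite /h /= div1r; case: (g _) => ? ? /=; rewrite mul0r subr0.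
have Ehi : Im \o h = fun y => `|y| `^ (- s - 1) * (Im \o g) y^-1.
  by apply/funext => y; rewrite /h /= div1r; case: (g _) => ? ? /=; rewrite mul0r addr0.
have [Grr Crr] := dint_inversion s1 d0 dr r1 fr gr.
have [Gii Cii] := dint_inversion s1 d0 dr r1 fi gi.
have [Gri Cri] := dint_inversion s1 d0 dr r1 fr gi.
have [Gir Cir] := dint_inversion s1 d0 dr r1 fi gr.
rewrite riesz_form_parts; [|by rewrite ?Ehr ?Ehi..].
rewrite Ehr Ehi /=; split.
  rewrite (_ : (fun N => _) = (fun N =>
      \sum_(0 <= i < N) bin_coef (1 - s) i * (moment i (Re \o f) * moment i (Re \o g)) +
      \sum_(0 <= i < N) bin_coef (1 - s) i * (moment i (Im \o f) * moment i (Im \o g)))).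
    exact: cvgD Crr Cii.
  apply/funext => N; rewrite -big_split/=; apply: eq_bigr => i _.
  by rewrite /coef /cmoment /=; ring.
rewrite (_ : (fun N => _) = (fun N =>
    \sum_(0 <= i < N) bin_coef (1 - s) i * (moment i (Re \o f) * moment i (Im \o g)) -
    \sum_(0 <= i < N) bin_coef (1 - s) i * (moment i (Im \o f) * moment i (Re \o g)))).
  exact: cvgB Cri Cir.
apply/funext => N; rewrite -sumrB/=; apply: eq_bigr => i _.
by rewrite /coef /cmoment /=; ring.
Qed.

Let hardy_coordM f g i : (hardy_coord f i)^* * hardy_coord g i =
  (coef i)%:C * ((cmoment i f)^* * cmoment i g).
Proof.
rewrite /hardy_coord conjM conj_realE -{3}(sqr_sqrtr (ltW (coef0 i))) rmorphXn; ring.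
Qed.

Let ReZ (r : R) (z : R[i]) : Re (r%:C * z) = r * Re z.
Proof. by case: z => p q /=; rewrite mul0r subr0. Qed.
Let ImZ (r : R) (z : R[i]) : Im (r%:C * z) = r * Im z.
Proof. by case: z => p q /=; rewrite mul0r addr0. Qed.

Lemma hardy_coord_cvg f g : test0 f -> test0 g ->
  series (fun i => Re ((hardy_coord f i)^* * hardy_coord g i)) @ \oo -->
    Re '<< iota f, J (iota g) >> /\
  series (fun i => Im ((hardy_coord f i)^* * hardy_coord g i)) @ \oo -->
    Im '<< iota f, J (iota g) >>.
Proof.
move=> tf tg; have [cr ci] := iota_J_parts tf tg; split.
  rewrite (_ : series _ = fun N => \sum_(0 <= i < N) coef i * Re ((cmoment i f)^* * cmoment i g))//.
  by apply/funext => N; apply: eq_bigr => i _; rewrite hardy_coordM ReZ.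
rewrite (_ : series _ = fun N => \sum_(0 <= i < N) coef i * Im ((cmoment i f)^* * cmoment i g))//.
by apply/funext => N; apply: eq_bigr => i _; rewrite hardy_coordM ImZ.
Qed.

Let sqnorm_conj (z : R[i]) : sqnorm z = Re (z^* * z).
Proof. by case: z => p q; rewrite /sqnorm /=; ring. Qed.

(** With [g = f] the terms of the expansion are the squared moduli, so the partial sums increase to
    [<f, J f>], which bounds them. *)
Lemma hardy_coord_l2 f : test0 f -> hardy_coord f \in l2_pred.
Proof.
move=> tf; have [+ _] := hardy_coord_cvg tf tf; set g := series _ => cg.
apply/l2_predP; exists (Re '<< iota f, J (iota f) >>) => N.
have E : \sum_(0 <= i < N) sqnorm (hardy_coord f i) = g N.
  by apply: eq_bigr => i _; rewrite sqnorm_conj.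
have <- : limn g = Re '<< iota f, J (iota f) >> by exact: cvg_lim.
rewrite E; apply: (nondecreasing_cvgn_le _ (cvgP _ cg)).
apply/nondecreasing_seqP => m.
have -> : g m.+1 = g m + sqnorm (hardy_coord f m).
  by rewrite sqnorm_conj /g /series /= big_nat_recr.
by rewrite lerDl sqnorm_ge0.
Qed.

(** Total on functions by the default value 0; only the values on [test0], where the coordinates are
    square summable, are meaningful. *)
Definition hardy_vec f : l2 R := insubd (0 : l2 R) (hardy_coord f).

Lemma hardy_vecE f i : test0 f -> l2c (hardy_vec f) i = hardy_coord f i.
Proof. by move=> /hardy_coord_l2 tf; rewrite /l2c /hardy_vec -[l2_seq _]/(val _) insubdK. Qed.

Lemma hardy_vec_dot f g : test0 f -> test0 g ->
  l2dot (hardy_vec f) (hardy_vec g) = '<< iota f, J (iota g) >>.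
Proof.
move=> tf tg; have [cr ci] := hardy_coord_cvg tf tg.
rewrite /l2dot /l2r /l2i.
rewrite (_ : (fun i => Re _) = fun i => Re ((hardy_coord f i)^* * hardy_coord g i)); last first.
  by apply/funext => i; rewrite !hardy_vecE.
rewrite (_ : (fun i => Im _) = fun i => Im ((hardy_coord f i)^* * hardy_coord g i)); last first.
  by apply/funext => i; rewrite !hardy_vecE.
by rewrite (cvg_lim _ cr)// (cvg_lim _ ci)//; case: '<< _, _ >>.
Qed.

Lemma hardy_vec_le f : test0 f -> l2n (hardy_vec f) <= nrm (iota f).
Proof.
move=> tf; rewrite -(@ler_pXn2r _ 2)// ?nnegrE ?l2n_ge0 ?nrm_ge0// l2n_sqr.
have := hardy_vec_dot tf tf; rewrite l2dotxx_q => E.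
have := hdot_CS (iota f) (J (iota f)); rewrite -E (unitary_nrm _ (let: And3 u _ _ := hJ in u)).
by rewrite ger0_norm ?ler0c ?l2q_ge0// lecR expr2.
Qed.

Lemma hardy_vec_lin (c : R[i]) f g : test0 f -> test0 g ->
  hardy_vec (fun x => c * f x + g x) = c *: hardy_vec f + hardy_vec g.
Proof.
move=> tf tg; apply: l2P => i; rewrite l2cD l2cZ !hardy_vecE//; last exact: test0_lin.
have [r [_ _ sf]] := test0_ccsupp tf; have [r' [_ _ sg]] := test0_ccsupp tg.
by rewrite /hardy_coord cmoment_lin; [ring|exists r|exists r'].
Qed.

Lemma iota_test0_lin (c : R[i]) f g : test0 f -> test0 g ->
  iota (fun x => c * f x + g x) = c *: iota f + iota g.
Proof. by move=> tf tg; apply: iota_lin; exact: test0_CcT. Qed.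

(* Functions vanishing near 0 suffice, and on them [J] is given by its formula. *)
Lemma Ks_test0 : Ks iota = closure (iota @` test0).
Proof.
apply/seteqP; split; last by apply: closureS => _ [f tf <-]; exists f => //; exact: test0_Cc1.
apply: closureP_sub => _ [f Cf <-]; apply/closure_nrm => e e0.
have [r [r0 r1 sf]] := Cc_ccsupp Cf; have [fr fi] := ccsupp_parts sf.
have [Mr Mr0 HMr] := csupp_bounded fr; have [Mi Mi0 HMi] := csupp_bounded fi.
pose M := Num.max Mr Mi.
have M0 : 0 <= M by rewrite le_max Mr0.
(* [K t] bounds the energy of the part of [f] within distance [2 t] of 0: each of the real and
   imaginary parts has supremum at most [M] and integral at most [4 t M]. The number [t] below makes
   this less than [e^2], and [t <= 1/4] keeps the inner radius of the annulus below the outer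
   one. *)
pose K := M * rkbound s * (M * 4) * 2.
have K0 : 0 <= K by rewrite /K !mulr_ge0// rkbound_ge0.
pose t := Num.min (4^-1 : R) (e ^+ 2 / (K + 1) / 2).
have t0 : 0 < t by rewrite /t lt_min invr_gt0 ltr0n/= !divr_gt0 ?exprn_gt0// ltr_wpDl.
have t4 : t <= 4^-1 by rewrite /t ge_min lexx.
have tK : K * t < e ^+ 2.
  have : t <= e ^+ 2 / (K + 1) / 2 by rewrite /t ge_min lexx orbT.
  have K1 : 0 < K + 1 by rewrite ltr_wpDl.
  rewrite ler_pdivlMr// ler_pdivlMr// => HH.
  have e2 : 0 < e ^+ 2 by rewrite exprn_gt0.
  nra.
(* A continuous cutoff, 0 for [|x| <= t] and 1 for [|x| >= 2 t]. *)
pose chi (x : R) : R := Num.min 1 (Num.max 0 (`|x| / t - 1)).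
have chi01 x : 0 <= chi x <= 1 by rewrite /chi le_min ge_min le_max !lexx ler01.
have chi_c : continuous chi.
  move=> x; apply: (@continuous_min _ _ (fun=> 1) (fun x => Num.max 0 (`|x| / t - 1))).
    exact: cvg_cst.
  apply: (@continuous_max _ _ (fun=> 0) (fun x : R => `|x| / t - 1)); first exact: cvg_cst.
  by apply: cvgB; [apply: cvgM; [exact: (@norm_continuous _ R^o)|]|]; exact: cvg_cst.
have chi_small x : `|x| <= t -> chi x = 0.
  move=> xt; rewrite /chi max_l ?min_r//.
  by rewrite subr_le0 ler_pdivrMr// mul1r.
have chi_big x : t * 2 < `|x| -> chi x = 1.
  move=> xt; rewrite /chi min_l// le_max; apply/orP; right.
  by rewrite lerBrDr ler_pdivlMr// mulrC -[1 + 1]/(2%:R) ltW.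
have tg : test0 (fun x => (chi x)%:C * f x).
  exists t, (Num.max r 4^-1); split => //.
  - by rewrite le_max t4 orbT.
  - by rewrite gt_max r1 invf_lt1// ltr1n.
  split; first by apply: cvgM_real => //; case: sf.
  move=> x; rewrite mulf_eq0 negb_or => /andP[cx /(proj2 sf) xr].
  rewrite le_max xr andbT; apply: contraNT cx; rewrite -ltNge => /ltW/chi_small ->.
  by rewrite rmorph0.
exists (iota (fun x => (chi x)%:C * f x)); first by exists (fun x => (chi x)%:C * f x).
pose k (x : R) : R[i] := (1 - chi x)%:C * f x.
have sk' : ccsupp r k.
  split.
    by apply: cvgM_real; [move=> x; apply: cvgB; [exact: cvg_cst|exact: chi_c]|case: sf].
  by move=> x; rewrite /k mulf_eq0 negb_or => /andP[_ /(proj2 sf)].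
have sk : ccsupp (t * 2) k.
  split; first by case: sk'.
  move=> x; rewrite /k mulf_eq0 negb_or => /andP[+ _].
  by apply: contraNT; rewrite -ltNge => /chi_big ->; rewrite subrr rmorph0.
have -> : iota f - iota (fun x => (chi x)%:C * f x) = iota k.
  rewrite addrC -scaleN1r -iota_lin; last 2 first.
  - exact: test0_CcT.
  - exact: ccsupp_CcT sf.
  by congr iota; apply/funext => x; rewrite /k rmorphB rmorph1; ring.
rewrite -(@ltr_pXn2r _ 2)// ?nnegrE ?nrm_ge0 ?(ltW e0)//.
rewrite (nrm_iota r0 r1 sk'); apply: le_lt_trans tK.
have bound (u : R -> R) : csupp r u -> csupp (t * 2) u -> (forall x, `|u x| <= M) ->
    rform s u u <= M * rkbound s * (M * (t * 2 + t * 2)).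
  move=> su su2 HM; apply: le_trans (ler_norm _) _.
  apply: le_trans (dint_riesz_le s01 r1 r0 su su M0 HM) _.
  rewrite ler_wpM2l ?mulr_ge0 ?rkbound_ge0//.
  by apply: csupp_rint_norm_le su2 HM; rewrite mulr_ge0// ltW.
have [kr ki] := ccsupp_parts sk'; have [kr2 ki2] := ccsupp_parts sk.
have EK : K * t = M * rkbound s * (M * (t * 2 + t * 2)) + M * rkbound s * (M * (t * 2 + t * 2)).
  by rewrite /K; ring.
have chi1 x : `|1 - chi x| <= 1.
  by have /andP[? ?] := chi01 x; rewrite ger0_norm ?subr_ge0// gerBl.
rewrite EK; apply: lerD; apply: bound => // x.
  rewrite /k /= ReZ normrM -[M]mul1r; apply: ler_pM => //.
  by rewrite le_max HMr.
rewrite /k /= ImZ normrM -[M]mul1r; apply: ler_pM => //.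
by rewrite le_max HMi orbT.
Qed.

Lemma Ks_lin c x y : Ks iota x -> Ks iota y -> Ks iota (c *: x + y).
Proof.
rewrite Ks_test0; apply: closure_subspace => {}c _ _ [f tf <-] [g tg <-].
by rewrite -iota_test0_lin//; exists (fun x => c * f x + g x) => //; exact: test0_lin.
Qed.

(** The two bounds add up to [e^2 / 2], which is at most [9/16 e^2]; the constant 3/4 leaves [e / 4]
    for the distance from [x] to its approximation. *)
Let quarter_sq (e A B : R) : A <= (e / 4 + e / 4) ^+ 2 ->
  B <= (e / 4 + e / 4) ^+ 2 -> A + B <= (3 / 4 * e) ^+ 2.
Proof. by have := sqr_ge0 e; nra. Qed.

(** The second hypothesis is what [W x = 0] says before W is available. Test functions [t k] tending
    to [x] have moments tending to 0, while the energy of [t N - t k] stays small for [k >= N];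
    [energy_moment0] then makes the energy of [t N], hence the norm of [x], small. *)
Lemma Ks_inj (x : H) : Ks iota x ->
  (forall f, test0 f -> l2n (hardy_vec f) <= nrm (x - iota f)) -> x = 0.
Proof.
rewrite Ks_test0 => /closure_nrm Kx Hx.
have /choice[t Ht] : forall k : nat, exists f, test0 f /\ nrm (x - iota f) < k.+1%:R^-1.
  move=> k; have [|_ [f tf <-] Hf] := Kx k.+1%:R^-1; first by rewrite invr_gt0 ltr0n.
  by exists f.
have small (e : R) : 0 < e -> \forall k \near \oo, k.+1%:R^-1 < e.
  move=> e0; have /cvgrPdist_lt/(_ e e0) := @cvg_harmonic R.
  by apply: filterS => k /=; rewrite sub0r normrN ger0_norm// invr_ge0.
(* By [Hx] the norm of [hardy_vec (t k)] is at most that of [x - iota (t k)], and its i-th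
   coordinate is the i-th moment times a fixed positive factor. *)
have mom0 i : moment i (Re \o t k) @[k --> \oo] --> (0 : R) /\
              moment i (Im \o t k) @[k --> \oo] --> (0 : R).
  have bnd k : Num.sqrt (coef i) * Num.sqrt (sqnorm (cmoment i (t k))) <= k.+1%:R^-1.
    have [tk Hk] := Ht k.
    apply: le_trans (ltW Hk); apply: le_trans (Hx _ tk).
    have := l2_coord_le (hardy_vec (t k)) i; rewrite hardy_vecE// /hardy_coord sqnormM sqnorm_real.
    by rewrite sqr_sqrtr ?(ltW (coef0 i))// -sqrtrM ?(ltW (coef0 i))// => HH; apply: ler_wsqrtr.
  have sc0 : 0 < Num.sqrt (coef i) by rewrite sqrtr_gt0.
  split; apply/cvgrPdist_lt => e e0.
    have : 0 < Num.sqrt (coef i) * e by rewrite mulr_gt0.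
    move=> /small; apply: filterS => k Hk; rewrite sub0r normrN.
    have [HH _] := parts_le_normc (cmoment i (t k)); apply: le_lt_trans HH _.
    by rewrite -(ltr_pM2l sc0); apply: le_lt_trans (bnd k) Hk.
  have : 0 < Num.sqrt (coef i) * e by rewrite mulr_gt0.
  move=> /small; apply: filterS => k Hk; rewrite sub0r normrN.
  have [_ HH] := parts_le_normc (cmoment i (t k)); apply: le_lt_trans HH _.
  by rewrite -(ltr_pM2l sc0); apply: le_lt_trans (bnd k) Hk.
have ball k : cball (Re \o t k) /\ cball (Im \o t k).
  have [r [r0 r1 sf]] := test0_ccsupp (proj1 (Ht k)); have [fr fi] := ccsupp_parts sf.
  by split; exists r.
apply: nrm_small => e e0.
have e20 : 0 < e / 4 by rewrite divr_gt0.
have [N _ HN] := small _ e20.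
have HNN := HN N (leqnn N); rewrite /= in HNN.
have near_le : \forall k \near \oo, nrm (iota (t N) - iota (t k)) <= e / 4 + e / 4.
  exists N => // k /= Nk; apply: le_trans (nrm_tri x _ _) _.
  rewrite nrmBC; apply: lerD; apply: ltW.
    by apply: lt_trans (proj2 (Ht N)) _; exact: HNN.
  by apply: lt_trans (proj2 (Ht k)) _; exact: HN.
have near2 : \forall k \near \oo,
    rform s (fun x => (Re \o t N) x - (Re \o t k) x) (fun x => (Re \o t N) x - (Re \o t k) x) +
    rform s (fun x => (Im \o t N) x - (Im \o t k) x) (fun x => (Im \o t N) x - (Im \o t k) x)
      <= (e / 4 + e / 4) ^+ 2.
  apply: filterS near_le => k Hk.
  have td := test0_lin (-1) (proj1 (Ht k)) (proj1 (Ht N)).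
  have [r [r0 r1 sd]] := test0_ccsupp td.
  have := nrm_iota r0 r1 sd.
  rewrite (iota_test0_lin _ (proj1 (Ht k)) (proj1 (Ht N))) scaleN1r [- _ + _]addrC => Hd.
  have -> : (fun x => (Re \o t N) x - (Re \o t k) x) = Re \o (fun x => -1 * t k x + t N x).
    by apply/funext => y /=; rewrite mulN1r; case: (t N y) => ? ?; case: (t k y) => ? ? /=; ring.
  have -> : (fun x => (Im \o t N) x - (Im \o t k) x) = Im \o (fun x => -1 * t k x + t N x).
    by apply/funext => y /=; rewrite mulN1r; case: (t N y) => ? ?; case: (t k y) => ? ? /=; ring.
  by rewrite -Hd lerXn2r// ?nnegrE ?nrm_ge0// addr_ge0// ltW.
(* Nonnegativity of both energies lets the bound on their sum pass to each of them. *)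
have pos_r k : 0 <= rform s (fun x => (Re \o t N) x - (Re \o t k) x) (fun x => (Re \o t N) x - (Re \o t k) x).
  by apply: rform_ge0 => //; apply: cballB; [exact: (proj1 (ball N))|exact: (proj1 (ball k))].
have pos_i k : 0 <= rform s (fun x => (Im \o t N) x - (Im \o t k) x) (fun x => (Im \o t N) x - (Im \o t k) x).
  by apply: rform_ge0 => //; apply: cballB; [exact: (proj2 (ball N))|exact: (proj2 (ball k))].
have Er : rform s (Re \o t N) (Re \o t N) <= (e / 4 + e / 4) ^+ 2.
  apply: (@energy_moment0 _ _ s01 (fun k => Re \o t k) N).
  - by move=> k; exact: (proj1 (ball k)).
  - by move=> i; exact: (proj1 (mom0 i)).
  - by apply: filterS near2 => k; apply: le_trans; rewrite lerDl.
have Ei : rform s (Im \o t N) (Im \o t N) <= (e / 4 + e / 4) ^+ 2.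
  apply: (@energy_moment0 _ _ s01 (fun k => Im \o t k) N).
  - by move=> k; exact: (proj2 (ball k)).
  - by move=> i; exact: (proj2 (mom0 i)).
  - by apply: filterS near2 => k; apply: le_trans; rewrite lerDr.
have [r [r0 r1 sN]] := test0_ccsupp (proj1 (Ht N)).
have nN := nrm_iota r0 r1 sN.
have nN2 : nrm (iota (t N)) <= 3 / 4 * e.
  rewrite -(@ler_pXn2r _ 2)// ?nnegrE ?nrm_ge0 ?mulr_ge0 ?(ltW e0)// nN.
  exact: quarter_sq Er Ei.
have -> : e = e / 4 + 3 / 4 * e by field.
rewrite -(subrK (iota (t N)) x); apply: le_trans (nrmD _ _) _; apply: lerD nN2.
by apply/ltW; apply: lt_trans (proj2 (Ht N)) HNN.
Qed.

End Realization.

(** * The eigenvalues a^(s-1-2n) *)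

Section Eigenvalues.
Context {R : realType}.
Variables (s a : R).
Hypotheses (s1 : s < 1) (a1 : 1 < a).

Definition eigval n : R := a `^ (s - 1 - 2 * n%:R).

Let a0 : 0 < a. Proof. by rewrite (lt_trans _ a1). Qed.

Lemma eigval_gt0 n : 0 < eigval n.
Proof. exact: powR_gt0. Qed.

Lemma eigvalE n : eigval n = a `^ (s - 1) * (a ^- 2) ^+ n.
Proof.
rewrite /eigval powRD; last by rewrite (gt_eqF a0) implybT.
congr (_ * _); rewrite -natrM powR_invn ?(ltW a0)//.
by rewrite exprM exprVn.
Qed.

Let q0 : 0 < a ^- 2. Proof. by rewrite invr_gt0 exprn_gt0. Qed.
Let q1 : a ^- 2 < 1. Proof. by rewrite invf_lt1 ?exprn_gt0// exprn_egt1. Qed.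

Lemma eigval_dec m n : (m < n)%N -> eigval n < eigval m.
Proof.
move=> mn; rewrite !eigvalE ltr_pM2l ?powR_gt0//.
by rewrite ltr_iXn2l// ?(ltW q1).
Qed.

Lemma eigval_le1 n : eigval n <= 1.
Proof.
rewrite eigvalE -[leRHS]mulr1; apply: ler_pM.
- exact: powR_ge0.
- by rewrite exprn_ge0 ?(ltW q0).
- by rewrite -[leRHS](powRr0 a) ler_powR ?(ltW a1)// subr_le0 ltW.
- by rewrite exprn_ile1 ?(ltW q0) ?(ltW q1).
Qed.

Lemma eigval_cvg : eigval n @[n --> \oo] --> (0 : R).
Proof.
have := @cvg_geometric R (a `^ (s - 1)) (a ^- 2); rewrite ger0_norm ?(ltW q0)// => /(_ q1).
by rewrite (_ : eigval = geometric (a `^ (s - 1)) (a ^- 2))//; apply/funext => n; rewrite eigvalE.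
Qed.

(** [a^(s+1)] is the prefactor of [U], and [(a^2)^-(n+1)] comes from substituting [a^2 x] in the
    n-th moment, the additional 1 being the Jacobian. *)
Lemma dilation_eigval n : a `^ (s + 1) / (a ^+ 2) ^+ n.+1 = eigval n.
Proof.
have -> : eigval n = a `^ (s + 1 - (2 * n.+1)%N%:R).
  by rewrite /eigval; congr powR; rewrite natrM -natr1; ring.
rewrite [in RHS]powRD; last by rewrite (gt_eqF a0) implybT.
by rewrite powR_invn ?(ltW a0)// exprM.
Qed.

End Eigenvalues.

(** * Construction of W, S(a) and the adjoint of W on all of K_s *)

Theorem mainTheorem2 (R : realType) (s a : R) (H : hilbertType R)
    (iota : (R -> R[i]) -> H) (U J P : {linear H -> H}) :
  0 < s < 1 -> 1 < a ->
  is_riesz_completion s iota ->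
  is_dilation s a iota U ->
  is_inversion s iota J ->
  orthogonal_projection (Ks iota) P ->
  (forall x, Ks iota x -> Ks iota (U x)) /\
  exists (HK : hilbertType R) (S : {linear HK -> HK})
         (W : {linear H -> HK}) (Wadj : {linear HK -> H}),
    [/\ bounded_operator S /\ selfadjoint S,
        contraction_on (Ks iota) W /\ adjoint_on (Ks iota) W Wadj,
        (forall x, Ks iota x -> W x = 0 -> x = 0) /\
        (forall y, Wadj y = 0 -> y = 0),
        (forall x, Ks iota x -> Wadj (W x) = P (J (P x))) /\
        (forall x, Ks iota x -> S (W x) = W (U (P x)))
      & spectrum S = [set (a `^ (s - 1 - 2 * n%:R))%:C | n in @setT nat] `|` [set 0] /\
        point_spectrum S = [set (a `^ (s - 1 - 2 * n%:R))%:C | n in @setT nat]].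
Proof.
move=> s01 a1 hC [uU UE] hJ hP.
have [s0 s1] := andP s01.
have a0 : 0 < a by rewrite (lt_trans _ a1).
have c1 : 1 < a ^+ 2 by rewrite exprn_egt1.
have c0 : 0 < a ^+ 2 by rewrite (lt_trans _ c1).
have [uJ _ _] := hJ.
have KE := Ks_test0 s01 hC.
have Klin := Ks_lin s01 hC.
have Kcl : closure (Ks iota) `<=` Ks iota by apply: closureP_sub.
(* Dilation by [a^2 > 1] shrinks the support radius from [r] to [r / a^2], and [U] preserves
   norms. *)
have KU x : Ks iota x -> Ks iota (U x).
  move=> /closure_nrm Kx; apply/closure_nrm => e e0; have [_ [f Cf <-] Hf] := Kx e e0.
  have [r [r0 r1 sf]] := Cc_ccsupp Cf.
  exists (U (iota f)); last by rewrite -linearB (unitary_nrm _ uU).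
  exists (fun x => (a `^ (s + 1))%:C * f (a ^+ 2 * x)).
    apply: (ccsupp_Cc1 _ (ccsupp_dil (a `^ (s + 1)) c0 sf)).
    by rewrite ltr_pdivrMr// mul1r (lt_trans r1).
  by rewrite UE//; exact: ccsupp_CcT sf.
split => //.
have PK x : Ks iota x -> P x = x.
  move=> Kx; have [KPx Px] := hP x.
  have := Px _ (Klin (-1) _ _ KPx Kx); rewrite scaleN1r [- _ + _]addrC => /hdotxx_eq0 /eqP.
  by rewrite subr_eq0 => /eqP.
have Pdot k x : Ks iota k -> '<< k, P x >> = '<< k, x >>.
  move=> Kk; have [_ /(_ k Kk)] := hP x; rewrite hdotBr => /eqP.
  by rewrite subr_eq0 => /eqP.
have Pnrm x : nrm (P x) <= nrm x.
  have [KPx _] := hP x; have := hdot_CS (P x) x; rewrite -(Pdot _ _ KPx) hdotxx_nrm.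
  rewrite ger0_norm ?ler0c ?exprn_ge0 ?nrm_ge0// lecR expr2.
  have [-> _|n0] := eqVneq (nrm (P x)) 0; first exact: nrm_ge0.
  by rewrite ler_pM2l// lt_neqAle eq_sym n0 nrm_ge0.
(* W is made total on the ambient space by composition with [P]; on test functions it is
   [hardy_vec]. *)
have [W hW] := @extend_contraction R H l2_hilbert _ test0 iota (hardy_vec s) P
  (fun c t t' tt tt' => ex_intro _ (fun x => c * t x + t' x)
     (And3 (test0_lin c tt tt') (iota_test0_lin hC c tt tt') (hardy_vec_lin s01 hC hJ c tt tt')))
  (fun t tt => hardy_vec_le s01 hC hJ tt)
  (fun x => eq_ind _ (fun A => A (P x)) (proj1 (hP x)) _ KE).
have Kiota f : test0 f -> Ks iota (iota f).
  by move=> tf; apply: sub_closure_nrm; exists f => //; exact: test0_Cc1.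
have Wiota f : test0 f -> W (iota f) = hardy_vec s f.
  move=> tf; apply/eqP; rewrite -subr_eq0; apply/eqP/nrm_small => e e0.
  by apply: le_trans (hW _ _ tf) _; rewrite PK ?subrr ?nrm0 ?(ltW e0)//; exact: Kiota.
have approx x e : Ks iota x -> 0 < e -> exists2 f, test0 f & nrm (x - iota f) < e.
  by rewrite KE => /closure_nrm Kx e0; have [_ [f tf <-] Hf] := Kx e e0; exists f.
have Wle x : nrm (W x) <= nrm x.
  apply: le_trans (Pnrm x); apply/ler_addgt0Pr => e e0.
  have e20 : 0 < e / 2 by rewrite divr_gt0.
  have [f tf Hf] := approx _ _ (proj1 (hP x)) e20.
  have h1 := hW x f tf; have h2 := hardy_vec_le s01 hC hJ tf.
  have h3 := nrmD (W x - hardy_vec s f) (hardy_vec s f : l2_hilbert).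
  rewrite subrK in h3; rewrite -[l2n _]/(nrm (hardy_vec s f : l2_hilbert)) in h2.
  have h4 := nrmD (iota f - P x) (P x); rewrite subrK nrmBC in h4.
  lra.
have [S [SE Sn]] := @diag_exists R (fun n => (eigval s a n)%:C) 1 ler01
  (fun i => le_trans (eq_ind_r (fun z => z <= eigval s a i ^+ 2) (lexx _) (sqnorm_real _))
     (lerXn2r 2 (ltW (eigval_gt0 s a1 i)) ler01 (eigval_le1 s1 a1 i))).
have dilW f n : test0 f -> l2c (hardy_vec s (fun x => (a `^ (s + 1))%:C * f (a ^+ 2 * x))) n =
    (eigval s a n)%:C * l2c (hardy_vec s f) n.
  move=> tf; have [r [r0 _ sf]] := test0_ccsupp tf.
  rewrite !(hardy_vecE s01 hC hJ)//; last exact: test0_dil.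
  by rewrite /hardy_coord (cmoment_dil _ _ c0 r0 sf) dilation_eigval// mulrCA.
have SWiota f : test0 f -> S (W (iota f)) = W (U (iota f)).
  move=> tf; rewrite UE; last exact: test0_CcT.
  rewrite !Wiota//; last exact: test0_dil.
  by apply: l2P => n; rewrite SE dilW.
(* The identity holds on test functions; both sides are contractions in [x], so an approximation
   within [e / 2] suffices. *)
have SW x : Ks iota x -> S (W x) = W (U x).
  move=> Kx; apply/eqP; rewrite -subr_eq0; apply/eqP/(@nrm_small R l2_hilbert) => e e0.
  have e20 : 0 < e / 2 by rewrite divr_gt0.
  have [f tf Hf] := approx _ _ Kx e20.
  have E : S (W x) - W (U x) = S (W (x - iota f)) - W (U (x - iota f)).
    have cancelB (p q r : l2_hilbert) : p - q = (p - r) - (q - r).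
      by rewrite opprB addrA subrK.
    have -> : S (W (x - iota f)) = S (W x) - S (W (iota f)) by rewrite !linearB.
    have -> : W (U (x - iota f)) = W (U x) - W (U (iota f)) by rewrite !linearB.
    by rewrite SWiota//; exact: cancelB.
  have h1 := Sn (W (x - iota f)); rewrite mul1r in h1.
  have h2 := Wle (x - iota f); have h3 := Wle (U (x - iota f)).
  rewrite (unitary_nrm _ uU) in h3.
  have h4 := nrmD (S (W (x - iota f)) : l2_hilbert) (- W (U (x - iota f))).
  rewrite nrmN -E in h4.
  rewrite -[l2n (S _)]/(nrm (S (W (x - iota f)) : l2_hilbert)) in h1.
  rewrite -[l2n (W _)]/(nrm (W (x - iota f))) in h1.
  lra.
have Wdense y : closure (W @` Ks iota) y.
  apply: (@diag_invariant_full R (eigval s a) S (eigval_gt0 s a1) (eigval_dec s a1) SE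
    (closure (W @` Ks iota))).
  - apply: (@closure_subspace R l2_hilbert) => c _ _ [x Kx <-] [x' Kx' <-].
    by exists (c *: x + x'); [exact: Klin|rewrite linearP].
  - move=> x Hx; apply: (@closureP_sub R l2_hilbert (closure (W @` Ks iota)) (W @` Ks iota)) => //.
    by apply/(@closure_nrm R l2_hilbert) => e e0; have [z Lz Hz] := Hx e e0; exists z.
  - move=> x /(@closure_nrm R l2_hilbert) Lx; apply/(@closure_nrm R l2_hilbert) => e e0.
    have [_ [z Kz <-] Hz] := Lx e e0.
    exists (S (W z)); first by exists (U z); [exact: KU|rewrite SW].
    rewrite -linearB; apply: le_lt_trans Hz.
    by have := Sn (x - W z); rewrite mul1r.
  (* The bump [tent n] has positive n-th moment, so its image has a nonzero n-th coordinate. *)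
  - move=> n; pose f (x : R) : R[i] := (tent n x)%:C.
    have tf : test0 f.
      exists 4^-1, (3 / 4); split; [by []|lra|lra|].
      have [cb sb] := @tent_annulus R n; split; last first.
        by move=> x fx; apply: sb; apply: contraNneq fx; rewrite /f => ->.
      by apply/continuous_parts; split => [//|x]; exact: cvg_cst.
    exists (W (iota f)); first by apply: subset_closure; exists (iota f) => //; exact: Kiota.
    rewrite Wiota// (hardy_vecE s01 hC hJ)// /hardy_coord mulf_neq0//.
      apply/eqP => /complexI /eqP; apply/negP; rewrite gt_eqF// sqrtr_gt0 bin_coef_gt0//.
      by rewrite subr_gt0.
    apply/eqP => /(congr1 (@complex.Re R)) /= /eqP; apply/negP; rewrite gt_eqF//.
    exact: tent_moment.
(* Equality holds on test functions by [hardy_vec_dot]; each side is Lipschitz in either argument,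
   so it extends first in the second argument, then in the first. *)
have WW x x' : Ks iota x -> Ks iota x' -> '<< W x, W x' >> = '<< x, J x' >>.
  have lipl z x1 x2 : `|('<< W x1, W z >> - '<< x1, J z >>) - ('<< W x2, W z >> - '<< x2, J z >>)|
      <= ((2 * nrm z) * nrm (x1 - x2))%:C.
    have -> : ('<< W x1, W z >> - '<< x1, J z >>) - ('<< W x2, W z >> - '<< x2, J z >>) =
       '<< W (x1 - x2), W z >> - '<< x1 - x2, J z >>.
      by rewrite (linearB W) !hdotBl; ring.
    apply: le_trans (ler_normB _ _) _.
    apply: le_trans (lerD (hdot_CS _ _) (hdot_CS _ _)) _.
    rewrite -rmorphD lecR (unitary_nrm _ uJ).
    have h1 := ler_pM (nrm_ge0 _) (nrm_ge0 _) (Wle (x1 - x2)) (Wle z).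
    lra.
  have lipr z x1 x2 : `|('<< W z, W x1 >> - '<< z, J x1 >>) - ('<< W z, W x2 >> - '<< z, J x2 >>)|
      <= ((2 * nrm z) * nrm (x1 - x2))%:C.
    have -> : ('<< W z, W x1 >> - '<< z, J x1 >>) - ('<< W z, W x2 >> - '<< z, J x2 >>) =
       '<< W z, W (x1 - x2) >> - '<< z, J (x1 - x2) >>.
      by rewrite (linearB W) (linearB J) !hdotBr; ring.
    apply: le_trans (ler_normB _ _) _.
    apply: le_trans (lerD (hdot_CS _ _) (hdot_CS _ _)) _.
    rewrite -rmorphD lecR (unitary_nrm _ uJ).
    have h1 := ler_pM (nrm_ge0 _) (nrm_ge0 _) (Wle z) (Wle (x1 - x2)).
    lra.
  have n2 (z : H) : 0 <= 2 * nrm z by rewrite mulr_ge0 ?nrm_ge0.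
  move=> Kx Kx'; apply/eqP; rewrite -subr_eq0; apply/eqP.
  rewrite KE in Kx Kx'.
  apply: (@lipschitz_closure_eq0 R H (iota @` test0)
    (fun z => '<< W x, W z >> - '<< x, J z >>) _ (n2 x) (lipr x) _ x' Kx') => _ [g tg <-].
  apply: (@lipschitz_closure_eq0 R H (iota @` test0)
    (fun z => '<< W z, W (iota g) >> - '<< z, J (iota g) >>) _ (n2 (iota g)) (lipl (iota g)) _ x Kx) => _ [f tf <-].
  rewrite !Wiota// -(hardy_vec_dot s01 hC hJ tf tg) -[hdot _ _]/(l2dot _ _).
  by rewrite subrr.
(* [|P J x|^2 = <P J x, J x> = <W P J x, W x> <= |P J x| |W x|]: hence [P J P x] depends
   contractively on [W x], as the extension to the closure of the range requires. *)
have contr x : Ks iota x -> nrm (P (J (P x))) <= nrm (W x).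
  move=> Kx; rewrite (PK _ Kx); have [KP _] := hP (J x).
  have := hdot_CS (W (P (J x))) (W x); rewrite WW// -(Pdot _ _ KP) hdotxx_nrm.
  rewrite ger0_norm ?ler0c ?exprn_ge0 ?nrm_ge0// lecR expr2 => HH.
  have HH2 : nrm (P (J x)) * nrm (P (J x)) <= nrm (P (J x)) * nrm (W x).
    by apply: le_trans HH _; rewrite ler_wpM2r ?nrm_ge0.
  have [->|n0] := eqVneq (nrm (P (J x))) 0; first exact: nrm_ge0.
  by move: HH2; rewrite ler_pM2l// lt_neqAle eq_sym n0 nrm_ge0.
have [Wadj hWadj] := @extend_contraction R l2_hilbert H _ (Ks iota) W (fun x => P (J (P x)))
  (@idfun (l2 R) : {linear _ -> _})
  (fun c t t' Kt Kt' => ex_intro _ (c *: t + t')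
     (And3 (Klin c t t' Kt Kt') (linearP W c t t')
       (etrans (congr1 P (etrans (congr1 J (linearP P c t t')) (linearP J c _ _))) (linearP P c _ _))))
  contr Wdense.
have K0 : Ks iota 0 by have [KP _] := hP 0; rewrite linear0 in KP.
have WadjW x : Ks iota x -> Wadj (W x) = P (J (P x)).
  move=> Kx; apply/eqP; rewrite -subr_eq0; apply/eqP/nrm_small => e e0.
  by apply: le_trans (hWadj (W x) x Kx) _; rewrite /= subrr nrm0 ltW.
have Wadjle y : nrm (Wadj y) <= nrm (y : l2_hilbert).
  by have := hWadj y 0 K0; rewrite (linear0 P) (linear0 J) (linear0 P) (linear0 W) /= !subr0.
have KWadj y : Ks iota (Wadj y).
  apply: Kcl; apply/closure_nrm => e e0.
  have /(@closure_nrm R l2_hilbert)/(_ e e0) [_ [x Kx <-] Hx] := Wdense y.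
  exists (P (J (P x))); first exact: (proj1 (hP _)).
  exact: le_lt_trans (hWadj y x Kx) Hx.
(* Both sides are Lipschitz in [y], so [y = W x'] suffices; there [<P J x', x> = <J x', x>] is the
   conjugate of [<x, J x'> = <W x, W x'>]. *)
have adj y x : Ks iota x -> '<< Wadj y, x >> = '<< y : l2_hilbert, W x >>.
  move=> Kx; apply/eqP; rewrite -subr_eq0; apply/eqP.
  have n2 : 0 <= 2 * nrm x by rewrite mulr_ge0 ?nrm_ge0.
  apply: (@lipschitz_closure_eq0 R l2_hilbert (W @` Ks iota)
    (fun y => '<< Wadj y, x >> - '<< y : l2_hilbert, W x >>) _ n2) => //.
    move=> y1 y2.
    have -> : ('<< Wadj y1, x >> - '<< y1, W x >>) - ('<< Wadj y2, x >> - '<< y2, W x >>) =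
       '<< Wadj (y1 - y2), x >> - '<< y1 - y2, W x >>.
      by rewrite (linearB Wadj) !hdotBl; ring.
    apply: le_trans (ler_normB _ _) _.
    apply: le_trans (lerD (hdot_CS _ _) (hdot_CS _ _)) _.
    rewrite -rmorphD lecR.
    have h1 := ler_pM (nrm_ge0 _) (nrm_ge0 _) (Wadjle (y1 - y2)) (lexx (nrm x)).
    have h2 := ler_pM (nrm_ge0 _) (nrm_ge0 _) (lexx (nrm (y1 - y2))) (Wle x).
    lra.
  move=> _ [x' Kx' <-]; rewrite WadjW// (PK _ Kx') WW//.
  by rewrite hdotC Pdot// -(WW _ _ Kx Kx') -hdotC WW// subrr.
exists l2_hilbert, S, W, Wadj; split.
- split; first by exists 1 => x; rewrite mul1r !nrmE lecR; have := Sn x; rewrite mul1r.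
  move=> x y; rewrite -[hdot _ _]/(l2dot (S x) y) -[RHS]/(l2dot x (S y)) /l2dot /l2r /l2i.
  have E i : (l2c (S x) i)^* * l2c y i = (l2c x i)^* * l2c (S y) i.
    by rewrite !SE conjM conj_realE; ring.
  by congr Complex; congr (limn (series _)); apply/funext => i; rewrite E.
- split; first by move=> x _; rewrite !nrmE lecR.
  by move=> y; split=> // x Kx; exact: adj.
- split.
    (* With [W x = 0], the estimate that defines W is exactly the hypothesis of [Ks_inj]. *)
    move=> x Kx Wx0; apply: (Ks_inj s01 hC hJ Kx) => f tf.
    have := hW x f tf; rewrite Wx0 sub0r nrmN (PK _ Kx); exact.
  (* A vector killed by the adjoint is orthogonal to the range of W, which is dense. *)
  move=> y y0; apply: (@hdot_dense0 R l2_hilbert _ y Wdense) => _ [x Kx <-].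
  by rewrite -adj// y0 hdotC hdot0r rmorph0.
- by split=> x Kx; [exact: WadjW|rewrite (PK _ Kx) SW].
- split.
    exact: (diag_spectrum (eigval_gt0 s a1) SE (eigval_cvg s a1)).
  exact: (diag_point_spectrum SE).
Qed.
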